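(* Let $(\mathfrak{d},\mathfrak{g})$ be a Manin pair, $(D,\Omega+\Theta)$ a 2-shifted symplectic Lie group integrating $(\mathfrak{d},\langle\cdot,\cdot\rangle)$, and $\Phi:(\mathcal{H},\sigma)\to D$, $\mathcal{H}\rightrightarrows N$, a multiplicative $D$-valued moment map with corresponding Dirac structure $\mathbf{L}\subseteq\mathbb{T}N\times\mathfrak{d}$. Let $\mathfrak{l}\subseteq\mathfrak{d}$ be a lagrangian subalgebra and $L\to D$ a Lie group morphism integrating the inclusion $\mathfrak{l}\hookrightarrow\mathfrak{d}$ that is a lagrangian morphism with respect to the zero 2-form on $L$. Suppose that $\Phi:\mathcal{H}\to D$ is transverse to $L\to D$. Then $$\mathbf{L}_{\mathfrak{l}}:=\{(X,\alpha)\ |\ \exists\,l\in\mathfrak{l}\text{ with }((X,\alpha),l)\in\mathbf{L}\}\subseteq\mathbb{T}N$$ is a Dirac structure, and the Lie groupoid $\mathcal{G}_L:=\mathcal{H}\times_DL\rightrightarrows N$ equipped with $\sigma_L:=\mathrm{pr}_1^*\sigma\in\Omega^2(\mathcal{G}_L)$ is a quasi-symplectic groupoid integrating $\mathbf{L}_{\mathfrak{l}}$.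
   Context: Everything is real and $C^\infty$. For a Lie groupoid $\mathcal{H}\rightrightarrows N$: source $\mathtt{s}$, target $\mathtt{t}$, multiplication $\mathtt{m}$ (defined when $\mathtt{s}(g)=\mathtt{t}(h)$), unit $\epsilon$; $A_{\mathcal{H}}=\ker(T\mathtt{s})|_N$, anchor $\mathtt{a}_{\mathcal{H}}=T\mathtt{t}$, bracket by right-invariant vector fields (same for Lie groups); $u^r,u^l$ are right/left-invariant vector fields; $\lambda_\sigma(u)=(i_u\sigma)|_{TN}$ for $u\in A_{\mathcal{H}}$. Manin pair $(\mathfrak{d},\mathfrak{g})$: a quadratic Lie algebra $\mathfrak{d}$ with a lagrangian Lie subalgebra $\mathfrak{g}$. 2-shifted symplectic Lie group $(D,\Omega+\Theta)$: $\Omega\in\Omega^2(D\times D)$, whose pullbacks along $k\mapsto(1,k)$ and $k\mapsto(k,1)$ vanish, and $\Theta\in\Omega^3(D)$, such that $\delta\Omega=0$, $\delta\Theta=\mathrm{pr}_1^*\Theta+\mathrm{pr}_2^*\Theta-\mathtt{m}^*\Theta=-d\Omega$, $d\Theta=0$, where $\delta\Omega=(k_2,k_3)^*\Omega-(k_1k_2,k_3)^*\Omega+(k_1,k_2k_3)^*\Omega-(k_1,k_2)^*\Omega$, and with $\langle u,v\rangle_\Omega=-\Omega_{(1,1)}((u,0),(0,v))+\Omega_{(1,1)}((0,u),(v,0))$ nondegenerate; it integrates $(\mathfrak{d},\langle\cdot,\cdot\rangle)$ if $\mathrm{Lie}(D)=\mathfrak{d}$ and $\langle\cdot,\cdot\rangle_\Omega=\langle\cdot,\cdot\rangle$.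 Lagrangian morphism $(\mathcal{H},\Phi,\sigma+\eta)$ into $D$: a Lie groupoid morphism $\Phi:\mathcal{H}\to D$, $\sigma\in\Omega^2(\mathcal{H})$ with $\epsilon^*\sigma=0$, closed $\eta\in\Omega^3(N)$, with $\mathrm{pr}_1^*\sigma+\mathrm{pr}_2^*\sigma-\mathtt{m}^*\sigma=\Phi^*\Omega$, $\mathtt{s}^*\eta-\mathtt{t}^*\eta-d\sigma=\Phi^*\Theta$, $\dim\mathcal{H}-2\dim N=\frac12\dim D$, $\ker(\sigma)\cap\ker(T\Phi)\cap\ker(T\mathtt{s})\cap\ker(T\mathtt{t})=0$. Its corresponding Dirac structure is $\mathbf{L}=(\mathtt{a}_{\mathcal{H}},\lambda_\sigma,\mathrm{Lie}(\Phi))(A_{\mathcal{H}})\subseteq\mathbb{T}_\eta N\times\mathfrak{d}$. In particular, for the Lie group morphism $\phi_L:L\to D$ being lagrangian with respect to the zero 2-form means that the pullbacks of $\Omega$ to $L\times L$ and of $\Theta$ to $L$ vanish (given that $\mathfrak{l}$ is lagrangian). $\mathbf{A}_{\mathfrak{g}}|_d=\{((u^r-v^l)|_d,\Omega|_{(1,d)}((0,\cdot),(u,0))-\Omega|_{(d,1)}((\cdot,0),(0,v))):u,v\in\mathfrak{g}\}\subset T_dD\oplus T^*_dD$. A multiplicative $D$-valued moment map is a Lie groupoid morphism $\Phi:\mathcal{H}\to D$ with $\sigma\in\Omega^2(\mathcal{H})$ such that $(\mathcal{H},\Phi,\sigma+0)$ is a lagrangian morphism into $D$, and $\Phi:(\mathcal{H},\sigma)\to(D,\mathbf{A}_{\mathfrak{g}})$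 is strong Dirac, i.e. $\ker(\sigma)\cap\ker(T\Phi)=0$ and $\mathbf{A}_{\mathfrak{g}}|_{\Phi(h)}=\{(T\Phi(Z),\beta):Z\in T_h\mathcal{H},\ i_Z\sigma=\Phi^*\beta\}$ for all $h$. $\mathbb{T}N=TN\oplus T^*N$ is the standard Courant algebroid (pairing $i_Y\alpha+i_X\beta$, bracket $[X,Y]+\mathcal{L}_X\beta-i_Yd\alpha$). A Dirac structure is a lagrangian subbundle with sections closed under the bracket. Quasi-symplectic groupoid (with $\eta=0$): a Lie groupoid $\mathcal{G}\rightrightarrows N$ with closed $\omega\in\Omega^2(\mathcal{G})$, $\mathtt{m}^*\omega=\mathrm{pr}_1^*\omega+\mathrm{pr}_2^*\omega$, $\dim\mathcal{G}=2\dim N$, $\ker(T\mathtt{s})_x\cap\ker(\omega)_x\cap\ker(T\mathtt{t})_x=0$ for $x\in N$; it integrates the Dirac structure $(\mathtt{a}_{\mathcal{G}},\lambda_\omega)(A_{\mathcal{G}})\subset\mathbb{T}N$. *)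

(* Defs.v *)
From HB Require Import structures.
From mathcomp Require Import all_boot all_order all_algebra.
From mathcomp Require Import all_classical all_reals all_analysis.
Import Order.TTheory GRing.Theory Num.Theory.
Import numFieldNormedType.Exports.

Set Implicit Arguments.
Unset Strict Implicit.
Unset Printing Implicit Defensive.

Local Open Scope classical_set_scope.
Local Open Scope ring_scope.

(** A manifold is presented by its topology together with its algebra of
    smooth real functions; it is required to be locally diffeomorphic to open
    subsets of R^n, Hausdorff and second countable.  For such spaces the
    algebra of smooth functions is equivalent to a maximal smooth atlas.  The
    benefit is that products and subsets have canonical smooth structures,
    and the latter is the usual one on embedded submanifolds. *)

Fixpoint Cr (R : realType) (n k : nat) (f : 'rV[R]_n -> R) : Prop :=
  continuous f /\
  if k is k'.+1 then
    forall v : 'rV[R]_n,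
      (forall x, derivable f x v) /\ @Cr R n k' (fun x => 'D_v f x)
  else True.

Definition Cinfty (R : realType) (n : nat) (f : 'rV[R]_n -> R) : Prop :=
  forall k, Cr k f.

Record smooth_space (R : realType) := Space {
  spt :> topologicalType;
  smfun : set (spt -> R) }.

Arguments smfun {R} s _.

(* Functions that are locally smooth functions of finitely many members of F. *)
Definition sm_closure (R : realType) (T : topologicalType)
    (F : set (T -> R)) : set (T -> R) :=
  [set f | forall x : T, exists (k : nat) (a : 'I_k -> T -> R)
             (g : 'rV[R]_k -> R),
     [/\ forall i, F (a i), Cinfty g &
         \forall y \near x, f y = g (\row_i a i y)]].

Definition euclid (R : realType) (n : nat) : smooth_space R :=
  Space [set f : 'rV[R]_n -> R | Cinfty f].

Definition sprod (R : realType) (X Y : smooth_space R) : smooth_space R :=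
  @Space R (X * Y)%type
    (sm_closure [set f : X * Y -> R |
       (exists2 g, smfun X g & f = g \o fst) \/
       (exists2 g, smfun Y g & f = g \o snd)]).

Definition spair (R : realType) (X Y : smooth_space R) (x : X) (y : Y) :
  sprod X Y := (x, y).

Definition ssub (R : realType) (X : smooth_space R) (A : set X) : smooth_space R :=
  @Space R (set_type A)
    (sm_closure [set f : set_type A -> R |
       exists2 g, smfun X g & f = g \o set_val]).

Definition smooth_map (R : realType) (X Y : smooth_space R) (f : X -> Y) : Prop :=
  forall g, smfun Y g -> smfun X (g \o f).

Definition diffeomorphic (R : realType) (X Y : smooth_space R) : Prop :=
  exists (f : X -> Y) (g : Y -> X),
    [/\ cancel f g /\ cancel g f, continuous f, continuous g,
        smooth_map f & smooth_map g].

Definition manifold (R : realType) (n : nat) (M : smooth_space R) : Prop :=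
  [/\ hausdorff_space M, @second_countable M,
      sm_closure (smfun M) `<=` smfun M &
      forall x : M, exists (U : set M) (V : set (euclid R n)),
        [/\ open U, U x, open V & diffeomorphic (ssub U) (ssub V)]].

Definition tvec (R : realType) (M : smooth_space R) : Type := (M -> R) -> R^o.
HB.instance Definition _ (R : realType) (M : smooth_space R) :=
  GRing.Lmodule.copy (tvec M) ((M -> R) -> R^o).

Definition tcovec (R : realType) (M : smooth_space R) : Type := tvec M -> R^o.
HB.instance Definition _ (R : realType) (M : smooth_space R) :=
  GRing.Lmodule.copy (tcovec M) (tvec M -> R^o).

(* Tangent vectors at x are the derivations at x of the algebra of smooth
   functions, extended by 0 to all functions so that equality of tangent
   vectors is equality of terms.  Sums and multiples are those of functions. *)
Definition tangent (R : realType) (M : smooth_space R) (x : M)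
    (v : tvec M) : Prop :=
  [/\ forall f, ~ smfun M f -> v f = 0,
      forall (c : R) f g, smfun M f -> smfun M g ->
        v (fun y => c * f y + g y) = c * v f + v g &
      forall f g, smfun M f -> smfun M g ->
        v (fun y => f y * g y) = f x * v g + g x * v f].

Definition tmap (R : realType) (M N : smooth_space R) (f : M -> N)
    (v : tvec M) : tvec N :=
  fun g => if `[< smfun N g >] then v (g \o f) else 0.

(* For covectors and forms, only the values on tangent vectors are relevant. *)
Definition covector (R : realType) (M : smooth_space R) (x : M)
    (a : tcovec M) : Prop :=
  forall (c : R) u v, tangent x u -> tangent x v ->
    a (c *: u + v) = c * a u + a v.

Definition vfield (R : realType) (M : smooth_space R) := M -> tvec M.
Definition form1 (R : realType) (M : smooth_space R) :=
  M -> tcovec M.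
Definition form2 (R : realType) (M : smooth_space R) :=
  M -> tvec M -> tcovec M.
Definition form3 (R : realType) (M : smooth_space R) :=
  M -> tvec M -> tvec M -> tcovec M.

Definition is_field (R : realType) (M : smooth_space R) (X : vfield M) : Prop :=
  (forall x, tangent x (X x)) /\
  (forall f, smfun M f -> smfun M (fun x => X x f)).

Definition is_form1 (R : realType) (M : smooth_space R) (a : form1 M) : Prop :=
  (forall x, covector x (a x)) /\
  (forall X, is_field X -> smfun M (fun x => a x (X x))).

Definition is_form2 (R : realType) (M : smooth_space R) (w : form2 M) : Prop :=
  [/\ forall x u, tangent x u -> covector x (w x u),
      forall x v, tangent x v -> covector x (fun u => w x u v),
      forall x u, tangent x u -> w x u u = 0 &
      forall X Y, is_field X -> is_field Y ->
        smfun M (fun x => w x (X x) (Y x))].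

Definition is_form3 (R : realType) (M : smooth_space R) (w : form3 M) : Prop :=
  [/\ forall x u v, tangent x u -> tangent x v ->
        [/\ covector x (w x u v), covector x (fun z => w x u z v) &
            covector x (fun z => w x z u v)],
      forall x u v, tangent x u -> tangent x v ->
        [/\ w x u u v = 0, w x v u u = 0 & w x u v u = 0] &
      forall X Y Z, is_field X -> is_field Y -> is_field Z ->
        smfun M (fun x => w x (X x) (Y x) (Z x))].

Definition zero_form2 (R : realType) (M : smooth_space R) : form2 M :=
  fun _ _ _ => 0.
Definition zero_form3 (R : realType) (M : smooth_space R) : form3 M :=
  fun _ _ _ _ => 0.

Definition pull2 (R : realType) (M N : smooth_space R) (f : M -> N)
    (w : form2 N) : form2 M :=
  fun x u v => w (f x) (tmap f u) (tmap f v).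

Definition pull3 (R : realType) (M N : smooth_space R) (f : M -> N)
    (w : form3 N) : form3 M :=
  fun x u v z => w (f x) (tmap f u) (tmap f v) (tmap f z).

Definition fbracket (R : realType) (M : smooth_space R) (X Y : vfield M) : vfield M :=
  fun x f => X x (fun y => Y y f) - Y x (fun y => X y f).

(* Exterior derivatives (d1, d2, d3) and the Lie derivative of a 1-form (lie1)
   are given by Cartan's formulas, i.e. through their values on vector fields. *)
Definition d1 (R : realType) (M : smooth_space R) (a : form1 M) (X Y : vfield M)
    (x : M) : R :=
  X x (fun y => a y (Y y)) - Y x (fun y => a y (X y))
  - a x (fbracket X Y x).

Definition d2 (R : realType) (M : smooth_space R) (w : form2 M) (X Y Z : vfield M)
    (x : M) : R :=
  X x (fun y => w y (Y y) (Z y)) - Y x (fun y => w y (X y) (Z y))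
  + Z x (fun y => w y (X y) (Y y))
  - w x (fbracket X Y x) (Z x) + w x (fbracket X Z x) (Y x)
  - w x (fbracket Y Z x) (X x).

Definition d3 (R : realType) (M : smooth_space R) (w : form3 M) (W X Y Z : vfield M)
    (x : M) : R :=
  W x (fun y => w y (X y) (Y y) (Z y)) - X x (fun y => w y (W y) (Y y) (Z y))
  + Y x (fun y => w y (W y) (X y) (Z y)) - Z x (fun y => w y (W y) (X y) (Y y))
  - w x (fbracket W X x) (Y x) (Z x) + w x (fbracket W Y x) (X x) (Z x)
  - w x (fbracket W Z x) (X x) (Y x) - w x (fbracket X Y x) (W x) (Z x)
  + w x (fbracket X Z x) (W x) (Y x) - w x (fbracket Y Z x) (W x) (X x).

Definition lie1 (R : realType) (M : smooth_space R) (X : vfield M) (b : form1 M)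
    (Z : vfield M) (x : M) : R :=
  X x (fun y => b y (Z y)) - b x (fbracket X Z x).

Definition closed2 (R : realType) (M : smooth_space R) (w : form2 M) : Prop :=
  forall X Y Z, is_field X -> is_field Y -> is_field Z ->
    forall x, d2 w X Y Z x = 0.

Definition closed3 (R : realType) (M : smooth_space R) (w : form3 M) : Prop :=
  forall W X Y Z, is_field W -> is_field X -> is_field Y -> is_field Z ->
    forall x, d3 w W X Y Z x = 0.

Definition gvec (R : realType) (M : smooth_space R) : Type :=
  tvec M * tcovec M.

Definition gfiber (R : realType) (M : smooth_space R) (x : M) (e : gvec M) : Prop :=
  tangent x e.1 /\ covector x e.2.

(* Equality of elements of the fiber at x: covectors are only compared on
   tangent vectors. *)
Definition geq (R : realType) (M : smooth_space R) (x : M) (e e' : gvec M) : Prop :=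
  e.1 = e'.1 /\ forall u, tangent x u -> e.2 u = e'.2 u.

Definition gpairing (R : realType) (M : smooth_space R) (e e' : gvec M) : R :=
  e.2 e'.1 + e'.2 e.1.

Definition gsection (R : realType) (M : smooth_space R) (E : M -> gvec M) : Prop :=
  is_field (fun x => (E x).1) /\ is_form1 (fun x => (E x).2).

(* E is the bracket [X, Y] + L_X b - i_Y (d a) of (X, a) and (Y, b). *)
Definition is_courant_bracket (R : realType) (M : smooth_space R)
    (E1 E2 E : M -> gvec M) : Prop :=
  let X := fun x => (E1 x).1 in let a := fun x => (E1 x).2 in
  let Y := fun x => (E2 x).1 in let b := fun x => (E2 x).2 in
  (forall x, (E x).1 = fbracket X Y x) /\
  (forall Z, is_field Z -> forall x,
     (E x).2 (Z x) = lie1 X b Z x - d1 a Y Z x).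

Definition subbundle (R : realType) (M : smooth_space R)
    (L : M -> set (gvec M)) : Prop :=
  forall x : M, exists (k : nat) (E : 'I_k -> M -> gvec M),
    (forall i, gsection (E i)) /\
    \forall y \near x,
      (forall c : 'I_k -> R,
         geq y (\sum_i c i *: (E i y).1, \sum_i c i *: (E i y).2) (0, 0) ->
         forall i, c i = 0) /\
      (forall e, L y e <-> gfiber y e /\ exists c : 'I_k -> R,
         geq y e (\sum_i c i *: (E i y).1, \sum_i c i *: (E i y).2)).

Definition dirac_structure (R : realType) (M : smooth_space R)
    (L : M -> set (gvec M)) : Prop :=
  [/\ forall x, L x `<=` gfiber x,
      subbundle L,
      forall x e, gfiber x e ->
        (L x e <-> forall e', L x e' -> gpairing e e' = 0) &
      forall E1 E2, gsection E1 -> gsection E2 ->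
        (forall x, L x (E1 x)) -> (forall x, L x (E2 x)) ->
        exists E, [/\ gsection E, is_courant_bracket E1 E2 E &
                      forall x, L x (E x)]].

(* [gm g h] is meaningful only when [gs g = gt h]. *)
Record groupoid (H N : Type) := Groupoid {
  gs : H -> N;
  gt : H -> N;
  gm : H -> H -> H;
  ge : N -> H;
  gi : H -> H;
  gs_m : forall g h, gs g = gt h -> gs (gm g h) = gs h;
  gt_m : forall g h, gs g = gt h -> gt (gm g h) = gt g;
  gmA : forall g h k, gs g = gt h -> gs h = gt k ->
    gm (gm g h) k = gm g (gm h k);
  gs_e : forall x, gs (ge x) = x;
  gt_e : forall x, gt (ge x) = x;
  gm_el : forall g, gm (ge (gt g)) g = g;
  gm_er : forall g, gm g (ge (gs g)) = g;
  gs_i : forall g, gs (gi g) = gt g;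
  gt_i : forall g, gt (gi g) = gs g;
  gm_il : forall g, gm (gi g) g = ge (gs g);
  gm_ir : forall g, gm g (gi g) = ge (gt g) }.

Definition composable (R : realType) (H N : smooth_space R) (G : groupoid H N) :
    smooth_space R :=
  ssub [set p : sprod H H | gs G p.1 = gt G p.2].

Definition cpr1 (R : realType) (H N : smooth_space R) (G : groupoid H N)
  (p : composable G) : H := (set_val p).1.
Definition cpr2 (R : realType) (H N : smooth_space R) (G : groupoid H N)
  (p : composable G) : H := (set_val p).2.
Definition cmul (R : realType) (H N : smooth_space R) (G : groupoid H N)
  (p : composable G) : H := gm G (cpr1 p) (cpr2 p).

Definition submersion (R : realType) (M N : smooth_space R) (f : M -> N) : Prop :=
  smooth_map f /\
  forall x v, tangent (f x) v -> exists2 u, tangent x u & tmap f u = v.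

Definition lie_groupoid (R : realType) (nH nN : nat) (H N : smooth_space R)
    (G : groupoid H N) : Prop :=
  [/\ manifold nH H, manifold nN N,
      submersion (gs G), submersion (gt G) &
      [/\ smooth_map (@cmul R H N G), smooth_map (ge G) & smooth_map (gi G)]].

(* Lie groups are the Lie groupoids over a point, for which we take R^0. *)
Definition spoint (R : realType) : smooth_space R := euclid R 0.

Definition lie_group (R : realType) (n : nat) (D : smooth_space R)
    (G : groupoid D (spoint R)) : Prop :=
  lie_groupoid n 0 G.

Definition gone (R : realType) (D : smooth_space R) (G : groupoid D (spoint R)) : D :=
  ge G (0 : 'rV[R]_0).

Definition multiplicative (H N D : Type) (P : Type)
    (G : groupoid H N) (GD : groupoid D P) (Phi : H -> D) : Prop :=
  forall g h, gs G g = gt G h -> Phi (gm G g h) = gm GD (Phi g) (Phi h).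

Definition cmap (R : realType) (H N D : smooth_space R) (G : groupoid H N)
    (Phi : H -> D) (p : composable G) : sprod D D :=
  spair (Phi (cpr1 p)) (Phi (cpr2 p)).

(* The fiber at x of the Lie algebroid ker(Ts)|_N. *)
Definition algebroid (R : realType) (H N : smooth_space R) (G : groupoid H N)
    (x : N) : set (tvec H) :=
  [set u | tangent (ge G x) u /\ tmap (gs G) u = 0].

Definition anchor (R : realType) (H N : smooth_space R) (G : groupoid H N)
    (u : tvec H) : tvec N := tmap (gt G) u.

Definition lambda (R : realType) (H N : smooth_space R) (G : groupoid H N)
    (sigma : form2 H) (x : N) (u : tvec H) : tcovec N :=
  fun Y => sigma (ge G x) u (tmap (ge G) Y).

Definition rinv (R : realType) (D : smooth_space R) (G : groupoid D (spoint R))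
    (u : tvec D) : vfield D := fun g => tmap (fun k : D => gm G k g) u.
Definition linv (R : realType) (D : smooth_space R) (G : groupoid D (spoint R))
    (u : tvec D) : vfield D := fun g => tmap (fun k : D => gm G g k) u.

Definition lie_algebra (R : realType) (V : vectType R) (br : V -> V -> V) :
    Prop :=
  [/\ forall u, linear (br u), forall v, linear (br^~ v),
      forall u, br u u = 0 &
      forall u v w, br u (br v w) + br v (br w u) + br w (br u v) = 0].

Definition quadratic_lie_algebra (R : realType) (V : vectType R)
    (br : V -> V -> V) (pr : V -> V -> R^o) : Prop :=
  lie_algebra br /\
  [/\ forall u, scalar (pr u), forall u v, pr u v = pr v u,
      forall u v w, pr (br u v) w = pr u (br v w) &
      forall u, (forall v, pr u v = 0) -> u = 0].

Definition lagrangian_subalgebra (R : realType) (V : vectType R)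
    (br : V -> V -> V) (pr : V -> V -> R^o) (U : {vspace V}) : Prop :=
  (forall u v, u \in U -> v \in U -> br u v \in U) /\
  (forall u, u \in U <-> forall v, v \in U -> pr u v = 0).

Definition manin_pair (R : realType) (V : vectType R)
    (br : V -> V -> V) (pr : V -> V -> R^o) (U : {vspace V}) : Prop :=
  quadratic_lie_algebra br pr /\ lagrangian_subalgebra br pr U.

(* j restricts to an isomorphism from the subalgebra U to Lie(G). *)
Definition lie_algebra_iso (R : realType) (V : vectType R)
    (br : V -> V -> V) (U : {vspace V}) (D : smooth_space R)
    (G : groupoid D (spoint R)) (j : {linear V -> tvec D}) : Prop :=
  [/\ forall u, u \in U -> tangent (gone G) (j u),
      forall u, u \in U -> j u = 0 -> u = 0,
      forall v, tangent (gone G) v -> exists2 u, u \in U & j u = v &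
      forall u v, u \in U -> v \in U ->
        j (br u v) = fbracket (rinv G (j u)) (rinv G (j v)) (gone G)].

Section TwoShifted.
Context (R : realType) (D : smooth_space R) (G : groupoid D (spoint R))
  (Omega : form2 (sprod D D)) (Theta : form3 D).

Definition pairing_of (u v : tvec D) : R :=
  let e := gone G in
  let l := tmap (fun k : D => spair k e) in
  let r := tmap (fun k : D => spair e k) in
  - Omega (spair e e) (l u) (r v) + Omega (spair e e) (r u) (l v).

Definition normalized : Prop :=
  forall (k : D) u v, tangent k u -> tangent k v ->
    pull2 (fun k : D => spair (gone G) k) Omega k u v = 0 /\
    pull2 (fun k : D => spair k (gone G)) Omega k u v = 0.

Definition delta_Omega_eq0 : Prop :=
  let D3 := sprod D (sprod D D) in
  forall (p : D3) u v, tangent p u -> tangent p v ->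
    pull2 (fun q : D3 => spair q.2.1 q.2.2) Omega p u v
    - pull2 (fun q : D3 => spair (gm G q.1 q.2.1) q.2.2) Omega p u v
    + pull2 (fun q : D3 => spair q.1 (gm G q.2.1 q.2.2)) Omega p u v
    - pull2 (fun q : D3 => spair q.1 q.2.1) Omega p u v = 0.

Definition delta_Theta_eq_dOmega : Prop :=
  forall X Y Z : vfield (sprod D D), is_field X -> is_field Y -> is_field Z ->
    forall p,
      pull3 (fun q : sprod D D => q.1) Theta p (X p) (Y p) (Z p)
      + pull3 (fun q : sprod D D => q.2) Theta p (X p) (Y p) (Z p)
      - pull3 (fun q : sprod D D => gm G q.1 q.2) Theta p (X p) (Y p) (Z p)
      = - d2 Omega X Y Z p.

Definition shifted_symplectic_group (n : nat) : Prop :=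
  [/\ lie_group n G, is_form2 Omega, is_form3 Theta, normalized &
      [/\ delta_Omega_eq0, delta_Theta_eq_dOmega, closed3 Theta &
          forall u, tangent (gone G) u ->
            (forall v, tangent (gone G) v -> pairing_of u v = 0) -> u = 0]].

Definition integrates_quadratic (V : vectType R) (br : V -> V -> V)
    (pr : V -> V -> R^o) (j : {linear V -> tvec D}) : Prop :=
  lie_algebra_iso br fullv G j /\
  forall u v, pairing_of (j u) (j v) = pr u v.

Definition lagrangian_morphism (nH nN n : nat) (H N : smooth_space R)
    (GH : groupoid H N) (Phi : H -> D) (sigma : form2 H) (eta : form3 N) :
    Prop :=
  [/\ lie_groupoid nH nN GH,
      smooth_map Phi /\ multiplicative GH G Phi,
      [/\ is_form2 sigma, is_form3 eta, closed3 eta &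
          forall x u v, tangent x u -> tangent x v ->
            pull2 (ge GH) sigma x u v = 0],
      (forall (p : composable GH) u v, tangent p u -> tangent p v ->
         pull2 (@cpr1 R H N GH) sigma p u v
         + pull2 (@cpr2 R H N GH) sigma p u v
         - pull2 (@cmul R H N GH) sigma p u v
         = pull2 (cmap Phi (G := GH)) Omega p u v) /\
      (forall X Y Z, is_field X -> is_field Y -> is_field Z -> forall h,
         pull3 (gs GH) eta h (X h) (Y h) (Z h)
         - pull3 (gt GH) eta h (X h) (Y h) (Z h)
         - d2 sigma X Y Z h
         = pull3 Phi Theta h (X h) (Y h) (Z h)) &
      (* dim H - 2 dim N = (dim D) / 2, without truncated operations *)
      (2 * nH = 4 * nN + n)%N /\
      forall h u, tangent h u ->
        (forall v, tangent h v -> sigma h u v = 0) ->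
        tmap Phi u = 0 -> tmap (gs GH) u = 0 -> tmap (gt GH) u = 0 -> u = 0].

(* The Dirac structure A_g on D; the covector component is only prescribed on
   tangent vectors. *)
Definition A_dirac (V : vectType R) (j : {linear V -> tvec D})
    (g : {vspace V}) (d : D) : set (gvec D) :=
  [set e | gfiber d e /\ exists u v,
     [/\ u \in g, v \in g,
         e.1 = rinv G (j u) d - linv G (j v) d &
         forall Y, tangent d Y ->
           e.2 Y =
             Omega (spair (gone G) d)
               (tmap (fun k : D => spair (gone G) k) Y)
               (tmap (fun k : D => spair k d) (j u))
             - Omega (spair d (gone G))
               (tmap (fun k : D => spair k (gone G)) Y)
               (tmap (fun k : D => spair d k) (j v))]].

Definition strong_dirac (V : vectType R) (j : {linear V -> tvec D})
    (g : {vspace V}) (H : smooth_space R) (Phi : H -> D) (sigma : form2 H) : Prop :=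
  (forall h u, tangent h u ->
     (forall v, tangent h v -> sigma h u v = 0) -> tmap Phi u = 0 -> u = 0) /\
  (forall h, A_dirac j g (Phi h) =
     [set e | gfiber (Phi h) e /\ exists Z, [/\ tangent h Z, e.1 = tmap Phi Z &
        forall W, tangent h W -> sigma h Z W = e.2 (tmap Phi W)]]).

Definition multiplicative_moment_map (nH nN n : nat) (V : vectType R)
    (j : {linear V -> tvec D}) (g : {vspace V}) (H N : smooth_space R)
    (GH : groupoid H N) (Phi : H -> D) (sigma : form2 H) : Prop :=
  lagrangian_morphism nH nN n GH Phi sigma (@zero_form3 R N) /\
  strong_dirac j g Phi sigma.

(* The Dirac structure in TN x d of a lagrangian morphism; its component in d
   is Lie(Phi)(u), under the identification j : d -> Lie(D). *)
Definition big_dirac (V : vectType R) (j : {linear V -> tvec D})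
    (H N : smooth_space R) (GH : groupoid H N) (Phi : H -> D) (sigma : form2 H)
    (x : N) : set (gvec N * V) :=
  [set w | gfiber x w.1 /\ exists2 u, algebroid GH x u &
     geq x w.1 (anchor GH u, lambda GH sigma x u) /\ j w.2 = tmap Phi u].

Definition reduced_dirac (V : vectType R) (j : {linear V -> tvec D})
    (l : {vspace V}) (H N : smooth_space R) (GH : groupoid H N) (Phi : H -> D)
    (sigma : form2 H) (x : N) : set (gvec N) :=
  [set e | exists2 v, v \in l & big_dirac j GH Phi sigma x (e, v)].

End TwoShifted.

Lemma lagrangian_multiplicative (R : realType) (D : smooth_space R)
  (G : groupoid D (spoint R)) (Omega : form2 (sprod D D)) (Theta : form3 D)
  (nH nN n : nat) (H N : smooth_space R) (GH : groupoid H N) (Phi : H -> D)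
  (sigma : form2 H) (eta : form3 N) :
  lagrangian_morphism G Omega Theta nH nN n GH Phi sigma eta ->
  multiplicative GH G Phi.
Proof. by case=> _ []. Qed.

Definition transverse (R : realType) (M M' P : smooth_space R) (f : M -> P)
    (f' : M' -> P) : Prop :=
  forall (x : M) (y : M'), f x = f' y -> forall w, tangent (f x) w ->
    exists u v, [/\ tangent x u, tangent y v & w = tmap f u + tmap f' v].

Definition quasi_symplectic_groupoid (R : realType) (n : nat)
    (H N : smooth_space R) (G : groupoid H N) (omega : form2 H) : Prop :=
  [/\ lie_groupoid (2 * n)%N n G, is_form2 omega, closed2 omega,
      forall (p : composable G) u v, tangent p u -> tangent p v ->
        pull2 (@cmul R H N G) omega p u v =
        pull2 (@cpr1 R H N G) omega p u v + pull2 (@cpr2 R H N G) omega p u v &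
      forall x u, tangent (ge G x) u ->
        tmap (gs G) u = 0 ->
        (forall v, tangent (ge G x) v -> omega (ge G x) u v = 0) ->
        tmap (gt G) u = 0 -> u = 0].

Definition groupoid_dirac (R : realType) (H N : smooth_space R) (G : groupoid H N)
    (omega : form2 H) (x : N) : set (gvec N) :=
  [set e | gfiber x e /\ exists2 u, algebroid G x u &
     geq x e (anchor G u, lambda G omega x u)].

Definition fiber_product (R : realType) (X Y Z : smooth_space R) (f : X -> Z)
    (g : Y -> Z) : smooth_space R :=
  ssub [set p : sprod X Y | f p.1 = g p.2].

Definition fpr1 (R : realType) (X Y Z : smooth_space R) (f : X -> Z) (g : Y -> Z)
  (p : fiber_product f g) : X := (set_val p).1.
Definition fpr2 (R : realType) (X Y Z : smooth_space R) (f : X -> Z) (g : Y -> Z)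
  (p : fiber_product f g) : Y := (set_val p).2.

Lemma fiber_productE (R : realType) (X Y Z : smooth_space R) (f : X -> Z) (g : Y -> Z)
  (p : fiber_product f g) : f (fpr1 p) = g (fpr2 p).
Proof. exact: set_mem (valP p). Qed.

Definition fmk (R : realType) (X Y Z : smooth_space R) (f : X -> Z) (g : Y -> Z)
    (x : X) (y : Y) (e : f x = g y) : fiber_product f g :=
  exist _ (spair x y)
    (mem_set (e : [set p : sprod X Y | f p.1 = g p.2] (spair x y))).

Lemma fiber_product_eq (R : realType) (X Y Z : smooth_space R) (f : X -> Z)
  (g : Y -> Z) (p q : fiber_product f g) :
  fpr1 p = fpr1 q -> fpr2 p = fpr2 q -> p = q.
Proof.
move=> e1 e2; apply: val_inj; move: e1 e2; rewrite /fpr1 /fpr2.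
by case: p q => -[a b] ? [[c d] ?] /= -> ->.
Qed.

Lemma spoint_eq (R : realType) (x y : spoint R) : x = y.
Proof. by rewrite (thinmx0 (x : 'rV[R]_0)) (thinmx0 (y : 'rV[R]_0)). Qed.

Section MultiplicativeMaps.
Context (R : realType) (H D : smooth_space R) (N : Type).
Context (GH : groupoid H N) (GD : groupoid D (spoint R)) (Phi : H -> D).
Context (mPhi : multiplicative GH GD Phi).

Lemma gm_idem (d : D) : gm GD d d = d -> d = gone GD.
Proof.
move=> dd; have P := @spoint_eq R.
rewrite -(gm_el GD d) (P (gt GD d) (gs GD d)) -(gm_il GD d).
rewrite gmA; [|exact: P|exact: P].
by rewrite dd gm_il /gone (P (gs GD d) 0).
Qed.

Lemma multiplicative_unit (x : N) : Phi (ge GH x) = gone GD.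
Proof.
apply: gm_idem; rewrite -mPhi ?gs_e ?gt_e //.
by rewrite -{1}(gt_e GH x) gm_el.
Qed.

Lemma multiplicative_inv (h : H) :
  Phi (gi GH h) = gi GD (Phi h).
Proof.
have P := @spoint_eq R.
have e : gm GD (Phi (gi GH h)) (Phi h) = gone GD.
  by rewrite -mPhi ?gs_i // gm_il multiplicative_unit.
rewrite -[LHS](gm_er GD) (P (gs GD _) (gt GD (Phi h))) -(gm_ir GD (Phi h)).
rewrite -gmA; [|exact: P|exact: P].
by rewrite e /gone (P 0 (gt GD (gi GD (Phi h)))) gm_el.
Qed.

End MultiplicativeMaps.

Section FiberProductGroupoid.
Context (R : realType) (H N L D : smooth_space R).
Context (GH : groupoid H N) (GL : groupoid L (spoint R))
  (GD : groupoid D (spoint R)) (Phi : H -> D) (phi : L -> D).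
Context (mPhi : multiplicative GH GD Phi) (mphi : multiplicative GL GD phi).

Local Notation F := (fiber_product Phi phi).

Lemma fp_mulP (p q : F) : gs GH (fpr1 p) = gt GH (fpr1 q) ->
  Phi (gm GH (fpr1 p) (fpr1 q)) = phi (gm GL (fpr2 p) (fpr2 q)).
Proof.
by move=> e; rewrite mPhi // mphi; [rewrite !fiber_productE|exact: spoint_eq].
Qed.

Definition fp_s (p : F) : N := gs GH (fpr1 p).
Definition fp_t (p : F) : N := gt GH (fpr1 p).

(* The product is componentwise on composable pairs (the only ones on which it
   matters). *)
Definition fp_m (p q : F) : F :=
  match pselect (gs GH (fpr1 p) = gt GH (fpr1 q)) with
  | left e => fmk (fp_mulP e)
  | right _ => p
  end.

Lemma fp_eP (x : N) : Phi (ge GH x) = phi (gone GL).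
Proof.
exact: etrans (multiplicative_unit mPhi x)
  (esym (multiplicative_unit mphi (0 : 'rV[R]_0))).
Qed.

Definition fp_e (x : N) : F := fmk (fp_eP x).

Lemma fp_iP (p : F) : Phi (gi GH (fpr1 p)) = phi (gi GL (fpr2 p)).
Proof.
by rewrite (multiplicative_inv mPhi) (multiplicative_inv mphi) fiber_productE.
Qed.

Definition fp_i (p : F) : F := fmk (fp_iP p).

Lemma fp_m1 (p q : F) : fp_s p = fp_t q ->
  fpr1 (fp_m p q) = gm GH (fpr1 p) (fpr1 q).
Proof. by rewrite /fp_m; case: pselect. Qed.

Lemma fp_m2 (p q : F) : fp_s p = fp_t q ->
  fpr2 (fp_m p q) = gm GL (fpr2 p) (fpr2 q).
Proof. by rewrite /fp_m; case: pselect. Qed.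

Lemma fp_sm (p q : F) : fp_s p = fp_t q -> fp_s (fp_m p q) = fp_s q.
Proof. by move=> e; rewrite /fp_s fp_m1 // gs_m. Qed.

Lemma fp_tm (p q : F) : fp_s p = fp_t q -> fp_t (fp_m p q) = fp_t p.
Proof. by move=> e; rewrite /fp_t fp_m1 // gt_m. Qed.

Lemma fp_mA (p q r : F) : fp_s p = fp_t q -> fp_s q = fp_t r ->
  fp_m (fp_m p q) r = fp_m p (fp_m q r).
Proof.
move=> e1 e2; have e3 : fp_s (fp_m p q) = fp_t r by rewrite fp_sm.
have e4 : fp_s p = fp_t (fp_m q r) by rewrite fp_tm.
apply: fiber_product_eq; first by rewrite !fp_m1 // gmA.
by rewrite !fp_m2 // gmA //; exact: spoint_eq.
Qed.

Lemma fp_se (x : N) : fp_s (fp_e x) = x. Proof. exact: gs_e. Qed.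
Lemma fp_te (x : N) : fp_t (fp_e x) = x. Proof. exact: gt_e. Qed.

Lemma fp_el (p : F) : fp_m (fp_e (fp_t p)) p = p.
Proof.
apply: fiber_product_eq; first by rewrite fp_m1 ?fp_se //; exact: gm_el.
rewrite fp_m2 ?fp_se //.
by rewrite -[RHS](gm_el GL) [gt GL _](spoint_eq _ 0).
Qed.

Lemma fp_er (p : F) : fp_m p (fp_e (fp_s p)) = p.
Proof.
apply: fiber_product_eq; first by rewrite fp_m1 ?fp_te //; exact: gm_er.
rewrite fp_m2 ?fp_te //.
by rewrite -[RHS](gm_er GL) [gs GL _](spoint_eq _ 0).
Qed.

Lemma fp_si (p : F) : fp_s (fp_i p) = fp_t p. Proof. exact: gs_i. Qed.
Lemma fp_ti (p : F) : fp_t (fp_i p) = fp_s p. Proof. exact: gt_i. Qed.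

Lemma fp_il (p : F) : fp_m (fp_i p) p = fp_e (fp_s p).
Proof.
apply: fiber_product_eq; first by rewrite fp_m1 ?fp_si //; exact: gm_il.
by rewrite fp_m2 ?fp_si // [LHS](gm_il GL) (spoint_eq (gs GL _) 0).
Qed.

Lemma fp_ir (p : F) : fp_m p (fp_i p) = fp_e (fp_t p).
Proof.
apply: fiber_product_eq; first by rewrite fp_m1 ?fp_ti //; exact: gm_ir.
by rewrite fp_m2 ?fp_ti // [LHS](gm_ir GL) (spoint_eq (gt GL _) 0).
Qed.

Definition fiber_product_groupoid : groupoid F N :=
  Groupoid fp_sm fp_tm fp_mA fp_se fp_te fp_el fp_er fp_si fp_ti fp_il fp_ir.

End FiberProductGroupoid.

(* Main.v *)
(** Transversality makes G_L = H x_D L a manifold of dimension 2 dim N.  Right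
    translation moves it to T_1 D = Phi (A_H) + T phi (T_1 L) and from there to
    T_d D = T Phi (ker T s) + T phi (T L) at every d, so the source of G_L is a
    submersion.  The form sigma_L is closed and multiplicative because the
    defects of sigma are pullbacks of Theta and Omega along Phi pr_1 = phi pr_2,
    and these vanish on L.  Comparing sigma with its values on unit multiples
    gives lambda_a (T t b) + lambda_b (T t a) = - <Phi a, Phi b> for a, b in A_H;
    with l = l^perp this yields nondegeneracy at the units.  The Dirac structure
    of G_L is L_l by inspection of the fibers, so it remains that a
    quasi-symplectic groupoid induces a Dirac structure.  A section (X, alpha) of
    it determines the vector field U on the groupoid with T s U = 0,
    T t U = X o t and i_U omega = t^* alpha, and the Courant bracket of two
    sections is read off from the Lie bracket of these fields by d omega = 0.

    Smoothness being defined by algebras of functions, charts and their inverses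
    are taken to be globally defined smooth maps with prescribed germs, which
    smooth cutoffs provide. *)
Require Import Defs.
From HB Require Import structures.
From mathcomp Require Import all_boot all_order all_algebra.
From mathcomp Require Import all_classical all_reals all_analysis.
From mathcomp Require Import ring lra zify.
Import Order.TTheory GRing.Theory Num.Theory.
Import numFieldNormedType.Exports.

Set Implicit Arguments.
Unset Strict Implicit.
Unset Printing Implicit Defensive.

Local Open Scope classical_set_scope.
Local Open Scope ring_scope.

(** * Smooth functions on R^n *)

(** Tangent vectors are derivations of a global algebra and forms are tested on global fields, so
    facts that atlases give at once need proof: derivations are local (bump functions), they are
    directional derivatives (Hadamard's lemma, hence smooth dependence of integrals on a parameter),
    and [d2] depends only on the values of its fields at the point. The last fact is the crux for
    the reduced form: a field on the fiber product need not be related to any field on H or L, so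
    the equations for sigma and Theta can only be applied to fields with prescribed values at one
    point. The other obstacle is smoothness of the lift of a section to the groupoid. It is obtained
    as the unique solution of an overdetermined linear system with smooth coefficients; pointwise
    right translation then only has to show that the system is consistent. *)

Section Calculus.
Context {R : realType}.

Lemma continuous_add (T : topologicalType) (f g : T -> R) :
  continuous f -> continuous g -> continuous (fun x => f x + g x).
Proof. by move=> cf cg x; apply: cvgD; [exact: cf|exact: cg]. Qed.

Lemma continuous_mul (T : topologicalType) (f g : T -> R) :
  continuous f -> continuous g -> continuous (fun x => f x * g x).
Proof. by move=> cf cg x; apply: cvgM; [exact: cf|exact: cg]. Qed.

Lemma continuous_inv (T : topologicalType) (f : T -> R) :
  (forall x, f x != 0) -> continuous f -> continuous (fun x => (f x)^-1).
Proof. by move=> f0 cf x; apply: cvgV; [exact: f0|exact: cf]. Qed.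

Lemma continuous_sum (T : topologicalType) I (r : seq I) (P : pred I) (F : I -> T -> R) :
  (forall i, continuous (F i)) -> continuous (fun x => \sum_(i <- r | P i) F i x).
Proof.
move=> cF; elim: r => [|i r IH].
  by under eq_fun do rewrite big_nil; move=> x; exact: cvg_cst.
under eq_fun do rewrite big_cons.
case: (P i) => //; move=> x; apply: cvgD; [exact: cF|exact: IH].
Qed.

Let line_quotient (V W : normedModType R) (f : V -> W) (a v : V) (t : R) :
  (fun h : R => h^-1 *: (((fun s : R => f (a + s *: v)) \o shift t) (h *: 1)
    - f (a + t *: v))) =
  (fun h : R => h^-1 *: ((f \o shift (a + t *: v)) (h *: v) - f (a + t *: v))).
Proof.
apply/funext => h /=; congr (_ *: (f _ - _)).
by rewrite [h *: 1]mulr1 scalerDl addrCA addrC.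
Qed.

Lemma derivable_line (V W : normedModType R) (f : V -> W) (a v : V) (t : R) :
  derivable (fun s : R => f (a + s *: v)) t 1 = derivable f (a + t *: v) v.
Proof. by rewrite /derivable line_quotient. Qed.

Lemma derive_line (V W : normedModType R) (f : V -> W) (a v : V) (t : R) :
  'D_1 (fun s : R => f (a + s *: v)) t = 'D_v f (a + t *: v).
Proof. by rewrite /derive line_quotient. Qed.

Lemma is_derive_line (V W : normedModType R) (f : V -> W) (a v : V) (t : R) :
  derivable f (a + t *: v) v ->
  is_derive t 1 (fun s : R => f (a + s *: v)) ('D_v f (a + t *: v)).
Proof.
by move=> df; apply: DeriveDef; rewrite ?derivable_line ?derive_line.
Qed.

(** The order of s and t is left open, so the intermediate point is located only by its distance to
    s. Losing the side costs a constant in [mean_value]. *)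
Lemma MVT_any (g dg : R -> R) (s t : R) :
  (forall x : R, is_derive x (1 : R) g (dg x)) ->
  exists c, `|c - s| <= `|t - s| /\ g t - g s = dg c * (t - s).
Proof.
move=> gd.
have gc (i : interval R) : {within [set` i], continuous g}.
  apply: derivable_within_continuous => x _; exact: ex_derive.
have [st|/ltW ts] := leP s t.
  have [c] := MVT_segment st (fun x _ => gd x) (gc _).
  rewrite in_itv /= => /andP[sc ct] ->; exists c; split => //.
  by rewrite !ger0_norm ?subr_ge0 // lerB.
have [c] := MVT_segment ts (fun x _ => gd x) (gc _).
rewrite in_itv /= => /andP[sc ct] E; exists c; split; last lra.
rewrite distrC [leRHS]distrC !ger0_norm ?subr_ge0 //; lra.
Qed.

Lemma MVT_dir (V : normedModType R) (f : V -> R) (a v : V) (t : R) :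
  (forall x, derivable f x v) ->
  exists c, `|c| <= `|t| /\ f (a + t *: v) - f a = t * 'D_v f (a + c *: v).
Proof.
move=> df.
have [c [c1 c2]] := @MVT_any (fun s => f (a + s *: v)) _ 0 t
  (fun x => is_derive_line (df (a + x *: v))).
exists c; rewrite !subr0 in c1 c2; split => //.
by rewrite mulrC -c2 scale0r addr0.
Qed.

Lemma rV_coord_le n (x : 'rV[R]_n) i : `|x 0 i| <= `|x|.
Proof.
rewrite /Num.norm/= mx_normrE.
by apply: (le_bigmax_cond _ (fun ij => `|x ij.1 ij.2|) (j := (0, i))).
Qed.

Lemma rV_norm_le n (x : 'rV[R]_n) (e : R) : 0 <= e ->
  (forall i, `|x 0 i| <= e) -> `|x| <= e.
Proof.
move=> e0 H; rewrite /Num.norm/= mx_normrE; apply/bigmax_leP; split => // -[i j] _ /=.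
by rewrite (ord1 i).
Qed.

Lemma rV_norm_lt n (x : 'rV[R]_n) (e : R) : 0 < e ->
  (forall i, `|x 0 i| < e) -> `|x| < e.
Proof.
move=> e0 H; rewrite /Num.norm/= mx_normrE; apply/bigmax_ltP; split => // -[i j] _ /=.
by rewrite (ord1 i).
Qed.

Lemma linear_rV_sum n (l : {linear 'rV[R]_n -> R^o}) v :
  l v = \sum_i v 0 i * l (delta_mx 0 i).
Proof.
rewrite {1}[v]row_sum_delta linear_sum; apply: eq_bigr => i _.
by rewrite linearZ.
Qed.

(** Telescoping along the axes: the increment h is reached in n axis-parallel steps, and the mean
    value theorem turns each step into a partial derivative at a point no farther from x than h,
    where continuity applies. *)
Lemma C1_differentiable n (f : 'rV[R]_n -> R) :
  (forall v x, derivable f x v) -> (forall v, continuous ('D_v f)) ->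
  forall x, differentiable f x.
Proof.
move=> df cf x.
pose l (h : 'rV[R]_n) : R^o := \sum_i h 0 i * 'D_(delta_mx 0 i) f x.
have llin : linear l.
  move=> c u v; rewrite /l scaler_sumr -big_split /=; apply: eq_bigr => i _.
  by rewrite !mxE mulrDl -mulrA.
pose lL := HB.pack_for {linear 'rV[R]_n -> R^o} l
  (GRing.isLinear.Build R 'rV[R]_n R^o _ l llin).
have lc : continuous lL.
  apply: (@continuous_sum _ _ _ _ (fun i (h : 'rV[R]_n) => h 0 i * 'D_(delta_mx 0 i) f x)).
  by move=> i y; exact: (cvgM (@coord_continuous R 1 n 0 i y) (cvg_cst _)).
pose hk (k : nat) (h : 'rV[R]_n) := \row_(i < n) (if (i < k)%N then h 0 i else 0).
(* [hk k h] keeps the first k coordinates of h; each further step adds e times the norm of h to the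
   error. *)
have main (e : R) : 0 < e -> forall k, (k <= n)%N -> exists2 d, 0 < d & forall h, `|h| < d ->
   `|f (x + hk k h) - f x - \sum_(i < n | (i < k)%N) h 0 i * 'D_(delta_mx 0 i) f x| <= e * k%:R * `|h|.
  move=> e0; elim=> [|k IH] kn.
    exists 1 => // h _; rewrite big_pred0 //.
    have -> : hk 0%N h = 0 by apply/rowP => i; rewrite !mxE.
    by rewrite addr0 subrr subr0 normr0 mulr0 mul0r.
  have [d d0 Hd] := IH (ltnW kn).
  pose ko := Ordinal kn.
  have := cf (delta_mx 0 ko) x.
  move=> /cvgrPdist_le /(_ e e0) /nbhs_normP [d' /= d'0 Hd'].
  exists (Num.min d d'); first by rewrite lt_min d0 d'0.
  move=> h; rewrite lt_min => /andP[hd hd'].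
  have -> : hk k.+1 h = hk k h + h 0 ko *: delta_mx 0 ko.
    apply/rowP => i; rewrite !mxE eqxx /= ltnS leq_eqVlt -val_eqE /=.
    case: eqP => [/= ik|_] /=; last by rewrite mulr0 addr0.
    by rewrite ik ltnn add0r mulr1; congr (h 0 _); apply: val_inj.
  have [c [c1 c2]] := @MVT_dir _ f (x + hk k h) (delta_mx 0 ko) (h 0 ko) (df _).
  rewrite (bigD1 ko) //=.
  rewrite (eq_bigl (fun i : 'I_n => (i < k)%N)); last first.
    move=> i; rewrite ltnS leq_eqVlt -val_eqE /=.
    by case: eqP => [->|] /=; rewrite ?ltnn // andbT.
  set S := \sum_(i < n | _) _.
  have -> : f (x + (hk k h + h 0 ko *: delta_mx 0 ko)) - f x -
      (h 0 ko * 'D_(delta_mx 0 ko) f x + S) =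
      (f (x + hk k h) - f x - S) + h 0 ko * ('D_(delta_mx 0 ko) f (x + hk k h + c *: delta_mx 0 ko)
       - 'D_(delta_mx 0 ko) f x).
    rewrite addrA; move: c2; set A := f _; set B := f _; set C := 'D_ _ f _; move=> c2.
    by rewrite mulrBr -c2; ring.
  apply: (le_trans (ler_normD _ _)); rewrite -natr1 (mulrDr e) (mulrDl _ _ `|h|) mulr1.
  apply: lerD; first exact: Hd.
  rewrite normrM mulrC; apply: ler_pM => //; last exact: rV_coord_le.
  rewrite distrC; apply: Hd' => /=; rewrite -addrA opprD addNKr normrN.
  apply: le_lt_trans hd'; apply: rV_norm_le => // i.
  rewrite !mxE eqxx /= -val_eqE /=.
  case: eqP => [ik|_] /=.
    by rewrite ik ltnn add0r mulr1 (le_trans c1) // rV_coord_le.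
  by case: ifP => _; rewrite mulr0 addr0 ?normr0 // rV_coord_le.
have H : f \o shift x = cst (f x) + (lL : 'rV[R]_n -> R^o) +o_ 0 id.
  apply/eqaddoP => _/posnumP[e].
  have e0 : 0 < e%:num / n.+1%:R by rewrite divr_gt0.
  have [d d0 Hd] := main _ e0 n (leqnn _).
  have dN : \forall h \near (0 : 'rV[R]_n), `|h| < d by exact: nbhs0_lt.
  apply: (filterS _ dN) => h hd.
  have := Hd h hd.
  have -> : hk n h = h by apply/rowP => i; rewrite mxE ltn_ord.
  rewrite (eq_bigl xpredT); last by move=> i; rewrite ltn_ord.
  move=> Hh; rewrite /= !fctE /= opprD addrA [h + x]addrC.
  apply: (le_trans Hh); rewrite ler_wpM2r //.
  by rewrite -mulrA ler_piMr // mulrC ler_pdivrMr // mul1r ler_nat.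
apply/diff_locallyP.
have -> : 'd f x = lL :> (_ -> _) by exact: diff_unique.
by [].
Qed.

(** Restriction to the line through x in direction v reduces to one variable, where derivability is
    differentiability. Hence g needs derivatives in the direction v only. *)
Lemma chain_rule (V : normedModType R) m (f : 'rV[R]_m -> R) (g : V -> 'rV[R]_m) (x v : V) :
  differentiable f (g x) -> (forall i, derivable (fun y => g y 0 i) x v) ->
  is_derive x v (f \o g)
    (\sum_i 'D_v (fun y => g y 0 i) x * 'D_(delta_mx 0 i) f (g x)).
Proof.
move=> df dg.
have dg' : derivable g x v by apply/derivable_mxP => i j; rewrite (ord1 i).
pose ga (s : R) := g (x + s *: v).
have x0 : x + 0 *: v = x by rewrite scale0r addr0.
have g0 : ga 0 = g x by rewrite /ga x0.
have dga : derivable ga 0 1 by rewrite derivable_line x0.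
have fga : differentiable (f \o ga) 0.
  by apply: differentiable_comp; [exact/derivable1_diffP|rewrite g0].
have E : (f \o ga) = fun s : R => (f \o g) (x + s *: v) by [].
have D1 : derivable (f \o g) x v.
  by move/derivable1_diffP: fga; rewrite E derivable_line x0.
apply: DeriveDef => //.
have <- : 'D_1 (f \o ga) 0 = 'D_v (f \o g) x by rewrite E derive_line x0.
rewrite deriveE // diff_comp; last 2 first.
- exact/derivable1_diffP.
- by rewrite g0.
have -> : ('d f (ga 0) \o 'd ga 0) 1 = 'd f (g x) ('D_v g x).
  rewrite /= -(deriveE (f := ga)); last exact/derivable1_diffP.
  by rewrite derive_line x0 g0.
rewrite linear_rV_sum; apply: eq_bigr => i _.
congr (_ * _); first by rewrite (derive_mx dg') mxE.
by rewrite (@deriveE _ _ _ f (g x) (delta_mx 0 i) df).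
Qed.

Lemma Cr_continuous n k (f : 'rV[R]_n -> R) : Cr k f -> continuous f.
Proof. by case: k => [|k] []. Qed.

Lemma Cr_lower n k (f : 'rV[R]_n -> R) : Cr k.+1 f -> Cr k f.
Proof.
elim: k f => [|k IH] f [cf df]; split => // v.
by have [d1 d2] := df v; split => //; exact: IH.
Qed.

Lemma CrS_derivable n k (f : 'rV[R]_n -> R) x v : Cr k.+1 f -> derivable f x v.
Proof. by move=> [_ /(_ v) []]. Qed.

Lemma CrS_derive n k (f : 'rV[R]_n -> R) v : Cr k.+1 f -> Cr k ('D_v f).
Proof. by move=> [_ /(_ v) []]. Qed.

Lemma CrS_differentiable n k (f : 'rV[R]_n -> R) x : Cr k.+1 f -> differentiable f x.
Proof.
move=> [_ Hf]; apply: C1_differentiable => v; first by case: (Hf v).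
by case: (Hf v) => _ /Cr_continuous.
Qed.

Lemma is_derive_split (V W : normedModType R) (f : V -> W) x v d :
  is_derive x v f d -> derivable f x v /\ 'D_v f x = d.
Proof. by case. Qed.

Lemma CrS_intro n k (f : 'rV[R]_n -> R) (df : 'rV[R]_n -> 'rV[R]_n -> R) :
  (forall x v, derivable f x v /\ 'D_v f x = df v x) -> continuous f -> (forall v, Cr k (df v)) ->
  Cr k.+1 f.
Proof.
move=> H cf Hk; split => // v; split.
  by move=> x; case: (H x v).
have -> : (fun x => 'D_v f x) = df v; last exact: Hk.
by apply/funext => x; case: (H x v).
Qed.

Lemma CrS_is_derive n k (f : 'rV[R]_n -> R) x v : Cr k.+1 f -> is_derive x v f ('D_v f x).
Proof. by move=> /(@CrS_derivable _ _ _ x v)/derivableP. Qed.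

Lemma Cr_cst n k (c : R) : Cr k (fun _ : 'rV[R]_n => c).
Proof.
have C0 : continuous (fun _ : 'rV[R]_n => c) by exact: cst_continuous.
elim: k c C0 => [|k IH] c C0; first by split.
apply: (CrS_intro (df := fun _ _ => 0)).
- by move=> x v; exact: (is_derive_split (is_derive_cst _ _ _)).
- exact: C0.
- by move=> v; apply: IH; exact: cst_continuous.
Qed.

Lemma is_derive_coord n (x v : 'rV[R]_n) i : is_derive x v (fun y : 'rV[R]_n => y 0 i) (v 0 i).
Proof.
have := @is_derive_id _ 'rV[R]_n x v => -[d1 d2].
have := d1; move/derivable_mxP => /(_ 0 i) d3.
by apply: DeriveDef => //; rewrite -[in RHS]d2 derive_mx // mxE.
Qed.

Lemma Cr_coord n k i : Cr k (fun x : 'rV[R]_n => x 0 i).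
Proof.
case: k => [|k]; first by split => //; move=> x; exact: coord_continuous.
apply: (CrS_intro (df := fun v _ => v 0 i)).
- by move=> x v; exact: (is_derive_split (is_derive_coord _ _ _)).
- by move=> x; exact: coord_continuous.
- by move=> v; exact: Cr_cst.
Qed.

Lemma Cr_add n k (f g : 'rV[R]_n -> R) : Cr k f -> Cr k g -> Cr k (fun x => f x + g x).
Proof.
elim: k f g => [|k IH] f g Hf Hg.
  by split => //; apply: continuous_add; [case: Hf|case: Hg].
apply: (CrS_intro (df := fun v x => 'D_v f x + 'D_v g x)).
- move=> x v; have := CrS_is_derive x v Hf; have := CrS_is_derive x v Hg => h1 h2.
  exact: (is_derive_split (is_deriveD h2 h1)).
- by apply: continuous_add; [case: Hf|case: Hg].
- by move=> v; apply: IH; exact: CrS_derive.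
Qed.

Lemma Cr_mul n k (f g : 'rV[R]_n -> R) : Cr k f -> Cr k g -> Cr k (fun x => f x * g x).
Proof.
elim: k f g => [|k IH] f g Hf Hg.
  by split => //; apply: continuous_mul; [case: Hf|case: Hg].
apply: (CrS_intro (df := fun v x => f x * 'D_v g x + g x * 'D_v f x)).
- move=> x v; have := CrS_is_derive x v Hf; have := CrS_is_derive x v Hg => h1 h2.
  exact: (is_derive_split (is_deriveM h2 h1)).
- by apply: continuous_mul; [case: Hf|case: Hg].
- move=> v; apply: Cr_add; apply: IH => //; try exact: Cr_lower; exact: CrS_derive.
Qed.

Lemma Cr_sum n k I (r : seq I) (P : pred I) (F : I -> 'rV[R]_n -> R) :
  (forall i, Cr k (F i)) -> Cr k (fun x => \sum_(i <- r | P i) F i x).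
Proof.
move=> cF; elim: r => [|i r IH].
  by under eq_fun do rewrite big_nil; exact: Cr_cst.
under eq_fun do rewrite big_cons.
by case: (P i) => //; apply: Cr_add.
Qed.

Lemma Cr_prod n k I (r : seq I) (P : pred I) (F : I -> 'rV[R]_n -> R) :
  (forall i, Cr k (F i)) -> Cr k (fun x => \prod_(i <- r | P i) F i x).
Proof.
move=> cF; elim: r => [|i r IH].
  by under eq_fun do rewrite big_nil; exact: Cr_cst.
under eq_fun do rewrite big_cons.
by case: (P i) => //; apply: Cr_mul.
Qed.

Lemma continuous_rV (T : topologicalType) n (g : T -> 'rV[R]_n) :
  (forall i, continuous (fun x => g x 0 i)) -> continuous g.
Proof.
move=> H x.
apply/cvgrPdist_lt => e e0.
have : \forall y \near x, forall i, `|g x 0 i - g y 0 i| < e.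
  apply: filter_forall => i.
  by move: (H i x) => /cvgrPdist_lt; exact.
apply: filterS => y Hy; apply: rV_norm_lt => // i.
by rewrite !mxE.
Qed.

Lemma Cr_comp n m k (f : 'rV[R]_m -> R) (g : 'rV[R]_n -> 'rV[R]_m) :
  Cr k f -> (forall i, Cr k (fun x => g x 0 i)) -> Cr k (f \o g).
Proof.
have C k' (f' : 'rV[R]_m -> R) : Cr k' f' -> (forall i, Cr k' (fun x => g x 0 i)) ->
    continuous (f' \o g).
  move=> Hf Hg x; apply: continuous_comp; last exact: Cr_continuous Hf _.
  by apply: continuous_rV => i; exact: Cr_continuous (Hg i).
elim: k f => [|k IH] f Hf Hg; first by split => //; exact: (C 0%N).
apply: (CrS_intro (df := fun v x => \sum_i 'D_v (fun y => g y 0 i) x * 'D_(delta_mx 0 i) f (g x))).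
- move=> x v; apply/is_derive_split/chain_rule; first exact: CrS_differentiable Hf.
  by move=> i; exact: CrS_derivable.
- exact: (C k.+1).
- move=> v; apply: Cr_sum => i; apply: Cr_mul; first exact: CrS_derive.
  apply: (IH ('D_(delta_mx 0 i) f)); first exact: CrS_derive.
  by move=> j; exact: Cr_lower.
Qed.

Lemma Cr_inv n k (f : 'rV[R]_n -> R) : (forall x, f x != 0) -> Cr k f ->
  Cr k (fun x => (f x)^-1).
Proof.
move=> f0.
have C : continuous f -> continuous (fun x => (f x)^-1) by exact: continuous_inv.
elim: k => [|k IH] Hf; first by split => //; apply: C; case: Hf.
apply: (CrS_intro (df := fun v x => (- 1) * ((f x)^-1 * (f x)^-1) * 'D_v f x)).
- move=> x v.
  have dfx : derivable f x v by exact: CrS_derivable Hf.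
  split; first exact: derivableV.
  rewrite [LHS](deriveV (f0 x) dfx) [_ *: _]/GRing.scale /= -exprVn expr2; ring.
- by apply: C; case: Hf.
- move=> v; have I := IH (Cr_lower Hf).
  apply: Cr_mul; last exact: CrS_derive.
  apply: Cr_mul; [exact: Cr_cst|exact: Cr_mul].
Qed.

(** A family closed under derivation consists of smooth functions. Carrying the whole family through
    the induction avoids naming any higher derivative of phi. *)
Lemma Cr_comp1 n k (F : set (R -> R)) (phi : R -> R) (g : 'rV[R]_n -> R) :
  (forall f, F f -> exists2 f', F f' & forall t : R, is_derive t (1 : R) f (f' t)) ->
  F phi -> Cr k g -> Cr k (phi \o g).
Proof.
move=> HF.
have C f : F f -> Cr 0 g -> continuous (f \o g).
  move=> /HF [f' _ Hf'] [cg _] x; apply: continuous_comp; first exact: cg.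
  by apply/differentiable_continuous/derivable1_diffP; exact: ex_derive.
elim: k phi => [|k IH] phi Fp Hg; first by split => //; exact: C.
have [f' Ff' Hf'] := HF _ Fp.
apply: (CrS_intro (df := fun v x => f' (g x) * 'D_v g x)).
- move=> x v; have dg : derivable g x v by exact: CrS_derivable Hg.
  have x0 : x + 0 *: v = x by rewrite scale0r addr0.
  have dga : derivable (fun s : R => g (x + s *: v)) 0 1 by rewrite derivable_line x0.
  have D : is_derive (0:R) (1:R) (phi \o (fun s : R => g (x + s *: v))) (f' (g x) * 'D_v g x).
    have := @is_derive1_comp _ phi (fun s : R => g (x + s *: v)) 0 (f' (g x)) ('D_v g x).
    rewrite x0; apply => //.
    by have := is_derive_line (f := g) (a := x) (v := v) (t := 0); rewrite x0; exact.
  have E : (phi \o (fun s : R => g (x + s *: v))) = fun s : R => (phi \o g) (x + s *: v) by [].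
  rewrite E in D; case: D => D1 D2.
  by split; [move: D1; rewrite derivable_line x0|rewrite -D2 derive_line x0].
- by apply: C => //; split; first exact: Cr_continuous Hg.
- move=> v; apply: Cr_mul; last exact: CrS_derive.
  by apply: (IH f') => //; exact: Cr_lower.
Qed.

End Calculus.

(** * Smooth cutoffs *)

Section Flat.
Context {R : realType}.

Lemma continuous_norm (T : topologicalType) (f : T -> R) :
  continuous f -> continuous (fun x => `|f x|).
Proof. by move=> cf x; apply: cvg_norm; exact: cf. Qed.

Lemma near_gt (T : topologicalType) (f : T -> R) x c :
  continuous f -> c < f x -> \forall y \near x, c < f y.
Proof. by move=> cf; exact: (cvgr_gt _ (cf x)). Qed.

Lemma is_derive_eps (V : normedModType R) (f : V -> R) (x v : V) (d : R) :
  (forall e, 0 < e -> exists2 del, 0 < del & forall h, h != 0 -> `|h| < del ->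
     `|h^-1 * (f (x + h *: v) - f x) - d| <= e) ->
  is_derive x v f d.
Proof.
move=> H.
have C : h^-1 *: ((f \o shift x) (h *: v) - f x) @[h --> 0^'] --> d.
  apply/cvgrPdist_le => e e0; have [del d0 Hd] := H _ e0.
  have dN : \forall h \near (0 : R)^', `|h| < del by exact: dnbhs0_lt.
  have nN : \forall h \near (0 : R)^', h != 0 by exact: nbhs_dnbhs_neq.
  apply: filterS2 dN nN => h hd h0 /=.
  by rewrite distrC [h *: v + x]addrC; exact: Hd.
by apply: DeriveDef; [exact: cvgP C|exact: (cvg_lim _ C)].
Qed.

(* The functions p(1/t) exp(-1/t) are closed under derivation. *)
Definition flat_fun (p : {poly R}) (t : R) : R :=
  if 0 < t then p.[t^-1] * expR (- t^-1) else 0.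

(** From exp s = exp (s / (n+1)) ^ (n+1) and exp y >= 1 + y >= y. *)
Lemma pow_expR_le n (s : R) : 0 < s -> s ^+ n * expR (- s) <= n.+1%:R ^+ n.+1 / s.
Proof.
move=> s0; rewrite expRN ler_pdivrMr ?expR_gt0 // mulrAC ler_pdivlMr //.
rewrite -exprSr.
have -> : expR s = expR (s / n.+1%:R) ^+ n.+1.
  by rewrite -expRM_natl mulrC divfK // pnatr_eq0.
rewrite -exprMn; apply: lerXn2r; rewrite ?nnegrE ?(ltW s0) //.
rewrite mulrC -ler_pdivrMr //.
by rewrite (le_trans _ (expR_ge1Dx _)) // lerDr.
Qed.

(** Applied to ['X * p], the linear bound is what gives derivative 0 at the origin. *)
Lemma flat_bound (p : {poly R}) : exists2 C, 0 <= C & forall t, `|flat_fun p t| <= C * `|t|.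
Proof.
pose C := \sum_(i < size p) `|p`_i| * i.+1%:R ^+ i.+1.
exists C; first by apply: sumr_ge0 => i _; rewrite mulr_ge0 // exprn_ge0.
move=> t; rewrite /flat_fun; case: ifP => t0; last first.
  by rewrite normr0 mulr_ge0 //; apply: sumr_ge0 => i _; rewrite mulr_ge0 // exprn_ge0.
rewrite horner_coef mulr_suml (le_trans (ler_norm_sum _ _ _)) // /C mulr_suml.
apply: ler_sum => i _; rewrite -mulrA normrM -mulrA ler_wpM2l //.
rewrite ger0_norm; last by rewrite mulr_ge0 ?expR_ge0 // exprn_ge0 // invr_ge0 ltW.
have := @pow_expR_le i t^-1; rewrite invr_gt0 => /(_ t0) /le_trans; apply.
by rewrite invrK (gtr0_norm t0).
Qed.

Lemma flat_deriv (p : {poly R}) (t : R) :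
  is_derive t (1 : R) (flat_fun p) (flat_fun ('X^2 * (p - p^`())) t).
Proof.
have [t0|t0|t0] := ltgtP 0 t.
- have -> : flat_fun ('X^2 * (p - p^`())) t =
     p.[t^-1] *: (expR (- t^-1) *: (- (- (t ^- 2 *: 1)))) +
     expR (- t^-1) *: (p^`().[t^-1] *: (- (t ^- 2 *: 1))).
    rewrite /flat_fun t0 !hornerE -!exprVn /GRing.scale /=; ring.
  apply: (@near_eq_is_derive R R R (fun t : R => p.[t^-1] * expR (- t^-1)) (flat_fun p) t 1).
    near=> y; rewrite /flat_fun ifT //.
    by near: y; exact: lt_nbhsr.
  have V : is_derive t (1:R) (fun t : R => t^-1) (- (t ^- 2 *: 1)).
    have t0' : id t != 0 :> R by rewrite gt_eqF.
    apply: DeriveDef; first exact: (derivableV t0' (@derivable_id _ _ _ _)).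
    by rewrite (deriveV t0' (@derivable_id _ _ _ _)) derive_id scaleNr.
  have A : is_derive t (1:R) (fun t : R => p.[t^-1]) (p^`().[t^-1] *: (- (t ^- 2 *: 1))).
    exact: (@is_derive1_comp _ (horner p) (fun t : R => t^-1) t _ _ (is_derive_poly p t^-1) V).
  have B : is_derive t (1:R) (fun t : R => expR (- t^-1)) (expR (- t^-1) *: (- (- (t ^- 2 *: 1)))).
    exact: (@is_derive1_comp _ expR (fun t : R => - t^-1) t _ _ (is_derive_expR _) (is_deriveN V)).
  exact: (is_deriveM A B).
- have -> : flat_fun ('X^2 * (p - p^`())) t = 0 by rewrite /flat_fun ltNge (ltW t0).
  apply: (@near_eq_is_derive R R R (fun _ : R => 0) (flat_fun p) t 1).
  near=> y; rewrite /flat_fun ifF //; apply/negbTE; rewrite -leNgt ltW //.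
  by near: y; exact: lt_nbhsl.
- rewrite -t0; have -> : flat_fun ('X^2 * (p - p^`())) 0 = 0 by rewrite /flat_fun ltxx.
  apply: is_derive_eps => e e0.
  (* Since 1/h is the variable of the polynomial, the difference quotient of [flat_fun p] at 0 is
     [flat_fun ('X * p)], and the linear bound makes it tend to 0. *)
  have [C C0 HC] := flat_bound ('X * p).
  exists (e / (C + 1)); first by rewrite divr_gt0 // ltr_wpDl.
  move=> h h0 hd; rewrite add0r [h *: 1]mulr1 subr0.
  have -> : flat_fun p 0 = 0 by rewrite /flat_fun ltxx.
  rewrite subr0.
  have -> : h^-1 * flat_fun p h = flat_fun ('X * p) h.
    rewrite /flat_fun; case: ifP => _; last by rewrite mulr0.
    by rewrite hornerM hornerX mulrA.
  rewrite (le_trans (HC h)) //; move: hd; rewrite ltr_pdivlMr ?ltr_wpDl // => hd.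
  by rewrite (le_trans _ (ltW hd)) // mulrC ler_wpM2l // lerDl.
Unshelve. all: end_near. Qed.

(* Derivatives in several variables of [b \o g], without naming those of [b]. *)
Definition smooth1 (b : R -> R) := forall n k (g : 'rV[R]_n -> R), Cr k g -> Cr k (b \o g).

Definition flat (t : R) : R := flat_fun 1 t.

Lemma flat_gt0 t : 0 < t -> 0 < flat t.
Proof. by move=> t0; rewrite /flat /flat_fun t0 hornerC mul1r expR_gt0. Qed.

Lemma flat_ge0 t : 0 <= flat t.
Proof. by rewrite /flat /flat_fun; case: ifP => // _; rewrite hornerC mul1r expR_ge0. Qed.

Lemma flat_eq0 t : t <= 0 -> flat t = 0.
Proof. by move=> t0; rewrite /flat /flat_fun ltNge t0. Qed.

Lemma smooth1_flat : smooth1 flat.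
Proof.
move=> n k g Hg.
apply: (@Cr_comp1 _ _ _ [set f | exists p, f = flat_fun p]) => //; last by exists 1.
move=> _ [p ->]; exists (flat_fun ('X^2 * (p - p^`()))); first by eexists.
by move=> t; exact: flat_deriv.
Qed.

Definition bump1 (t : R) : R :=
  flat (4 - t ^+ 2) / (flat (4 - t ^+ 2) + flat (t ^+ 2 - 1)).

(** The arguments 4 - t^2 and t^2 - 1 sum to 3, so one of them is positive. *)
Lemma bump1_den t : 0 < flat (4 - t ^+ 2) + flat (t ^+ 2 - 1).
Proof.
have [t4|t4] := ltP (t ^+ 2) 4.
  by rewrite ltr_wpDr ?flat_ge0 // flat_gt0 // subr_gt0.
by rewrite ltr_wpDl ?flat_ge0 // flat_gt0 // subr_gt0; lra.
Qed.

Lemma bump1_eq1 t : `|t| <= 1 -> bump1 t = 1.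
Proof.
move=> t1; rewrite /bump1 (@flat_eq0 (t ^+ 2 - 1)); last first.
  by rewrite subr_le0 -real_normK ?num_real // expr_le1.
rewrite addr0 divff // gt_eqF // flat_gt0 // subr_gt0.
have : `|t| ^+ 2 <= 1 by rewrite expr_le1.
by rewrite real_normK ?num_real //; lra.
Qed.

Lemma bump1_eq0 t : 2 <= `|t| -> bump1 t = 0.
Proof.
move=> t2; rewrite /bump1 flat_eq0 ?mul0r // subr_le0 -real_normK ?num_real //.
by have : (2:R) ^+ 2 <= `|t| ^+ 2 by [rewrite lerXn2r ?nnegrE]; rewrite -natrX.
Qed.

Lemma bump1_01 t : 0 <= bump1 t <= 1.
Proof.
rewrite /bump1 divr_ge0 ?flat_ge0 ?(ltW (bump1_den t)) //=.
by rewrite ler_pdivrMr ?bump1_den // mul1r lerDl flat_ge0.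
Qed.

Lemma smooth1_bump1 : smooth1 bump1.
Proof.
move=> n k g Hg.
have P (c d : R) : Cr k (fun x => c + d * (g x * g x)).
  by apply: Cr_add; [exact: Cr_cst|apply: Cr_mul; [exact: Cr_cst|exact: Cr_mul]].
have P1 : Cr k (flat \o (fun x => 4 - g x ^+ 2)).
  apply: smooth1_flat; have := P 4 (-1); congr (Cr _ _).
  by apply/funext => x; rewrite mulN1r expr2.
have P2 : Cr k (flat \o (fun x => g x ^+ 2 - 1)).
  apply: smooth1_flat; have := P (-1) 1; congr (Cr _ _).
  by apply/funext => x; rewrite mul1r expr2 addrC.
apply: Cr_mul => //; apply: Cr_inv; last exact: Cr_add.
by move=> x; rewrite gt_eqF // bump1_den.
Qed.

Definition cut1 (t : R) : R := t * bump1 t.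

Lemma smooth1_cut1 : smooth1 cut1.
Proof. by move=> n k g Hg; apply: Cr_mul => //; exact: smooth1_bump1. Qed.

Lemma cut1_id t : `|t| <= 1 -> cut1 t = t.
Proof. by move=> t1; rewrite /cut1 bump1_eq1 ?mulr1. Qed.

Lemma cut1_le2 t : `|cut1 t| <= 2.
Proof.
have [t2|t2] := leP 2 `|t|; first by rewrite /cut1 bump1_eq0 // mulr0 normr0.
rewrite /cut1 normrM; have /andP[b0 b1] := bump1_01 t.
by rewrite (ger0_norm b0) -[leRHS]mulr1 ler_pM // ltW.
Qed.

(** The function vanishes for |t| >= 2, so its derivative is bounded by a maximum over a compact
    set. It is viewed on R^1 as a space of row vectors, because [smooth1] speaks of such
    functions. *)
Lemma cut1_lipschitz : exists2 C, 0 < C & forall s t, `|cut1 s - cut1 t| <= C * `|s - t|.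
Proof.
pose f (x : 'rV[R]_1) := cut1 (x 0 0).
have fC : Cr 1 f by apply: smooth1_cut1; exact: Cr_coord.
pose e : 'rV[R]_1 := const_mx 1.
have E t : f (t *: e) = cut1 t by rewrite /f !mxE mulr1.
have D0 t : 2 < `|t| -> 'D_e f (t *: e) = 0.
  move=> t2; rewrite (@near_eq_derive R 'rV[R]_1 R f (cst 0)) ?derive_cst //.
  have : \forall y \near (t *: e), 2 < `|(y : 'rV[R]_1) 0 0|.
    apply: (near_gt (f := fun y : 'rV[R]_1 => `|y 0 0|)); last by rewrite !mxE mulr1.
    apply: (continuous_norm (f := fun y : 'rV[R]_1 => y 0 0)); exact: coord_continuous.
  by apply: filterS => y y2; rewrite /f /cut1 bump1_eq0 ?mulr0 // ltW.
pose B := [set x : 'rV[R]_1 | `|x| <= 3].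
have cB : compact B.
  apply: bounded_closed_compact.
    by exists 3; split; [exact: num_real|move=> x x3 y /le_trans; apply; exact: ltW].
  rewrite /B (_ : [set _ | _] = (fun x => `|x|) @^-1` [set y : R | y <= 3]) //.
  by apply: preimage_closed (@closed_le _ 3) => x _; exact: norm_continuous.
have B0 : B !=set0 by exists 0; rewrite /B /= normr0.
have cD : continuous (fun x => `|'D_e f x|).
  move=> x; apply: (@continuous_comp _ _ _ ('D_e f) Num.norm); last exact: norm_continuous.
  exact: (Cr_continuous (CrS_derive e fC)).
have [c _ Hc] := EVT_max_rV B0 cB (continuous_subspaceT cD).
exists (`|'D_e f c| + 1); first by rewrite ltr_wpDl.
have Db t : `|'D_e f (t *: e)| <= `|'D_e f c| + 1.
  have [t2|t2] := ltP 2 `|t|; first by rewrite D0 // normr0 addr_ge0.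
  rewrite (le_trans (Hc (t *: e) _)) ?lerDl // inE /B /=.
  by apply: rV_norm_le => // i; rewrite !mxE mulr1 (le_trans t2) // ler_nat.
move=> s t.
have [x [_ Hx]] := @MVT_dir _ _ f (t *: e) e (s - t) (fun _ => CrS_derivable fC).
rewrite -(E s) -(E t).
have -> : s *: e = t *: e + (s - t) *: e by rewrite -scalerDl addrC subrK.
by rewrite Hx normrM mulrC -scalerDl ler_wpM2r.
Qed.

End Flat.

(** * Inverse and implicit functions *)

Section InverseFunction.
Context {R : realType}.

Lemma near_forall (T : topologicalType) (x : T) (I : finType) (P : I -> T -> Prop) :
  (forall i, \forall y \near x, P i y) -> \forall y \near x, forall i, P i y.
Proof. by move=> H; apply: filter_forall. Qed.

Lemma lipschitz_continuous (V W : normedModType R) (g : V -> W) (C : R) : 0 < C ->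
  (forall a b, `|g a - g b| <= C * `|a - b|) -> continuous g.
Proof.
move=> C0 Hg a; apply/cvgrPdist_le => e e0.
have : \forall y \near a, `|a - y| < e / C by apply/nbhs_normP; exists (e / C) => //=; rewrite divr_gt0.
by apply: filterS => y Hy; rewrite (le_trans (Hg _ _)) // mulrC -ler_pdivlMr // ltW.
Qed.

Lemma Cinfty_cst n (c : R) : Cinfty (fun _ : 'rV[R]_n => c).
Proof. by move=> k; exact: Cr_cst. Qed.

Lemma Cinfty_coord n i : Cinfty (fun x : 'rV[R]_n => x 0 i).
Proof. by move=> k; exact: Cr_coord. Qed.

Lemma Cinfty_add n (f g : 'rV[R]_n -> R) :
  Cinfty f -> Cinfty g -> Cinfty (fun x => f x + g x).
Proof. by move=> Hf Hg k; exact: Cr_add. Qed.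

Lemma Cinfty_mul n (f g : 'rV[R]_n -> R) :
  Cinfty f -> Cinfty g -> Cinfty (fun x => f x * g x).
Proof. by move=> Hf Hg k; exact: Cr_mul. Qed.

Lemma Cinfty_sum n I (r : seq I) (P : pred I) (F : I -> 'rV[R]_n -> R) :
  (forall i, Cinfty (F i)) -> Cinfty (fun x => \sum_(i <- r | P i) F i x).
Proof. by move=> HF k; apply: Cr_sum => i; exact: HF. Qed.

Lemma Cinfty_opp n (f : 'rV[R]_n -> R) : Cinfty f -> Cinfty (fun x => - f x).
Proof.
move=> Hf; have := Cinfty_mul (@Cinfty_cst n (-1)) Hf; congr Cinfty.
by apply/funext => x; rewrite mulN1r.
Qed.

Lemma Cinfty_sub n (f g : 'rV[R]_n -> R) :
  Cinfty f -> Cinfty g -> Cinfty (fun x => f x - g x).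
Proof. by move=> Hf Hg; apply: Cinfty_add => //; exact: Cinfty_opp. Qed.

Lemma Cinfty_derive n (f : 'rV[R]_n -> R) v : Cinfty f -> Cinfty ('D_v f).
Proof. by move=> Hf k; apply: CrS_derive; exact: Hf. Qed.

Lemma Cinfty_continuous n (f : 'rV[R]_n -> R) : Cinfty f -> continuous f.
Proof. by move=> /(_ 0%N)/Cr_continuous. Qed.

Lemma Cinfty_differentiable n (f : 'rV[R]_n -> R) x : Cinfty f -> differentiable f x.
Proof. by move=> /(_ 1%N)/CrS_differentiable. Qed.

Lemma Cinfty_derivable n (f : 'rV[R]_n -> R) x v : Cinfty f -> derivable f x v.
Proof. by move=> /(_ 1%N)/CrS_derivable. Qed.

Definition smap n m (g : 'rV[R]_n -> 'rV[R]_m) := forall i, Cinfty (fun x => g x 0 i).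

Lemma Cinfty_comp n m (f : 'rV[R]_m -> R) (g : 'rV[R]_n -> 'rV[R]_m) :
  Cinfty f -> smap g -> Cinfty (f \o g).
Proof. by move=> Hf Hg k; apply: Cr_comp => // i; exact: Hg. Qed.

Lemma smap_comp n m p (f : 'rV[R]_m -> 'rV[R]_p) (g : 'rV[R]_n -> 'rV[R]_m) :
  smap f -> smap g -> smap (f \o g).
Proof. by move=> Hf Hg i; exact: (Cinfty_comp (Hf i) Hg). Qed.

Lemma smap_id n : smap (@id 'rV[R]_n).
Proof. by move=> i; exact: Cinfty_coord. Qed.

Lemma smap_cst n m (c : 'rV[R]_m) : smap (fun _ : 'rV[R]_n => c).
Proof. by move=> i; exact: Cinfty_cst. Qed.

Lemma smap_mulmx n m p (f : 'rV[R]_n -> 'rV[R]_m) (A : 'M[R]_(m, p)) :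
  smap f -> smap (fun x => f x *m A).
Proof.
move=> Hf i; under eq_fun do rewrite mxE.
apply: Cinfty_sum => j; apply: Cinfty_mul; [exact: Hf|exact: Cinfty_cst].
Qed.

Lemma smap_add n m (f g : 'rV[R]_n -> 'rV[R]_m) :
  smap f -> smap g -> smap (fun x => f x + g x).
Proof.
by move=> Hf Hg i; under eq_fun do rewrite mxE; apply: Cinfty_add.
Qed.

Lemma smap_sub n m (f g : 'rV[R]_n -> 'rV[R]_m) :
  smap f -> smap g -> smap (fun x => f x - g x).
Proof.
by move=> Hf Hg i; under eq_fun do rewrite mxE mxE; apply: Cinfty_sub.
Qed.

Lemma smap_row_mx n m p (f : 'rV[R]_n -> 'rV[R]_m) (g : 'rV[R]_n -> 'rV[R]_p) :
  smap f -> smap g -> smap (fun x => row_mx (f x) (g x)).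
Proof.
by move=> Hf Hg i; under eq_fun do rewrite mxE; case: (fintype.split i) => j; [exact: Hf|exact: Hg].
Qed.

Lemma smap_lsubmx m p : smap (fun x : 'rV[R]_(m + p) => lsubmx x).
Proof. by move=> i; under eq_fun do rewrite mxE; exact: Cinfty_coord. Qed.

Lemma smap_rsubmx m p : smap (fun x : 'rV[R]_(m + p) => rsubmx x).
Proof. by move=> i; under eq_fun do rewrite mxE; exact: Cinfty_coord. Qed.

Lemma smap_continuous n m (g : 'rV[R]_n -> 'rV[R]_m) : smap g -> continuous g.
Proof. by move=> Hg; apply: continuous_rV => i; apply: Cinfty_continuous; exact: Hg. Qed.

Lemma Cinfty_smooth1 n (b : R -> R) (g : 'rV[R]_n -> R) :
  smooth1 b -> Cinfty g -> Cinfty (b \o g).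
Proof. by move=> sb Hg k; apply: sb. Qed.

Lemma derive_sum_coord n (f : 'rV[R]_n -> R) x v : differentiable f x ->
  'D_v f x = \sum_i v 0 i * 'D_(delta_mx 0 i) f x.
Proof.
move=> df; rewrite deriveE // linear_rV_sum; apply: eq_bigr => i _.
by rewrite deriveE.
Qed.

(** [cut1] rescaled by r / 2 in each coordinate. The Lipschitz constant is invariant under this
    scaling, and having one C for all r is what allows [local_inverse] to choose the radius after
    C. *)
Lemma cutoff n : exists2 C : R, 0 < C & forall r : R, 0 < r ->
  exists rho : 'rV[R]_n -> 'rV[R]_n,
  [/\ smap rho, forall x, `|rho x| <= r, forall x, `|x| <= r / 2 -> rho x = x &
      forall x y, `|rho x - rho y| <= C * `|x - y|].
Proof.
have [C C0 HC] := @cut1_lipschitz R.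
exists C => // r r0.
have r2 : 0 < r / 2 by rewrite divr_gt0.
pose s := r / 2.
exists (fun x => \row_i (s * cut1 (s^-1 * x 0 i))); split.
- move=> i; under eq_fun do rewrite mxE.
  apply: Cinfty_mul; first exact: Cinfty_cst.
  apply: (Cinfty_smooth1 (g := fun x => s^-1 * x 0 i) (@smooth1_cut1 R)).
  apply: Cinfty_mul; [exact: Cinfty_cst|exact: Cinfty_coord].
- move=> x; apply: rV_norm_le => [|i]; first exact: ltW.
  rewrite mxE normrM (gtr0_norm r2) -[leRHS](@divfK _ 2) //.
  by apply: ler_wpM2l; [exact: ltW|exact: cut1_le2].
- move=> x xs; apply/rowP => i; rewrite mxE cut1_id ?mulrA ?divff ?mul1r ?gt_eqF //.
  rewrite normrM gtr0_norm ?invr_gt0 // mulrC ler_pdivrMr // mul1r.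
  by rewrite (le_trans (rV_coord_le _ _)).
- move=> x y; apply: rV_norm_le => [|i]; first by rewrite mulr_ge0 // ltW.
  rewrite !mxE -mulrBr normrM (gtr0_norm r2).
  rewrite (le_trans (ler_wpM2l (ltW r2) (HC _ _))) //.
  have -> : s^-1 * x 0 i - s^-1 * y 0 i = s^-1 * (x 0 i - y 0 i) by rewrite mulrBr.
  rewrite normrM gtr0_norm ?invr_gt0 // mulrCA mulVKf ?gt_eqF //.
  apply: ler_wpM2l; first exact: ltW.
  by have := rV_coord_le (x - y) i; rewrite !mxE.
Qed.

(** The intermediate point is x + c (y - x) with |c| <= 1 but unknown sign, so its norm is only
    known to be at most r + 2 r; hence the ball of radius 3 r. *)
Lemma mean_value n (f : 'rV[R]_n -> R) (r M : R) (x y : 'rV[R]_n) :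
  Cr 1 f -> (forall z, `|z| <= 3 * r -> forall i, `|'D_(delta_mx 0 i) f z| <= M) ->
  `|x| <= r -> `|y| <= r -> `|f y - f x| <= n%:R * M * `|y - x|.
Proof.
move=> fC HM xr yr.
have [c [c1]] := @MVT_dir _ _ f x (y - x) 1 (fun _ => CrS_derivable fC).
have -> : x + 1 *: (y - x) = y by rewrite scale1r addrC subrK.
rewrite mul1r => ->.
rewrite derive_sum_coord; last exact: CrS_differentiable fC.
rewrite (le_trans (ler_norm_sum _ _ _)) //.
have -> : n%:R * M * `|y - x| = \sum_(i < n) M * `|y - x|.
  by rewrite sumr_const card_ord -mulrA mulr_natl.
apply: ler_sum => i _; rewrite normrM mulrC ler_pM ?rV_coord_le //.
apply: HM; rewrite (le_trans (ler_normD _ _)) // normrZ.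
have yx : `|y - x| <= r + r by rewrite (le_trans (ler_normB _ _)) // lerD.
rewrite normr1 in c1.
have : `|c| * `|y - x| <= 1 * (r + r) by rewrite ler_pM.
by rewrite mul1r; lra.
Qed.

Lemma contraction_fixpoint n (g : 'rV[R]_n -> 'rV[R]_n) :
  (forall x y, `|g x - g y| <= 2^-1 * `|x - y|) -> exists x, g x = x.
Proof.
move=> Hg.
pose X : set 'rV[R]_n := setT.
have gf : set_fun X X g by [].
pose G := HB.pack_for {fun X >-> X} g (isFun.Build _ _ X X g gf).
have ctr : is_contraction G.
  exists (2^-1)%:nng; split => /=; first by rewrite invf_lt1 ?ltr1n.
  by move=> [x y] _ /=; exact: Hg.
pose W := HB.pack_for (completeNormedModType R) 'rV[R]_n (Complete.on 'rV[R]_n).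
have [x _ Hx] := @banach_fixed_point R W X G ctr closedT (ex_intro _ (0 : W) I).
by exists x; rewrite [RHS]Hx.
Qed.

Lemma is_derive_nearP (V : normedModType R) (f : V -> R) (x v : V) (d : R) :
  is_derive x v f d <-> forall e, 0 < e ->
    \forall h \near 0^', `|h^-1 * (f (x + h *: v) - f x) - d| <= e.
Proof.
have E : (fun h : R => h^-1 *: ((f \o shift x) (h *: v) - f x)) =
    (fun h => h^-1 * (f (x + h *: v) - f x)).
  by apply/funext => h; rewrite /= [h *: v + x]addrC.
split=> [[df dd] e e0|H].
  have C : h^-1 * (f (x + h *: v) - f x) @[h --> 0^'] --> d.
    by rewrite -dd /derive -E; exact: df.
  by move/cvgrPdist_le : C => /(_ e e0); apply: filterS => h; rewrite distrC.
have C : h^-1 *: ((f \o shift x) (h *: v) - f x) @[h --> 0^'] --> d.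
  rewrite E; apply/cvgrPdist_le => e e0.
  by apply: filterS (H _ e0) => h; rewrite distrC.
by apply: DeriveDef; [exact: cvgP C|exact: (cvg_lim _ C)].
Qed.

Lemma differentiable_near n (f : 'rV[R]_n -> R) x : differentiable f x ->
  forall e, 0 < e -> \forall u \near (0 : 'rV[R]_n), `|f (x + u) - f x - 'D_u f x| <= e * `|u|.
Proof.
move=> df e e0.
have /diff_locallyP[_ H] := df.
have := H => /eqaddoP /(_ e e0); apply: filterS => u.
by rewrite /= !fctE /= -deriveE // opprD addrA [u + x]addrC.
Qed.

Lemma mulmx_bound m n (A : 'M[R]_(m, n)) : exists2 K, 0 < K &
  forall v : 'rV[R]_m, `|v *m A| <= K * `|v|.
Proof.
pose K := \sum_i \sum_j `|A i j|.
have K0 : 0 <= K by apply: sumr_ge0 => i _; apply: sumr_ge0.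
exists (K + 1); first by rewrite ltr_wpDl.
move=> v; apply: rV_norm_le => [|j]; first by rewrite mulr_ge0 // addr_ge0.
rewrite mxE (le_trans (ler_norm_sum _ _ _)) //.
apply: (@le_trans _ _ (K * `|v|)); last by rewrite ler_wpM2r // lerDl.
rewrite mulr_suml; apply: ler_sum => i _; rewrite normrM mulrC ler_pM ?rV_coord_le //.
by rewrite (bigD1 j) //= lerDl sumr_ge0.
Qed.

Lemma derivative_matrix n m (f : 'rV[R]_n -> 'rV[R]_m) x v j :
  smap f -> 'D_v (fun z => f z 0 j) x =
    (v *m \matrix_(i, k) 'D_(delta_mx 0 i) (fun z => f z 0 k) x) 0 j.
Proof.
move=> sf; rewrite derive_sum_coord; last exact/Cinfty_differentiable/sf.
by rewrite mxE; apply: eq_bigr => i _; rewrite mxE.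
Qed.

Lemma Cr_det n m k (A : 'rV[R]_n -> 'M[R]_m) :
  (forall i j, Cr k (fun x => A x i j)) -> Cr k (fun x => \det (A x)).
Proof.
move=> HA; apply: Cr_sum => s; apply: Cr_mul; first exact: Cr_cst.
by apply: Cr_prod => i; exact: HA.
Qed.

Lemma Cr_invmx n m k (A : 'rV[R]_n -> 'M[R]_m) :
  (forall x, A x \in unitmx) ->
  (forall i j, Cr k (fun x => A x i j)) -> forall i j, Cr k (fun x => invmx (A x) i j).
Proof.
move=> uA HA i j.
have -> : (fun x => invmx (A x) i j) = (fun x => (\det (A x))^-1 * cofactor (A x) j i).
  by apply/funext => x; rewrite /invmx uA !mxE.
apply: Cr_mul.
  apply: Cr_inv; last exact: Cr_det.
  by move=> x; rewrite -unitfE -unitmxE.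
apply: Cr_mul; first exact: Cr_cst.
by apply: Cr_det => a b; under eq_fun do rewrite !mxE; exact: HA.
Qed.

(* Since the perturbation is globally contracting, the inverse is global and no
   domains have to be tracked. *)
Lemma perturbation_inverse n (h : 'rV[R]_n -> 'rV[R]_n) : smap h ->
  (forall x y, `|h x - h y| <= 2^-1 * `|x - y|) ->
  exists G : 'rV[R]_n -> 'rV[R]_n,
    [/\ smap G, forall x, G (x + h x) = x & forall y, G y + h (G y) = y].
Proof.
move=> sh Hh; pose F x := x + h x.
have sF : smap F by apply: smap_add => //; exact: smap_id.
(* F expands distances by at least 1/2. This gives injectivity, the Lipschitz bound for G and,
   infinitesimally, invertibility of the differential. *)
have low x y : `|x - y| <= 2 * `|F x - F y|.
  have := Hh x y; have := ler_normB (F x - F y) (h x - h y).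
  have -> : F x - F y - (h x - h y) = x - y.
    by apply/rowP => i; rewrite !mxE; ring.
  by lra.
have /choice [G HG] y : exists x, F x = y.
  have ctr a b : `|(y - h a) - (y - h b)| <= 2^-1 * `|a - b|.
    have -> : y - h a - (y - h b) = - (h a - h b) by apply/rowP => i; rewrite !mxE; ring.
    by rewrite normrN; exact: Hh.
  have [x Hx] := contraction_fixpoint ctr.
  by exists x; rewrite /F -{1}Hx subrK.
have GF x : G (F x) = x.
  apply/eqP; rewrite -subr_eq0 -normr_le0 (le_trans (low _ _)) // HG subrr.
  by rewrite normr0 mulr0.
have lipG a b : `|G a - G b| <= 2 * `|a - b| by have := low (G a) (G b); rewrite !HG.
pose J x := \matrix_(i, k) 'D_(delta_mx 0 i) (fun z => F z 0 k) x.
have DF x v j : 'D_v (fun z => F z 0 j) x = (v *m J x) 0 j by exact: derivative_matrix.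
(* Along a vector v with v J = 0, F would move x by o(t) only, against the lower bound [low]. *)
have uJ x : J x \in unitmx.
  rewrite -row_free_unit; apply: inj_row_free => v vJ; apply/eqP.
  rewrite -normr_le0 leNgt; apply/negP => v0.
  have e0 : 0 < `|v| / 4 by rewrite divr_gt0.
  have : \forall t \near (0 : R)^', forall j,
      `|t^-1 * (F (x + t *: v) 0 j - F x 0 j) - 0| <= `|v| / 4.
    apply: filter_forall => j.
    have dj : is_derive x v (fun z => F z 0 j) 0.
      have <- : 'D_v (fun z => F z 0 j) x = 0 by rewrite DF vJ mxE.
      exact/derivableP/Cinfty_derivable/sF.
    by have /is_derive_nearP/(_ _ e0) := dj.
  move=> Hn; have nN : \forall t \near (0 : R)^', t != 0 by exact: nbhs_dnbhs_neq.
  have [t [t0 Ht]] := filter_ex (filterI nN Hn).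
  have tp : 0 < `|t| by rewrite normr_gt0.
  have K : `|F (x + t *: v) - F x| <= `|t| * (`|v| / 4).
    apply: rV_norm_le => [|j]; first by rewrite mulr_ge0 // ltW.
    by have := Ht j; rewrite subr0 normrM normfV ler_pdivrMl // !mxE.
  have := low (x + t *: v) x; rewrite [x + _]addrC addrK normrZ.
  have : 0 < `|t| * `|v| by rewrite mulr_gt0.
  move: K; rewrite [x + _]addrC mulrA; lra.
(* For the increment u of G, differentiability of F at x gives t w = u J + o(u), and u = O(t) by the
   Lipschitz bound. Applying the inverse of J, whose bound is K, leaves an error that c was chosen
   to bring down to e. *)
have dG a w i : is_derive a w (fun y => G y 0 i) ((w *m invmx (J (G a))) 0 i).
  apply/is_derive_nearP => e e0.
  set x := G a.
  have [K K0 HK] := mulmx_bound (invmx (J x)).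
  pose c := K * (2 * (`|w| + 1)).
  have c0 : 0 < c by rewrite mulr_gt0 // mulr_gt0 // ltr_wpDl.
  have e0' : 0 < e / c by rewrite divr_gt0.
  have : \forall u \near (0 : 'rV[R]_n), forall j,
      `|F (x + u) 0 j - F x 0 j - (u *m J x) 0 j| <= e / c * `|u|.
    apply: near_forall => j.
    have := differentiable_near (Cinfty_differentiable x (sF j)) e0'.
    by apply: filterS => u; rewrite DF.
  move=> /nbhs_normP [d /= d0 Hd].
  have wp : 0 < 2 * (`|w| + 1) by rewrite mulr_gt0 // ltr_wpDl.
  have dd : 0 < d / (2 * (`|w| + 1)) by rewrite divr_gt0.
  have tN : \forall t \near (0 : R)^', `|t| < d / (2 * (`|w| + 1)) by exact: dnbhs0_lt.
  have nN : \forall t \near (0 : R)^', t != 0 by exact: nbhs_dnbhs_neq.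
  apply: filterS2 tN nN => t td t0.
  pose u := G (a + t *: w) - x.
  have ub : `|u| <= 2 * (`|w| + 1) * `|t|.
    rewrite (le_trans (lipG _ _)) // addrAC subrr add0r normrZ.
    by rewrite -mulrA ler_wpM2l // mulrC ler_wpM2r // lerDl.
  have ud : `|u| < d by rewrite (le_lt_trans ub) // mulrC -ltr_pdivlMr.
  have Hu : `|t *: w - u *m J x| <= e / c * `|u|.
    apply: rV_norm_le => [|j]; first by rewrite mulr_ge0 // ltW.
    have := Hd u; rewrite /= sub0r normrN => /(_ ud j).
    have -> : x + u = G (a + t *: w) by rewrite /u addrC subrK.
    by rewrite !HG !mxE; congr (`|_| <= _); rewrite [a 0 j + _]addrC addrK.
  have E : t^-1 *: u - w *m invmx (J x) = - (t^-1 *: ((t *: w - u *m J x) *m invmx (J x))).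
    have -> : (t *: w - u *m J x) *m invmx (J x) = t *: (w *m invmx (J x)) - u.
      by rewrite mulmxBl mulmxK // -scalemxAl.
    move: (w *m invmx (J x)) (u) => W u'.
    by apply/rowP => k; rewrite !mxE mulrBr mulKf // opprB.
  have -> : t^-1 * (G (a + t *: w) 0 i - x 0 i) - (w *m invmx (J x)) 0 i =
      (t^-1 *: u - w *m invmx (J x)) 0 i by rewrite !mxE.
  apply: le_trans (rV_coord_le _ _) _.
  rewrite E normrN normrZ normfV ler_pdivrMl ?normr_gt0 //.
  apply: le_trans (HK _) _.
  apply: le_trans (ler_wpM2l (ltW K0) Hu) _.
  apply: (@le_trans _ _ (K * (e / c * (2 * (`|w| + 1) * `|t|)))).
    by apply: ler_wpM2l; [exact: ltW|apply: ler_wpM2l; [exact: ltW|]].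
  have -> : K * (e / c * (2 * (`|w| + 1) * `|t|)) = `|t| * (e * (c / c)).
    by rewrite /c; ring.
  by rewrite divff ?gt_eqF // mulr1.
(* Bootstrapping: the derivative of G is a smooth function of G itself, so class C^k for G gives
   C^(k+1). *)
have sG : forall k i, Cr k (fun y => G y 0 i).
  have cG : continuous G by exact: (@lipschitz_continuous _ _ G 2).
  have cGi i : continuous (fun y => G y 0 i).
    move=> y; apply: (@continuous_comp _ _ _ G (fun z : 'rV[R]_n => z 0 i)); first exact: cG.
    exact: coord_continuous.
  elim=> [|k IH] i; first by split.
  apply: (CrS_intro (df := fun w a => (w *m invmx (J (G a))) 0 i)).
  - by move=> a w; exact: is_derive_split (dG a w i).
  - exact: cGi.
  - move=> w; under eq_fun do rewrite mxE.
    apply: Cr_sum => j; apply: Cr_mul; first exact: Cr_cst.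
    apply: (Cr_invmx (A := J \o G)) => [a|a b]; first exact: uJ.
    under eq_fun do rewrite mxE.
    by apply: (@Cr_comp _ _ _ _ ('D_(delta_mx 0 a) (fun z => F z 0 b)) G) => //; exact: Cinfty_derive.
exists G; split => //.
by move=> i k; exact: sG.
Qed.

End InverseFunction.

Section NormalForm.
Context {R : realType}.

Lemma near_comp (T U : topologicalType) (g : T -> U) x (P : U -> Prop) :
  continuous g -> (\forall y \near g x, P y) -> \forall z \near x, P (g z).
Proof. by move=> cg H; exact: (cg x P H). Qed.

Lemma near_lt (T : topologicalType) (f : T -> R) x c :
  continuous f -> f x < c -> \forall y \near x, f y < c.
Proof. by move=> cf; exact: (cvgr_lt _ (cf x)). Qed.

Definition dmap n m (g : 'rV[R]_n -> 'rV[R]_m) (x v : 'rV[R]_n) : 'rV[R]_m :=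
  \row_j 'D_v (fun z => g z 0 j) x.

Lemma derive_comp n m (f : 'rV[R]_m -> R) (g : 'rV[R]_n -> 'rV[R]_m) x v :
  Cinfty f -> smap g -> 'D_v (f \o g) x = 'D_(dmap g x v) f (g x).
Proof.
move=> Hf Hg; have df := Cinfty_differentiable (g x) Hf.
have [_ ->] := is_derive_split (chain_rule (v := v) df (fun i => Cinfty_derivable (Hg i))).
by rewrite (derive_sum_coord _ df); apply: eq_bigr => i _; rewrite mxE.
Qed.

Lemma dmap_comp n m p (f : 'rV[R]_m -> 'rV[R]_p) (g : 'rV[R]_n -> 'rV[R]_m) x v :
  smap f -> smap g -> dmap (f \o g) x v = dmap f (g x) (dmap g x v).
Proof.
move=> Hf Hg; apply/rowP => j; rewrite !mxE.
exact: (@derive_comp _ _ (fun z => f z 0 j) g x v (Hf j) Hg).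
Qed.

Lemma dmapE n m (g : 'rV[R]_n -> 'rV[R]_m) x v : smap g ->
  dmap g x v = v *m \matrix_(i, k) 'D_(delta_mx 0 i) (fun z => g z 0 k) x.
Proof. by move=> Hg; apply/rowP => j; rewrite mxE derivative_matrix. Qed.

Lemma dmap_id n x v : dmap (@id 'rV[R]_n) x v = v.
Proof.
apply/rowP => j; rewrite mxE.
by have [_ ->] := is_derive_split (is_derive_coord x v j).
Qed.

Lemma dmap_add n m (f g : 'rV[R]_n -> 'rV[R]_m) x v : smap f -> smap g ->
  dmap (fun z => f z + g z) x v = dmap f x v + dmap g x v.
Proof.
move=> Hf Hg; apply/rowP => j; rewrite !mxE; under eq_fun do rewrite mxE.
by apply: deriveD; [exact: Cinfty_derivable (Hf j)|exact: Cinfty_derivable (Hg j)].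
Qed.

Lemma dmap_sub n m (f g : 'rV[R]_n -> 'rV[R]_m) x v : smap f -> smap g ->
  dmap (fun z => f z - g z) x v = dmap f x v - dmap g x v.
Proof.
move=> Hf Hg; apply/rowP => j; rewrite !mxE; under eq_fun do rewrite mxE mxE.
by apply: deriveB; [exact: Cinfty_derivable (Hf j)|exact: Cinfty_derivable (Hg j)].
Qed.

Lemma dmap_mulmx n m p (f : 'rV[R]_n -> 'rV[R]_m) (B : 'M[R]_(m, p)) x v : smap f ->
  dmap (fun z => f z *m B) x v = dmap f x v *m B.
Proof.
move=> Hf; have lB i : Cinfty (fun z : 'rV[R]_m => (z *m B) 0 i).
  exact: (smap_mulmx B (@smap_id _ m)).
rewrite -[LHS]/(dmap ((fun z => z *m B) \o f) x v) dmap_comp //.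
apply/rowP => j; rewrite mxE.
pose l (z : 'rV[R]_m) : R^o := (z *m B) 0 j.
have llin : linear l by move=> c a b; rewrite /l mulmxDl -scalemxAl !mxE.
pose lL := HB.pack_for {linear 'rV[R]_m -> R^o} l
  (GRing.isLinear.Build R 'rV[R]_m R^o _ l llin).
rewrite deriveE; last exact/Cinfty_differentiable/lB.
by rewrite -[X in 'd X _]/(lL : _ -> _) diff_lin //; exact: (Cinfty_continuous (lB j)).
Qed.

Lemma dmap_row_mx n m p (f : 'rV[R]_n -> 'rV[R]_m) (g : 'rV[R]_n -> 'rV[R]_p) x v :
  dmap (fun z => row_mx (f z) (g z)) x v = row_mx (dmap f x v) (dmap g x v).
Proof.
apply/rowP => j; rewrite !mxE; under eq_fun do rewrite mxE.
by case: (fintype.split j) => k; rewrite mxE.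
Qed.

Lemma dmap_near n m (f g : 'rV[R]_n -> 'rV[R]_m) x v :
  (\forall z \near x, f z = g z) -> dmap f x v = dmap g x v.
Proof.
move=> fg; apply/rowP => j; rewrite !mxE; apply: near_eq_derive.
by apply: filterS fg => z ->.
Qed.

(** Write f = id + h with h of zero differential at 0. Precomposing h with a cutoff of small radius
    makes it globally contracting and does not change the germ at 0, so [perturbation_inverse]
    applies. *)
Lemma local_inverse n (f : 'rV[R]_n -> 'rV[R]_n) : smap f -> f 0 = 0 ->
  (forall v, dmap f 0 v = v) ->
  exists F G : 'rV[R]_n -> 'rV[R]_n,
    [/\ smap F, smap G, cancel F G, cancel G F & \forall x \near (0 : 'rV[R]_n), F x = f x].
Proof.
move=> sf f0 df; pose h x := f x - x.
have sh : smap h by apply: smap_sub => //; exact: smap_id.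
have dh i j : 'D_(delta_mx 0 i) (fun z => h z 0 j) 0 = 0.
  have : dmap h 0 (delta_mx 0 i) = 0.
    by rewrite dmap_sub // ?df ?dmap_id ?subrr //; exact: smap_id.
  by move=> /rowP/(_ j); rewrite !mxE.
have [C C0 cut] := @cutoff R n.
(* Chosen so that n * d * C is at most 1/2; the successor keeps the denominator nonzero in dimension
   0. *)
pose d := (2 * (n.+1%:R * C))^-1.
have d0 : 0 < d by rewrite invr_gt0 mulr_gt0 // mulr_gt0.
have : \forall z \near (0 : 'rV[R]_n), forall i, forall j,
    `|'D_(delta_mx 0 i) (fun z => h z 0 j) z| < d.
  apply: near_forall => i; apply: near_forall => j.
  have c : continuous ('D_(delta_mx 0 i) (fun z => h z 0 j)).
    exact/Cinfty_continuous/Cinfty_derive/sh.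
  by apply: (near_lt (continuous_norm c)); rewrite dh normr0.
move=> /nbhs_normP [r /= r0 Hr].
(* [mean_value] needs the derivative bound on three times the radius of the points, and 3 * (r / 4)
   < r. *)
have r4 : 0 < r / 4 by rewrite divr_gt0.
have [rho [srho brho idrho lrho]] := cut _ r4.
have sht : smap (h \o rho) by exact: smap_comp.
have lip x y : `|(h \o rho) x - (h \o rho) y| <= 2^-1 * `|x - y|.
  apply: rV_norm_le => [|j]; first by rewrite mulr_ge0 // invr_ge0.
  have Hb (z : 'rV[R]_n) : `|z| <= 3 * (r / 4) -> forall i, `|'D_(delta_mx 0 i) (fun z => h z 0 j) z| <= d.
    move=> zr i; apply: ltW; apply: Hr; rewrite /= sub0r normrN.
    by rewrite (le_lt_trans zr) //; lra.
  have := mean_value (sh j 1%N) Hb (brho y) (brho x); rewrite !mxE => /le_trans; apply.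
  have nd : 0 <= n%:R * d by rewrite mulr_ge0 // ltW.
  apply: le_trans (ler_wpM2l nd (lrho x y)) _.
  rewrite mulrA; apply: ler_wpM2r => //.
  have -> : n%:R * d * C = n%:R / (2 * n.+1%:R).
    by rewrite /d !invfM; field; rewrite (gt_eqF C0) nat1r pnatr_eq0.
  rewrite ler_pdivrMr ?mulr_gt0 // mulKf // ler_nat //.
have [G [sG GF FG]] := perturbation_inverse sht lip.
exists (fun x => x + (h \o rho) x), G; split => //.
- by apply: smap_add => //; exact: smap_id.
- have : \forall x \near (0 : 'rV[R]_n), `|x| < r / 4 / 2 by apply: nbhs0_lt; rewrite divr_gt0.
  by apply: filterS => x xr; rewrite /= idrho ?ltW // /h addrC subrK.
Qed.

Lemma row_base_rank (F : fieldType) m n p (A : 'M[F]_(m, n)) : \rank A = p ->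
  exists2 K : 'M[F]_(p, n), row_free K & (K :=: A)%MS.
Proof. by move=> <-; exists (row_base A); [exact: row_base_free|exact: eq_row_base]. Qed.

(* The linear map [P] is a coordinate system on the zero set of the submersion
   germ [H], with parametrization [k]. *)
Lemma implicit_chart m p q (H : 'rV[R]_m -> 'rV[R]_q) : m = (q + p)%N ->
  smap H -> H 0 = 0 -> (forall w, exists v, dmap H 0 v = w) ->
  exists (P : 'M[R]_(m, p)) (k : 'rV[R]_p -> 'rV[R]_m),
  [/\ smap k, k 0 = 0,
      \forall w \near (0 : 'rV[R]_m), H w = 0 -> k (w *m P) = w,
      \forall c \near (0 : 'rV[R]_p), H (k c) = 0 /\ k c *m P = c &
      forall v, dmap H 0 v = 0 -> dmap k 0 (v *m P) = v].
Proof.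
move=> e; subst m => sH H0 surj.
pose A := \matrix_(i, k) 'D_(delta_mx 0 i) (fun z => H z 0 k) 0.
have dA v : dmap H 0 v = v *m A by exact: dmapE.
have fA : row_full A.
  rewrite -sub1mx; apply/row_subP => i; have [v] := surj (row i 1%:M).
  by rewrite dA => <-; exact: submxMl.
have rk : \rank (kermx A) = p.
  by rewrite mxrank_ker (eqP fA) addKn.
have [K Kfree KE] := row_base_rank rk.
have KA : K *m A = 0 by apply/sub_kermxP; rewrite KE.
(* The rows of [pinvmx A] are preimages of the standard basis and those of K span the kernel of A. B
   is thus a basis adapted to the differential of H, and the last p columns P of its inverse are the
   coordinates along the kernel. *)
pose B := col_mx (pinvmx A) K.
have BA : B *m A = col_mx 1%:M 0 by rewrite mul_col_mx KA mulVpmx.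
have uB : B \in unitmx.
  rewrite -row_free_unit; apply: inj_row_free => v.
  rewrite -[v]hsubmxK mul_row_col => E.
  have a0 : lsubmx v = 0.
    have := congr1 (mulmx^~ A) E.
    rewrite mulmxDl -(mulmxA (lsubmx v)) -(mulmxA (rsubmx v)) KA (mulVpmx fA).
    by rewrite mulmx1 mulmx0 addr0 mul0mx.
  rewrite a0 mul0mx add0r in E.
  have : rsubmx v = 0 by apply: (row_free_inj Kfree); rewrite E mul0mx.
  by rewrite a0 => ->; rewrite row_mx0.
pose M := invmx B.
have MA : A = M *m col_mx 1%:M 0 by rewrite -BA mulKmx.
pose P := rsubmx M.
have EA : lsubmx M = A by rewrite MA -{2}[M]hsubmxK mul_row_col mulmx1 mulmx0 addr0.
have MB : row_mx A P *m B = 1%:M by rewrite -EA hsubmxK mulVmx.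
have BM : B *m row_mx A P = 1%:M by rewrite -EA hsubmxK mulmxV.
(* The factor B makes the differential at 0 the identity. The local inverse G then straightens H to
   the first q coordinates, and k is G restricted to the slice on which these vanish. *)
pose f w := row_mx (H w) (w *m P) *m B.
have sP : smap (fun w : 'rV[R]_(q + p) => w *m P) by exact: (smap_mulmx P (@smap_id _ _)).
have sf : smap f by apply: smap_mulmx; exact: smap_row_mx.
have f0 : f 0 = 0 by rewrite /f H0 mul0mx row_mx0 mul0mx.
have df v : dmap f 0 v = v.
  rewrite dmap_mulmx ?dmap_row_mx; last exact: smap_row_mx.
  rewrite dA (@dmap_mulmx _ _ _ id P) ?dmap_id; last exact: smap_id.
  by rewrite -mul_mx_row -mulmxA MB mulmx1.
have [F [G [sF sG FG GF nF]]] := local_inverse sf f0 df.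
have F0 : F 0 = 0 by rewrite (nbhs_singleton nF).
have G0 : G 0 = 0 by rewrite -[in LHS]F0 FG.
pose j (c : 'rV[R]_p) : 'rV[R]_(q + p) := row_mx 0 c *m B.
have sj : smap j by apply: smap_mulmx; apply: smap_row_mx; [exact: smap_cst|exact: smap_id].
have j0 : j 0 = 0 by rewrite /j row_mx0 mul0mx.
pose k := G \o j.
have sk : smap k by exact: smap_comp.
have k0 : k 0 = 0 by rewrite /k /= j0.
have near2 : \forall c \near (0 : 'rV[R]_p), H (k c) = 0 /\ k c *m P = c.
  have : \forall c \near (0 : 'rV[R]_p), F (k c) = f (k c).
    have := @near_comp _ _ k 0 (fun w => F w = f w) (smap_continuous sk).
    by rewrite k0; exact.
  apply: filterS => c; rewrite /k /= GF /j /f => E.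
  have : row_mx 0 c = row_mx (H (G (row_mx 0 c *m B))) (G (row_mx 0 c *m B) *m P).
    by apply: (row_free_inj (A := B)); rewrite ?row_free_unit.
  by move=> /eq_row_mx [<- <-].
exists P, k; split => //.
- apply: filterS nF => w Fw Hw; rewrite /k /=; apply: (can_inj FG).
  by rewrite GF Fw /f /j Hw.
- move=> v Hv.
  have : dmap k 0 (v *m P) *m row_mx A P = v *m row_mx A P.
    rewrite !mul_mx_row -!dA Hv; congr row_mx.
      rewrite -{1}k0 -dmap_comp // (@dmap_near _ _ _ (fun _ => 0)).
        by apply/rowP => i; rewrite !mxE; exact: derive_cst.
      by apply: filterS near2 => c [].
    rewrite -dmap_mulmx // (@dmap_near _ _ _ id) ?dmap_id //.
    by apply: filterS near2 => c [].
  by move=> /(congr1 (mulmx^~ B)); rewrite -!mulmxA MB !mulmx1.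
Qed.

End NormalForm.

(** * Hadamard's lemma *)

Section Hadamard.
Context {R : realType}.

Local Notation mu := (@lebesgue_measure R).

Definition int01 (phi : R -> R) : R := \int[mu]_(t in `[0, 1]) phi t.

Let int01_integrable (phi : R -> R) : continuous phi -> mu.-integrable `[0, 1] (EFin \o phi).
Proof.
move=> cphi; apply: continuous_compact_integrable; first exact: segment_compact.
exact: continuous_subspaceT.
Qed.

Lemma int01_sub (phi psi : R -> R) : continuous phi -> continuous psi ->
  int01 (fun t => phi t - psi t) = int01 phi - int01 psi.
Proof. by move=> c1 c2; apply: RintegralB => //; exact: int01_integrable. Qed.

Lemma int01_scale (c : R) (phi : R -> R) : continuous phi ->
  int01 (fun t => c * phi t) = c * int01 phi.
Proof. by move=> c1; apply: RintegralZl => //; exact: int01_integrable. Qed.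

Lemma int01_cst (c : R) : int01 (fun _ => c) = c.
Proof.
rewrite /int01 Rintegral_cst //= lebesgue_measure_itv /= lte_fin ltr01 /=.
by rewrite oppr0 addr0 mulr1.
Qed.

Lemma int01_bound (phi : R -> R) (M : R) : continuous phi ->
  (forall t, 0 <= t <= 1 -> `|phi t| <= M) -> `|int01 phi| <= M.
Proof.
move=> c1 HM; rewrite -[leRHS]int01_cst.
apply: le_trans (le_normr_Rintegral _ (int01_integrable c1)) _ => //.
apply: le_Rintegral => //.
- by apply: int01_integrable; exact: continuous_norm.
- by apply: int01_integrable => x; exact: cvg_cst.
Qed.

Lemma int01_derive (F f : R -> R) : (forall t : R, is_derive t (1 : R) F (f t)) ->
  continuous f -> int01 f = F 1 - F 0.
Proof.
move=> dF cf; rewrite /int01 /Rintegral.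
have cF t : F @ t --> F t.
  by apply/differentiable_continuous/derivable1_diffP; exact: ex_derive.
rewrite (@continuous_FTC2 _ _ F) //.
- exact: continuous_subspaceT.
- split; first by move=> x _; exact: ex_derive.
  + by apply: cvg_at_right_filter; exact: cF.
  + by apply: cvg_at_left_filter; exact: cF.
- by move=> x _; rewrite derive1E; exact: derive_val.
Qed.

Lemma continuous_ball_bound n (g : 'rV[R]_n -> R) (r : R) : continuous g ->
  exists2 M, 0 < M & forall z, `|z| <= r -> `|g z| <= M.
Proof.
move=> cg; have [r0|r0] := ltP r 0.
  by exists 1 => // z zr; have := normr_ge0 z; lra.
pose B := [set x : 'rV[R]_n | `|x| <= r].
have cB : compact B.
  apply: bounded_closed_compact.
    by exists r; split; [exact: num_real|move=> x xr y /le_trans; apply; exact: ltW].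
  rewrite /B (_ : [set _ | _] = (fun x => `|x|) @^-1` [set y : R | y <= r]) //.
  by apply: preimage_closed (@closed_le _ r) => x _; exact: norm_continuous.
have B0 : B !=set0 by exists 0; rewrite /B /= normr0.
have [c _ Hc] := EVT_max_rV B0 cB (continuous_subspaceT (continuous_norm cg)).
exists (`|g c| + 1); first by rewrite ltr_wpDl.
by move=> z zr; rewrite (le_trans (Hc z _)) ?lerDl // inE.
Qed.

Lemma Cinfty_lipschitz n (f : 'rV[R]_n -> R) (r : R) : Cinfty f ->
  exists2 M, 0 < M & forall x y, `|x| <= r -> `|y| <= r -> `|f y - f x| <= M * `|y - x|.
Proof.
move=> Hf.
have H i : exists M, 0 < M /\ forall z, `|z| <= 3 * r -> `|'D_(delta_mx 0 i) f z| <= M.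
  have [M M0 HM] := continuous_ball_bound (3 * r) (Cinfty_continuous (Cinfty_derive (delta_mx 0 i) Hf)).
  by exists M.
have /choice [M HM] := H.
pose S := \sum_i M i.
have S0 : 0 <= S by apply: sumr_ge0 => i _; apply: ltW; case: (HM i).
exists (n%:R * S + 1); first by rewrite ltr_wpDl // mulr_ge0.
move=> x y xr yr.
have HS (z : 'rV[R]_n) : `|z| <= 3 * r -> forall i, `|'D_(delta_mx 0 i) f z| <= S.
  move=> zr i; have [_ /(_ z zr)] := HM i; move=> /le_trans; apply.
  by rewrite /S (bigD1 i) //= lerDl sumr_ge0 // => k _; apply: ltW; case: (HM k).
apply: le_trans (mean_value (Hf 1%N) HS xr yr) _.
by apply: ler_wpM2r => //; rewrite lerDl.
Qed.

Lemma continuous_sub (T : topologicalType) (f g : T -> R) :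
  continuous f -> continuous g -> continuous (fun x => f x - g x).
Proof. by move=> cf cg x; apply: cvgB; [exact: cf|exact: cg]. Qed.

Lemma locally_lipschitz_continuous (V : normedModType R) (g : V -> R) :
  (forall x, exists2 M, 0 < M & forall y, `|y - x| < 1 -> `|g y - g x| <= M * `|y - x|) ->
  continuous g.
Proof.
move=> Hg x; have [M M0 HM] := Hg x.
apply/cvgrPdist_le => e e0.
have : \forall y \near x, `|y - x| < Num.min 1 (e / M).
  apply/nbhs_normP; exists (Num.min 1 (e / M)); first by rewrite /= lt_min ltr01 divr_gt0.
  by move=> y; rewrite /= distrC.
apply: filterS => y; rewrite lt_min => /andP[y1 ye].
by rewrite distrC (le_trans (HM _ y1)) // mulrC -ler_pdivlMr // ltW.
Qed.

(* The weight [t ^+ m] makes the family closed under directional derivatives. *)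
Definition radial_int (m : nat) n (f : 'rV[R]_n -> R) (x : 'rV[R]_n) : R :=
  int01 (fun t => t ^+ m * f (t *: x)).

Let continuous_radial m n (f : 'rV[R]_n -> R) x : continuous f ->
  continuous (fun t : R => t ^+ m * f (t *: x)).
Proof.
move=> cf; apply: continuous_mul; first by move=> t; exact: exprn_continuous.
move=> t; apply: continuous_comp; last exact: cf.
exact: (@scalel_continuous _ _ x t).
Qed.

Lemma radial_norm_le n (x : 'rV[R]_n) (t : R) r : 0 <= t <= 1 -> `|x| <= r -> `|t *: x| <= r.
Proof.
move=> /andP[t0 t1] xr; rewrite normrZ (ger0_norm t0) (le_trans _ xr) //.
by rewrite -[leRHS]mul1r ler_wpM2r.
Qed.

Lemma radial_int_continuous m n (f : 'rV[R]_n -> R) : Cinfty f -> continuous (radial_int m f).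
Proof.
move=> Hf; apply: locally_lipschitz_continuous => x; have cf := Cinfty_continuous Hf.
have [M M0 HM] := Cinfty_lipschitz (`|x| + 1) Hf; exists M => // y y1.
rewrite /radial_int -int01_sub; [|exact: continuous_radial|exact: continuous_radial].
apply: int01_bound.
  by move=> t; apply: cvgB; exact: continuous_radial.
move=> t t01; have /andP[t0 t1] := t01.
have tm : 0 <= t ^+ m <= 1 by rewrite exprn_ge0 // exprn_ile1.
have /andP[tm0 tm1] := tm.
rewrite -mulrBr normrM (ger0_norm tm0) -[leRHS]mul1r; apply: ler_pM => //.
apply: le_trans (HM (t *: x) (t *: y) _ _) _.
- by apply: radial_norm_le => //; rewrite lerDl.
- apply: radial_norm_le => //; rewrite -[y](subrK x) (le_trans (ler_normD _ _)) //.
  by rewrite addrC lerD2l ltW.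
- rewrite -scalerBr normrZ (ger0_norm t0); apply: ler_wpM2l; first exact: ltW.
  by rewrite -[leRHS]mul1r ler_wpM2r.
Qed.

(** Differentiation under the integral sign without dominated convergence: the mean value theorem
    and the Lipschitz bound for ['D_v f] make the error of the integrand O(h), uniformly for t in
    [0, 1]. *)
Lemma radial_int_derive m n (f : 'rV[R]_n -> R) x v : Cinfty f ->
  is_derive x v (radial_int m f) (radial_int m.+1 ('D_v f) x).
Proof.
move=> Hf; have cf := Cinfty_continuous Hf.
have Hdf := Cinfty_derive v Hf; have cdf := Cinfty_continuous Hdf.
have [M M0 HM] := Cinfty_lipschitz (`|x| + `|v|) Hdf.
apply/is_derive_nearP => e e0.
pose d := e / (M * (`|v| + 1)).
have Mv : 0 < M * (`|v| + 1) by rewrite mulr_gt0 // ltr_wpDl.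
have d0 : 0 < d by rewrite divr_gt0.
have hN : \forall h \near (0 : R)^', `|h| < Num.min 1 d.
  by apply: dnbhs0_lt; rewrite lt_min ltr01.
have nN : \forall h \near (0 : R)^', h != 0 by exact: nbhs_dnbhs_neq.
apply: filterS2 hN nN => h; rewrite lt_min => /andP[h1 hd] h0.
have k1 := @continuous_radial m _ _ (x + h *: v) cf.
have k2 := @continuous_radial m _ _ x cf.
have k3 := @continuous_radial m.+1 _ _ x cdf.
have k4 := continuous_sub k1 k2.
have k5 : continuous (fun t : R =>
    h^-1 * (t ^+ m * f (t *: (x + h *: v)) - t ^+ m * f (t *: x))).
  by apply: continuous_mul => //; exact: cst_continuous.
rewrite /radial_int -(int01_sub k1 k2) -(int01_scale _ k4) -(int01_sub k5 k3).
apply: int01_bound; first exact: (continuous_sub k5 k3).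
move=> t t01; have /andP[t0 t1] := t01.
have tm : 0 <= t ^+ m <= 1 by rewrite exprn_ge0 // exprn_ile1.
have /andP[tm0 tm1] := tm.
have [c [c1 Hc]] := @MVT_dir _ _ f (t *: x) v (t * h) (fun _ => Cinfty_derivable Hf).
have th : `|t * h| <= `|h| by rewrite normrM (ger0_norm t0) -[leRHS]mul1r ler_wpM2r.
have ch : `|c| <= `|h| by exact: le_trans th.
have E : t *: (x + h *: v) = t *: x + (t * h) *: v by rewrite scalerDr scalerA.
rewrite E.
have -> : h^-1 * (t ^+ m * f (t *: x + (t * h) *: v) - t ^+ m * f (t *: x)) -
    t ^+ m.+1 * 'D_v f (t *: x) =
    t ^+ m * (t * ('D_v f (t *: x + c *: v) - 'D_v f (t *: x))).
  by rewrite -mulrBr Hc exprSr; field.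
rewrite normrM (ger0_norm tm0) -[leRHS]mul1r; apply: ler_pM => //.
rewrite normrM (ger0_norm t0) -[leRHS]mul1r; apply: ler_pM => //.
have nx : `|t *: x| <= `|x| by exact: radial_norm_le.
apply: le_trans (HM (t *: x) (t *: x + c *: v) _ _) _.
- by rewrite (le_trans nx) // lerDl.
- rewrite (le_trans (ler_normD _ _)) // lerD // normrZ -[leRHS]mul1r ler_wpM2r //.
  by rewrite (le_trans ch) // ltW.
- rewrite [t *: x + _]addrC addrK normrZ.
  have : `|c| * `|v| <= d * (`|v| + 1).
    by apply: ler_pM => //; [rewrite (le_trans ch) // ltW|rewrite lerDl].
  move=> /(ler_wpM2l (ltW M0)) /le_trans; apply.
  by rewrite mulrCA /d divfK ?gt_eqF.
Qed.

Lemma radial_int_Cinfty m n (f : 'rV[R]_n -> R) : Cinfty f -> Cinfty (radial_int m f).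
Proof.
move=> Hf k; elim: k m f Hf => [|k IH] m f Hf.
  by split => //; exact: radial_int_continuous.
apply: (CrS_intro (df := fun v => radial_int m.+1 ('D_v f))).
- by move=> x v; exact: is_derive_split (radial_int_derive m x v Hf).
- exact: radial_int_continuous.
- by move=> v; apply: IH; exact: Cinfty_derive.
Qed.

(** Integrate the derivative of f along the segment from a to x; the g i are the radial integrals of
    the partial derivatives. This form is what lets an abstract derivation at a be computed, through
    [tangent_chain]. *)
Lemma hadamard n (f : 'rV[R]_n -> R) (a : 'rV[R]_n) : Cinfty f ->
  exists g : 'I_n -> 'rV[R]_n -> R, [/\ forall i, Cinfty (g i),
    forall i, g i a = 'D_(delta_mx 0 i) f a &
    forall x, f x = f a + \sum_i (x 0 i - a 0 i) * g i x].
Proof.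
move=> Hf.
pose sh (x : 'rV[R]_n) := x + a.
have ssh : smap sh by apply: smap_add; [exact: smap_id|exact: smap_cst].
pose F := f \o sh.
have HF : Cinfty F by exact: Cinfty_comp.
have DF v x : 'D_v F x = 'D_v f (x + a).
  rewrite derive_comp // dmap_add ?dmap_id //; [|exact: smap_id|exact: smap_cst].
  suff -> : dmap (fun=> a) x v = 0 by rewrite addr0.
  by apply/rowP => i; rewrite !mxE; exact: derive_cst.
pose bk (x : 'rV[R]_n) := x - a.
have sbk : smap bk by apply: smap_sub; [exact: smap_id|exact: smap_cst].
exists (fun i => radial_int 0 ('D_(delta_mx 0 i) F) \o bk); split.
- by move=> i; apply: Cinfty_comp => //; apply: radial_int_Cinfty; exact: Cinfty_derive.
- move=> i; rewrite /= /bk subrr /radial_int.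
  rewrite (_ : (fun t : R => _) = fun=> 'D_(delta_mx 0 i) f a) ?int01_cst //.
  by apply/funext => t; rewrite expr0 mul1r scaler0 DF add0r.
- move=> x.
  have ci i : continuous ('D_(delta_mx 0 i) F) by exact/Cinfty_continuous/Cinfty_derive.
  have dl (t : R) : is_derive t (1 : R) (fun s : R => F (0 + s *: bk x)) ('D_(bk x) F (0 + t *: bk x)).
    by apply: is_derive_line; exact: Cinfty_derivable.
  have E := int01_derive dl.
  have -> : f x = F (0 + 1 *: bk x) by rewrite /F /= /sh /bk add0r scale1r subrK.
  have -> : f a = F (0 + 0 *: bk x) by rewrite /F /= /sh add0r scale0r add0r.
  have cE : continuous (fun t : R => 'D_(bk x) F (0 + t *: bk x)).
    have cD := Cinfty_continuous (Cinfty_derive (bk x) HF).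
    under eq_fun do rewrite add0r.
    by have := @continuous_radial 0 _ _ (bk x) cD; under eq_fun do rewrite expr0 mul1r.
  rewrite -[LHS](subrK (F (0 + 0 *: bk x))) -(E cE) addrC; congr (_ + _).
  rewrite (_ : (fun t : R => _) = fun t => \sum_i (bk x) 0 i * 'D_(delta_mx 0 i) F (t *: bk x)); last first.
    by apply/funext => t; rewrite add0r derive_sum_coord //; exact: Cinfty_differentiable.
  have cl : forall i, continuous (fun t : R => 'D_(delta_mx 0 i) F (t *: bk x)).
    move=> i; have := @continuous_radial 0 _ _ (bk x) (ci i).
    by under eq_fun do rewrite expr0 mul1r.
  have S (s : seq 'I_n) : int01 (fun t => \sum_(i <- s) bk x 0 i * 'D_(delta_mx 0 i) F (t *: bk x)) =
     \sum_(i <- s) bk x 0 i * int01 (fun t => 'D_(delta_mx 0 i) F (t *: bk x)).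
    elim: s => [|i s IH].
      under eq_fun do rewrite big_nil.
      by rewrite big_nil int01_cst.
    under eq_fun do rewrite big_cons.
    rewrite big_cons -IH -int01_scale //.
    set A := fun t => _ * _; set B := fun t => \sum_(_ <- _) _.
    have cA : continuous A by apply: continuous_mul => //; exact: cst_continuous.
    have cB : continuous B.
      by apply: continuous_sum => k; apply: continuous_mul => //; exact: cst_continuous.
    by apply: RintegralD => //; exact: int01_integrable.
  rewrite S; apply: eq_bigr => i _; rewrite !mxE; congr (_ * _).
  by rewrite /radial_int /=; congr int01; apply/funext => t; rewrite expr0 mul1r.
Qed.

End Hadamard.

(** * Smooth maps *)

Section SmoothSpaces.
Context {R : realType}.

Lemma sm_closure_sub (T : topologicalType) (F : set (T -> R)) : F `<=` sm_closure F.
Proof.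
move=> f Ff x; exists 1%N, (fun _ => f), (fun z : 'rV[R]_1 => z 0 0); split => //.
- exact: Cinfty_coord.
- by apply: nearW => y; rewrite mxE.
Qed.

Lemma smap_reindex n m (h : 'I_m -> 'I_n) : smap (fun z : 'rV[R]_n => \row_j z 0 (h j)).
Proof. by move=> j; under eq_fun do rewrite mxE; exact: Cinfty_coord. Qed.

(** A function of functions is flattened to one function of all the inner arguments, which are
    indexed by the dependent sum J of the finite index sets. *)
Lemma sm_closure_idem (T : topologicalType) (F : set (T -> R)) :
  sm_closure (sm_closure F) `<=` sm_closure F.
Proof.
move=> f Hf x; have [k [a [g [Ha Hg fE]]]] := Hf x.
have H i : exists s : {m : nat & (('I_m -> T -> R) * ('rV[R]_m -> R))%type},
    [/\ forall j, F ((tagged s).1 j), Cinfty (tagged s).2 &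
        \forall y \near x, a i y = (tagged s).2 (\row_j (tagged s).1 j y)].
  have [m [b [h [Hb Hh aE]]]] := Ha i x.
  by exists (Tagged (fun m => (('I_m -> T -> R) * ('rV[R]_m -> R))%type) (b, h)).
have /choice [s Hs] := H.
pose J := {i : 'I_k & 'I_(tag (s i))}.
pose B (q : 'I_#|{: J}|) : T -> R := (tagged (s (tag (enum_val q)))).1 (tagged (enum_val q)).
pose G (z : 'rV[R]_#|{: J}|) : 'rV[R]_k :=
  \row_i (tagged (s i)).2 (\row_j z 0 (enum_rank (Tagged (fun i => 'I_(tag (s i))) j))).
exists #|{: J}|, B, (g \o G); split.
- by move=> q; have [h _ _] := Hs (tag (enum_val q)); exact: (h (tagged (enum_val q))).
- apply: Cinfty_comp => // i; have [_ Hi _] := Hs i.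
  pose h (j : 'I_(tag (s i))) := enum_rank (Tagged (fun i => 'I_(tag (s i))) j : J).
  have := Cinfty_comp Hi (@smap_reindex _ _ h); congr Cinfty.
  by apply/funext => z; rewrite /G mxE.
- have N : \forall y \near x, forall i, a i y = (tagged (s i)).2 (\row_j (tagged (s i)).1 j y).
    by apply: near_forall => i; have [] := Hs i.
  apply: filterS2 fE N => y -> Hy /=; congr g; apply/rowP => i; rewrite !mxE Hy.
  congr ((tagged (s i)).2 _); apply/rowP => j; rewrite !mxE /B.
  by rewrite enum_rankK.
Qed.

(** The axioms of a Sikorski differential structure in one inclusion: locality, and stability under
    smooth operations of finitely many arguments. *)
Definition smclosed (M : smooth_space R) := sm_closure (smfun M) `<=` smfun M.

Lemma manifold_smclosed n (M : smooth_space R) : manifold n M -> smclosed M.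
Proof. by case. Qed.

Lemma sprod_smclosed (X Y : smooth_space R) : smclosed (sprod X Y).
Proof. exact: sm_closure_idem. Qed.

Lemma ssub_smclosed (X : smooth_space R) (A : set X) : smclosed (ssub A).
Proof. exact: sm_closure_idem. Qed.

Lemma continuous_local (T : topologicalType) (f : T -> R) :
  (forall x : T, exists2 g, continuous g & \forall y \near x, f y = g y) -> continuous f.
Proof.
move=> H x; have [g cg fg] := H x.
rewrite /continuous_at (nbhs_singleton fg).
have E : {near x, g =1 f} by apply: filterS fg => y ->.
by apply: cvg_trans (cg x); exact: near_eq_cvg.
Qed.

Lemma Cr_local n k (f : 'rV[R]_n -> R) :
  (forall x : 'rV[R]_n, exists2 g, Cr k g & \forall y \near x, f y = g y) -> Cr k f.
Proof.
elim: k f => [|k IH] f H.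
  split => //; apply: continuous_local => x; have [g [cg _] fg] := H x; by exists g.
have c : continuous f.
  apply: (@Cr_continuous _ _ k); apply: IH => x.
  by have [g Hg fg] := H x; exists g => //; exact: Cr_lower.
split => // v; split.
  move=> x; have [g Hg fg] := H x.
  apply: (near_eq_derivable _ (CrS_derivable (v := v) (x := x) Hg)).
  by apply: filterS fg => y ->.
apply: IH => x; have [g Hg fg] := H x; exists ('D_v g); first exact: CrS_derive.
have := nbhs_interior fg; apply: filterS => y fgy; apply: near_eq_derive.
exact: fgy.
Qed.

Lemma euclid_smclosed n : smclosed (euclid R n).
Proof.
move=> f Hf k; apply: Cr_local => x; have [m [a [g [Ha Hg fE]]]] := Hf x.
exists (g \o (fun y => \row_i a i y)) => //.
apply: Cr_comp; first exact: Hg.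
by move=> i; under eq_fun do rewrite mxE; exact: Ha.
Qed.

Section Closed.
Variables (M : smooth_space R) (cM : smclosed M).

Lemma smf_local (f : M -> R) :
  (forall x : M, exists2 g, smfun M g & \forall y \near x, f y = g y) -> smfun M f.
Proof.
move=> H; apply: cM => x; have [g Hg fg] := H x.
exists 1%N, (fun _ => g), (fun z : 'rV[R]_1 => z 0 0); split => //.
- exact: Cinfty_coord.
- by apply: filterS fg => y ->; rewrite mxE.
Qed.

Lemma smf_comp n (g : 'rV[R]_n -> R) (a : M -> 'rV[R]_n) : Cinfty g ->
  (forall i, smfun M (fun y => a y 0 i)) -> smfun M (fun y => g (a y)).
Proof.
move=> Hg Ha; apply: cM => x; exists n, (fun i y => a y 0 i), g; split => //.
by apply: nearW => y; congr g; apply/rowP => i; rewrite mxE.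
Qed.

Lemma smf_cst c : smfun M (fun _ => c).
Proof.
by apply: (@smf_comp 0 (fun _ => c) (fun _ => 0)); [exact: Cinfty_cst|case].
Qed.

Lemma smf_add f g : smfun M f -> smfun M g -> smfun M (fun y => f y + g y).
Proof.
move=> Hf Hg.
have := @smf_comp (1 + 1) (fun z => z 0 (lshift _ 0) + z 0 (rshift _ 0))
  (fun y => row_mx (f y)%:M (g y)%:M).
have -> : (fun y => row_mx (f y)%:M (g y)%:M 0 (lshift 1 0) +
   row_mx (f y)%:M (g y)%:M 0 (rshift 1 0)) = (fun y => f y + g y).
  by apply/funext => y; rewrite row_mxEl row_mxEr !mxE.
apply; first by apply: Cinfty_add; exact: Cinfty_coord.
move=> i; under eq_fun do rewrite mxE; case: (fintype.split i) => j.
  by under eq_fun do rewrite mxE (ord1 j) eqxx.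
by under eq_fun do rewrite mxE (ord1 j) eqxx.
Qed.

Lemma smf_mul f g : smfun M f -> smfun M g -> smfun M (fun y => f y * g y).
Proof.
move=> Hf Hg.
have := @smf_comp (1 + 1) (fun z => z 0 (lshift _ 0) * z 0 (rshift _ 0))
  (fun y => row_mx (f y)%:M (g y)%:M).
have -> : (fun y => row_mx (f y)%:M (g y)%:M 0 (lshift 1 0) *
   row_mx (f y)%:M (g y)%:M 0 (rshift 1 0)) = (fun y => f y * g y).
  by apply/funext => y; rewrite row_mxEl row_mxEr !mxE.
apply; first by apply: Cinfty_mul; exact: Cinfty_coord.
move=> i; under eq_fun do rewrite mxE; case: (fintype.split i) => j.
  by under eq_fun do rewrite mxE (ord1 j) eqxx.
by under eq_fun do rewrite mxE (ord1 j) eqxx.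
Qed.

Lemma smf_scale c f : smfun M f -> smfun M (fun y => c * f y).
Proof. by move=> Hf; apply: smf_mul => //; exact: smf_cst. Qed.

Lemma smf_sub f g : smfun M f -> smfun M g -> smfun M (fun y => f y - g y).
Proof.
move=> Hf Hg; have := smf_add Hf (smf_scale (-1) Hg); congr smfun.
by apply/funext => y; rewrite mulN1r.
Qed.

Lemma smf_sum I (r : seq I) (P : pred I) (F : I -> M -> R) :
  (forall i, smfun M (F i)) -> smfun M (fun x => \sum_(i <- r | P i) F i x).
Proof.
move=> cF; elim: r => [|i r IH].
  by under eq_fun do rewrite big_nil; exact: smf_cst.
under eq_fun do rewrite big_cons.
by case: (P i) => //; apply: smf_add.
Qed.

Lemma smf_prod I (r : seq I) (P : pred I) (F : I -> M -> R) :
  (forall i, smfun M (F i)) -> smfun M (fun x => \prod_(i <- r | P i) F i x).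
Proof.
move=> cF; elim: r => [|i r IH].
  by under eq_fun do rewrite big_nil; exact: smf_cst.
under eq_fun do rewrite big_cons.
by case: (P i) => //; apply: smf_mul.
Qed.

Lemma smooth_to_euclid n (a : M -> 'rV[R]_n) :
  (forall i, smfun M (fun y => a y 0 i)) -> smooth_map (a : M -> euclid R n).
Proof. by move=> Ha g Hg; exact: smf_comp. Qed.

Lemma smfun_closure_comp (T : topologicalType) (F : set (T -> R)) (f : M -> T) :
  continuous f -> (forall g, F g -> smfun M (g \o f)) ->
  forall g, sm_closure F g -> smfun M (g \o f).
Proof.
move=> cf HF g Hg; apply: smf_local => x.
have [k [a [h [Ha Hh gE]]]] := Hg (f x).
exists (fun y => h (\row_i a i (f y))).
  by apply: smf_comp => // i; under eq_fun do rewrite mxE; exact: HF.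
exact: (near_comp (P := fun z => g z = h (\row_i a i z)) cf gE).
Qed.

Lemma smooth_to_sprod (X Y : smooth_space R) (f : M -> X * Y) : continuous f ->
  smooth_map (fun m => (f m).1) -> smooth_map (fun m => (f m).2) ->
  smooth_map (f : M -> sprod X Y).
Proof.
move=> cf s1 s2; apply: smfun_closure_comp => // g [[h Hh ->]|[h Hh ->]].
  exact: s1.
exact: s2.
Qed.

Lemma smooth_to_ssub (X : smooth_space R) (A : set X) (f : M -> set_type A) :
  continuous f -> smooth_map (fun m => (set_val (f m) : X)) ->
  smooth_map (f : M -> ssub A).
Proof.
move=> cf s1; apply: smfun_closure_comp => // g [h Hh ->].
exact: s1.
Qed.

End Closed.

Lemma smooth_comp (X Y Z : smooth_space R) (f : Y -> Z) (g : X -> Y) :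
  smooth_map f -> smooth_map g -> smooth_map (f \o g).
Proof. by move=> Hf Hg h Hh; exact: (Hg (h \o f) (Hf h Hh)). Qed.

Lemma smooth_id (X : smooth_space R) : smooth_map (@id X).
Proof. by []. Qed.

Lemma smooth_cst (X Y : smooth_space R) (y : Y) : smclosed X -> smooth_map (fun _ : X => y).
Proof. by move=> cX g Hg; exact: (smf_cst cX (g y)). Qed.

Lemma smooth_fst (X Y : smooth_space R) : smooth_map (fun p : sprod X Y => p.1).
Proof. by move=> g Hg; apply: sm_closure_sub; left; exists g. Qed.

Lemma smooth_snd (X Y : smooth_space R) : smooth_map (fun p : sprod X Y => p.2).
Proof. by move=> g Hg; apply: sm_closure_sub; right; exists g. Qed.

Lemma smooth_val (X : smooth_space R) (A : set X) : smooth_map (fun p : ssub A => (set_val p : X)).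
Proof. by move=> g Hg; apply: sm_closure_sub; exists g. Qed.

Lemma continuous_val (X : topologicalType) (A : set X) : continuous (fun p : set_type A => set_val p).
Proof. exact: initial_continuous. Qed.

Lemma continuous_to_sub (T X : topologicalType) (A : set X) (f : T -> set_type A) :
  continuous (fun t => set_val (f t)) -> continuous f.
Proof. exact: continuous_comp_initial. Qed.

Lemma continuous_comp_fun (T U V : topologicalType) (f : U -> V) (g : T -> U) :
  continuous f -> continuous g -> continuous (fun t => f (g t)).
Proof. by move=> cf cg t; apply: continuous_comp; [exact: cg|exact: cf]. Qed.

Lemma continuous_fst (T U : topologicalType) : continuous (fun p : T * U => p.1).
Proof. by move=> p; exact: cvg_fst. Qed.

Lemma continuous_snd (T U : topologicalType) : continuous (fun p : T * U => p.2).
Proof. by move=> p; exact: cvg_snd. Qed.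

Lemma continuous_to_prod (T U V : topologicalType) (f : T -> U * V) :
  continuous (fun t => (f t).1) -> continuous (fun t => (f t).2) -> continuous f.
Proof.
move=> c1 c2 t.
have -> : f = (fun t => ((f t).1, (f t).2)) by apply/funext => s; case: (f s).
by apply: cvg_pair; [exact: c1|exact: c2].
Qed.

(** Nothing in [smooth_space] ties the functions to the topology. For manifolds this property comes
    from the charts, and it passes to products and subsets. *)
Definition smcontinuous (M : smooth_space R) := forall f, smfun M f -> continuous f.

Lemma continuous_closure (T : topologicalType) (F : set (T -> R)) :
  (forall f, F f -> continuous f) -> forall f, sm_closure F f -> continuous f.
Proof.
move=> HF f Hf; apply: continuous_local => x; have [k [a [g [Ha Hg fE]]]] := Hf x.
exists (fun y => g (\row_i a i y)) => //.
apply: continuous_comp_fun; first exact: Cinfty_continuous.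
by apply: continuous_rV => i; under eq_fun do rewrite mxE; apply: HF.
Qed.

Lemma sprod_smcontinuous (X Y : smooth_space R) : smcontinuous X -> smcontinuous Y ->
  smcontinuous (sprod X Y).
Proof.
move=> cX cY; apply: continuous_closure => f [[g Hg ->]|[g Hg ->]].
  by apply: continuous_comp_fun; [exact: cX|exact: continuous_fst].
by apply: continuous_comp_fun; [exact: cY|exact: continuous_snd].
Qed.

Lemma ssub_smcontinuous (X : smooth_space R) (A : set X) : smcontinuous X ->
  smcontinuous (ssub A).
Proof.
move=> cX; apply: continuous_closure => f [g Hg ->].
by apply: continuous_comp_fun; [exact: cX|exact: continuous_val].
Qed.

Lemma euclid_smcontinuous n : smcontinuous (euclid R n).
Proof. by move=> f; exact: Cinfty_continuous. Qed.

End SmoothSpaces.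

(** * Charts and bump functions *)

Section Charts.
Context {R : realType}.

Lemma near_openP (T : topologicalType) (x : T) (P : T -> Prop) :
  (\forall y \near x, P y) -> exists A, [/\ open A, A x & forall y, A y -> P y].
Proof. by rewrite /prop_near1 nbhsE => -[A [oA Ax] AP]; exists A. Qed.

Lemma near_val (T : topologicalType) (A : set T) (u : set_type A) (P : T -> Prop) :
  open A -> (\forall w \near u, P (set_val w)) -> \forall y \near (set_val u), P y.
Proof.
move=> oA /near_openP [_ [[Q oO <-] Ou HB]].
have OA : nbhs (set_val u) (Q `&` A).
  by apply: open_nbhs_nbhs; split; [exact: openI|split => //; exact: set_valP].
apply: filterS OA => y [Oy Ay].
exact: (HB (exist _ y (mem_set Ay)) Oy).
Qed.

(* A chart and its inverse, extended from germs to globally defined smooth maps. *)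
Definition chart_at n (M : smooth_space R) (x : M) (chi : M -> 'rV[R]_n) (kap : 'rV[R]_n -> M) :=
  [/\ forall i, smfun M (fun y => chi y 0 i),
      smooth_map (kap : euclid R n -> M), continuous kap, chi x = 0 &
      (\forall y \near x, kap (chi y) = y) /\
      (\forall z \near (0 : 'rV[R]_n), chi (kap z) = z)].

Lemma diffeo_smcontinuous n (M : smooth_space R) : manifold n M -> smcontinuous M.
Proof.
move=> [_ _ _ charts] h Hh x.
have [U [V [oU Ux oV [f [g [[fg _] cf _ _ sg]]]]]] := charts x.
have hg : smfun (ssub V) ((fun u : ssub U => h (set_val u)) \o g).
  by apply: sg; apply: sm_closure_sub; exists h.
have chg : continuous ((fun u : ssub U => h (set_val u)) \o g).
  apply: (@ssub_smcontinuous R _ V _ _ hg); exact: euclid_smcontinuous.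
have ch : continuous (fun u : set_type U => h (set_val u)).
  by have := continuous_comp_fun chg cf; under eq_fun do rewrite /= fg.
pose xU : set_type U := exist _ x (mem_set Ux).
apply/cvgrPdist_lt => e e0.
have : \forall w \near xU, `|h (set_val xU) - h (set_val w)| < e.
  by have /cvgrPdist_lt := ch xU; exact.
exact: (@near_val _ U xU (fun y => `|h x - h y| < e) oU).
Qed.

Lemma manifold_chart n (M : smooth_space R) (x : M) : manifold n M ->
  exists (chi : M -> 'rV[R]_n) (kap : 'rV[R]_n -> M), chart_at x chi kap.
Proof.
move=> mM; have cM := manifold_smclosed mM; have scM := diffeo_smcontinuous mM.
have [_ _ _ /(_ x) [U [V [oU Ux oV [f [g [[fg gf] cf cg sf sg]]]]]]] := mM.
pose xU : set_type U := exist _ x (mem_set Ux).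
pose v0 : 'rV[R]_n := set_val (f xU).
(* By the definition of [ssub], a smooth function on U is, near xU, a smooth function of
   restrictions of global functions. So each chart component has a global representative of its
   germ, with no cutoff on M. *)
have H i : exists2 c : M -> R, smfun M c &
    \forall u \near xU, (set_val (f u) : 'rV[R]_n) 0 i - v0 0 i = c (set_val u).
  have Hc : smfun (euclid R n) (fun z : 'rV[R]_n => z 0 i - v0 0 i).
    by apply: Cinfty_sub; [exact: Cinfty_coord|exact: Cinfty_cst].
  have := sf _ (sm_closure_sub (ex_intro2 _ _ _ Hc erefl)).
  move=> /(_ xU) [k [a [h [Ha Hh E]]]].
  have /choice [b Hb] : forall j, exists b, smfun M b /\ a j = b \o set_val.
    by move=> j; have [b b1 b2] := Ha j; exists b.
  exists (fun y => h (\row_j b j y)).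
    by apply: (smf_comp cM Hh) => j; under eq_fun do rewrite mxE; case: (Hb j).
  apply: filterS E => u /= ->; congr h; apply/rowP => j; rewrite !mxE.
  by case: (Hb j) => _ ->.
have /choice [c Hc] : forall i, exists c : M -> R, smfun M c /\
    \forall u \near xU, (set_val (f u) : 'rV[R]_n) 0 i - v0 0 i = c (set_val u).
  by move=> i; have [c c1 c2] := H i; exists c.
pose chi (y : M) : 'rV[R]_n := \row_i c i y.
have schi i : smfun M (fun y => chi y 0 i).
  by under eq_fun do rewrite mxE; case: (Hc i).
have chiE : \forall u \near xU, set_val (f u) - v0 = chi (set_val u).
  have : \forall u \near xU, forall i, (set_val (f u) : 'rV[R]_n) 0 i - v0 0 i = c i (set_val u).
    by apply: near_forall => i; case: (Hc i).
  by apply: filterS => u Hu; apply/rowP => i; rewrite !mxE Hu.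
have cchi : continuous chi.
  by apply: continuous_rV => i; apply: scM; exact: schi.
have chix : chi x = 0 by rewrite -(nbhs_singleton chiE) subrr.
have Vv0 : V v0 by exact: set_valP.
have : nbhs v0 V by apply: open_nbhs_nbhs.
move=> /nbhs_normP [r /= r0 Hr].
have r2 : 0 < r / 2 by rewrite divr_gt0.
have [C C0 cut] := @cutoff R n.
(* The translate by v0 of the image of rho lies in V, so g can be composed with it on all of R^n. *)
have [rho [srho brho idrho _]] := cut _ r2.
have inV z : V (v0 + rho z).
  apply: Hr => /=; rewrite opprD addrA subrr add0r normrN (le_lt_trans (brho z)) //.
  by rewrite ltr_pdivrMr // ltr_pMr // ltr1n.
pose mk z : set_type V := exist _ (v0 + rho z) (mem_set (inV z)).
have srho' : smap (fun z => v0 + rho z) by apply: smap_add => //; exact: smap_cst.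
have cmk : continuous mk.
  by apply: continuous_to_sub; exact: (smap_continuous srho').
have smk : smooth_map (mk : euclid R n -> ssub V).
  apply: smooth_to_ssub => //; first exact: euclid_smclosed.
  by apply: smooth_to_euclid; first exact: euclid_smclosed.
pose kap z : M := set_val (g (mk z)).
have ckap : continuous kap.
  apply: continuous_comp_fun; first exact: continuous_val.
  exact: continuous_comp_fun cg cmk.
have skap : smooth_map (kap : euclid R n -> M).
  by move=> h Hh; exact: (smk _ (sg _ (smooth_val (A := U) Hh))).
have small : \forall z \near (0 : 'rV[R]_n), rho z = z.
  have : \forall z \near (0 : 'rV[R]_n), `|z| < r / 2 / 2 by apply: nbhs0_lt; rewrite !divr_gt0.
  by apply: filterS => z /ltW; exact: idrho.
have rho0 : rho 0 = 0 by exact: nbhs_singleton small.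
exists chi, kap; split => //; split.
- have N1 : \forall y \near x, rho (chi y) = chi y.
    by apply: (near_comp (g := chi) (P := fun z => rho z = z) cchi); rewrite chix.
  apply: (@near_val _ U xU (fun y => kap (chi y) = y) oU).
  have N2 : \forall u \near xU, rho (chi (set_val u)) = chi (set_val u).
    by apply: (near_comp (g := fun u : set_type U => set_val u)
       (P := fun y => rho (chi y) = chi y) (@continuous_val _ U)).
  apply: filterS2 chiE N2 => u Eu ru.
  rewrite /kap; have -> : mk (chi (set_val u)) = f u.
    by apply: val_inj; rewrite /= ru -Eu addrC subrK.
  by rewrite fg.
- have mk0 : mk 0 = f xU by apply: val_inj; rewrite /= rho0 addr0.
  have N1 : \forall z \near (0 : 'rV[R]_n), set_val (f (g (mk z))) - v0 = chi (set_val (g (mk z))).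
    apply: (near_comp (g := fun z => g (mk z))
       (P := fun u => set_val (f u) - v0 = chi (set_val u))).
      exact: continuous_comp_fun cg cmk.
    by rewrite mk0 fg.
  apply: filterS2 N1 small => z; rewrite gf => E rz.
  have mkE : set_val (mk z) = v0 + rho z by [].
  by rewrite /kap -E mkE rz addrC addKr.
Qed.

(** Converse of [manifold_chart]: on the open sets where both germ identities hold, chi and kap
    become mutually inverse. This is how fiber products become manifolds. *)
Lemma chart_manifold n (M : smooth_space R) : hausdorff_space M -> @second_countable M ->
  smclosed M -> smcontinuous M ->
  (forall x : M, exists (chi : M -> 'rV[R]_n) (kap : 'rV[R]_n -> M), chart_at x chi kap) ->
  manifold n M.
Proof.
move=> hM sM cM scM charts; split => // x.
have [chi [kap [schi skap ckap chix [kc ck]]]] := charts x.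
have cchi : continuous chi by apply: continuous_rV => i; exact: scM.
have kap0 : kap 0 = x by rewrite -chix; exact: nbhs_singleton kc.
have [A [oA Ax HA]] := near_openP kc.
have [B [oB B0 HB]] := near_openP ck.
pose U := A `&` chi @^-1` B; pose V : set (euclid R n) := B `&` kap @^-1` A.
have oU : open U by apply: openI => //; exact: open_comp.
have oV : open V by apply: openI => //; exact: open_comp.
have fP (u : set_type U) : V (chi (set_val u)).
  have [Au Bu] := set_valP u; split => //=.
  by rewrite (HA _ Au).
have gP (v : set_type V) : U (kap (set_val v)).
  have [Bv Av] := set_valP v; split => //=.
  by rewrite (HB _ Bv).
pose f (u : ssub U) : ssub V := exist _ (chi (set_val u)) (mem_set (fP u)).
pose g (v : ssub V) : ssub U := exist _ (kap (set_val v)) (mem_set (gP v)).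
exists U, V; split => //; first by split => //; rewrite /= chix.
have cf : continuous f.
  by apply: continuous_to_sub; exact: (continuous_comp_fun cchi (@continuous_val _ U)).
have cg : continuous g.
  by apply: continuous_to_sub; exact: (continuous_comp_fun ckap (@continuous_val _ V)).
exists f, g; split => //.
- split=> [u|v]; apply: val_inj => /=.
    by rewrite HA //; have [] := set_valP u.
  by rewrite HB //; have [] := set_valP v.
- apply: smooth_to_ssub => //; first exact: ssub_smclosed.
  by move=> h Hh; exact: (smooth_val (A := U) (smooth_to_euclid cM schi Hh)).
- apply: smooth_to_ssub => //; first exact: ssub_smclosed.
  by move=> h Hh; exact: (smooth_val (A := V) (skap _ Hh)).
Qed.

Definition bumpr n (r : R) (z : 'rV[R]_n) : R := \prod_i bump1 (2 / r * z 0 i).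

Lemma bumpr_Cinfty n r : Cinfty (@bumpr n r).
Proof.
move=> k; apply: Cr_prod => i.
apply: (@smooth1_bump1 R n k (fun z => 2 / r * z 0 i)).
by apply: Cr_mul; [exact: Cr_cst|exact: Cr_coord].
Qed.

Lemma bumpr1 n r : 0 < r -> \forall z \near (0 : 'rV[R]_n), bumpr r z = 1.
Proof.
move=> r0; have : \forall z \near (0 : 'rV[R]_n), `|z| < r / 2 by apply: nbhs0_lt; rewrite divr_gt0.
apply: filterS => z zr; apply: big1 => i _; apply: bump1_eq1.
rewrite normrM gtr0_norm ?divr_gt0 // mulrC -ler_pdivlMr ?divr_gt0 //.
by rewrite mul1r invfM invrK mulrC ltW // (le_lt_trans (rV_coord_le _ _)).
Qed.

Lemma bumpr0 n r (z : 'rV[R]_n) : 0 < r -> r < `|z| -> bumpr r z = 0.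
Proof.
move=> r0 rz; have [i ri] : exists i, r < `|z 0 i|.
  apply/not_existsP => H; have : `|z| <= r.
    by apply: rV_norm_le => [|i]; [exact: ltW|rewrite leNgt; apply/negP; exact: H].
  by rewrite leNgt rz.
rewrite /bumpr (bigD1 i) //= bump1_eq0 ?mul0r //.
rewrite normrM gtr0_norm ?divr_gt0 // -mulrA ler_pMr // mulrC ler_pdivlMr //.
by rewrite mul1r ltW.
Qed.

Lemma closed_ball_compact n (r : R) : compact [set z : 'rV[R]_n | `|z| <= r].
Proof.
apply: bounded_closed_compact.
  by exists r; split; [exact: num_real|move=> x xr y /le_trans; apply; exact: ltW].
rewrite (_ : [set _ | _] = (fun x => `|x|) @^-1` [set y : R | y <= r]) //.
by apply: preimage_closed (@closed_le _ r) => x _; exact: norm_continuous.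
Qed.

(** The dichotomy replaces a statement on supports and is the form in which gluing uses it. A bump
    in a chart is extended by zero; this is smooth because the image K of a closed ball is compact,
    hence closed in the Hausdorff space M. *)
Lemma manifold_bump n (M : smooth_space R) (x : M) (W : set M) : manifold n M -> nbhs x W ->
  exists b : M -> R, [/\ smfun M b, \forall y \near x, b y = 1 &
    forall y : M, (\forall z \near y, W z) \/ (\forall z \near y, b z = 0)].
Proof.
move=> mM nW; have cM := manifold_smclosed mM; have scM := diffeo_smcontinuous mM.
have [chi [kap [schi skap ckap chix [kc ck]]]] := manifold_chart x mM.
have cchi : continuous chi by apply: continuous_rV => i; exact: scM.
have kap0 : kap 0 = x by rewrite -chix; exact: nbhs_singleton kc.
have [hM _ _ _] := mM.
have NW : \forall y \near x, kap (chi y) = y /\ W y by exact: filterI.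
have [A [oA Ax HA]] := near_openP NW.
have [B [oB B0 HB]] := near_openP ck.
have : nbhs (0 : 'rV[R]_n) (B `&` kap @^-1` A).
  apply: open_nbhs_nbhs; split; first by apply: openI => //; exact: open_comp.
  by split => //=; rewrite kap0.
move=> /nbhs_normP [r0 /= r00 Hr0].
pose r := r0 / 2.
have rp : 0 < r by rewrite divr_gt0.
have Hr (z : 'rV[R]_n) : `|z| <= r -> B z /\ A (kap z).
  move=> zr; apply: Hr0; rewrite /= sub0r normrN (le_lt_trans zr) //.
  by rewrite /r ltr_pdivrMr // ltr_pMr // ltr1n.
pose K := kap @` [set z : 'rV[R]_n | `|z| <= r].
have clK : closed K.
  apply: compact_closed => //; apply: continuous_compact; last exact: closed_ball_compact.
  exact: continuous_subspaceT.
pose O := A `&` chi @^-1` B.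
have oO : open O by apply: openI => //; exact: open_comp.
have KO : K `<=` O.
  move=> _ [z /= zr <-]; have [Bz Az] := Hr z zr; split => //=.
  by rewrite (HB _ Bz).
pose b (y : M) : R := if pselect (O y) then bumpr r (chi y) else 0.
have bK y : ~ K y -> b y = 0.
  rewrite /b; case: pselect => // -[Ay By] nK; apply: bumpr0 => //.
  rewrite ltNge; apply/negP => yr; apply: nK; exists (chi y) => //.
  by have [] := HA _ Ay.
have bO y : O y -> \forall z \near y, b z = bumpr r (chi z).
  move=> Oy; have : nbhs y O by apply: open_nbhs_nbhs.
  by apply: filterS => z Oz; rewrite /b; case: pselect.
have nK y : ~ K y -> \forall z \near y, b z = 0.
  move=> Ky; have : nbhs y (~` K) by apply: open_nbhs_nbhs; split => //; exact: closed_openC.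
  by apply: filterS => z; exact: bK.
exists b; split.
- apply: smf_local => // y; have [Oy|Oy] := pselect (O y).
    exists (fun z => bumpr r (chi z)); last exact: bO.
    by apply: smf_comp => //; exact: bumpr_Cinfty.
  exists (fun _ => 0); first exact: smf_cst.
  by apply: nK => /KO.
- have Ox : O x by split => //=; rewrite chix.
  have N : \forall y \near x, bumpr r (chi y) = 1.
    by apply: (near_comp (g := chi) (P := fun z => bumpr r z = 1) cchi); rewrite chix; exact: bumpr1.
  by apply: filterS2 (bO x Ox) N => y ->.
- move=> y; have [Ky|Ky] := pselect (K y); [left|right; exact: nK].
  have [Ay _] := KO _ Ky.
  have : nbhs y A by apply: open_nbhs_nbhs.
  by apply: filterS => z /HA [].
Qed.

(** [smooth_map] does not include continuity. For a bump b at f x, the preimage of W contains the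
    open set where b o f is positive. *)
Lemma smooth_continuous n (X M : smooth_space R) (f : X -> M) : smcontinuous X ->
  manifold n M -> smooth_map f -> continuous f.
Proof.
move=> cX mM sf x W nW.
have [b [sb b1 bW]] := manifold_bump mM nW.
have cb : continuous (b \o f) by apply: cX; exact: sf.
have bx : 0 < (b \o f) x by rewrite /= (nbhs_singleton b1).
have := near_gt cb bx; apply: filterS => y by0.
have [Wy|b0] := bW (f y); first exact: (nbhs_singleton Wy).
by move: by0; rewrite /= (nbhs_singleton b0) ltxx.
Qed.

End Charts.

(** * Tangent vectors *)

Section Tangent.
Context {R : realType}.

Lemma tvecE (M : smooth_space R) (c : R) (u v : tvec M) f : (c *: u + v) f = c * u f + v f.
Proof. by []. Qed.

Lemma tvec_sumE (M : smooth_space R) I (r : seq I) (P : pred I) (v : I -> tvec M) f :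
  (\sum_(i <- r | P i) v i) f = \sum_(i <- r | P i) v i f.
Proof.
elim: r => [|i r IH]; first by rewrite !big_nil.
by rewrite !big_cons; case: (P i); rewrite -IH.
Qed.

Lemma tangent0 (M : smooth_space R) (x : M) : tangent x (0 : tvec M).
Proof. by split=> *; rewrite -[(0 : tvec M) _]/(0:R) ?mulr0 ?addr0. Qed.

Lemma tangent_lin (M : smooth_space R) (x : M) (c : R) u v :
  tangent x u -> tangent x v -> tangent x (c *: u + v).
Proof.
move=> [u1 u2 u3] [v1 v2 v3]; split=> [f nf|d f g Hf Hg|f g Hf Hg]; rewrite !tvecE.
- by rewrite u1 // v1 // mulr0 addr0.
- by rewrite u2 // v2 //; ring.
- by rewrite u3 // v3 //; ring.
Qed.

Lemma tangent_scale (M : smooth_space R) (x : M) (c : R) u : tangent x u -> tangent x (c *: u).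
Proof. by move=> Hu; rewrite -[c *: u]addr0; apply: tangent_lin => //; exact: tangent0. Qed.

Lemma tangent_add (M : smooth_space R) (x : M) u v :
  tangent x u -> tangent x v -> tangent x (u + v).
Proof. by move=> Hu Hv; rewrite -[u]scale1r; exact: tangent_lin. Qed.

Lemma tangent_sub (M : smooth_space R) (x : M) u v :
  tangent x u -> tangent x v -> tangent x (u - v).
Proof. by move=> Hu Hv; rewrite addrC -scaleN1r; exact: tangent_lin. Qed.

Lemma tangent_sum (M : smooth_space R) (x : M) I (r : seq I) (P : pred I) (v : I -> tvec M) :
  (forall i, tangent x (v i)) -> tangent x (\sum_(i <- r | P i) v i).
Proof.
move=> Hv; elim: r => [|i r IH]; first by rewrite big_nil; exact: tangent0.
by rewrite big_cons; case: (P i) => //; exact: tangent_add.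
Qed.

Lemma tangent_ext (M : smooth_space R) (x : M) u v : tangent x u -> tangent x v ->
  (forall f, smfun M f -> u f = v f) -> u = v.
Proof.
move=> [u1 _ _] [v1 _ _] H; apply/funext => f.
by have [Hf|Hf] := pselect (smfun M f); [exact: H|rewrite u1 // v1].
Qed.

Lemma tangent_cst (M : smooth_space R) (x : M) v c : smclosed M -> tangent x v ->
  v (fun _ => c) = 0.
Proof.
move=> cM [_ v2 v3].
have v1 : v (fun _ => 1) = 0.
  have := v3 (fun _ => 1) (fun _ => 1) (smf_cst cM 1) (smf_cst cM 1).
  by rewrite !mul1r => /eqP; rewrite -subr_eq subrr eq_sym => /eqP.
have := v2 c (fun _ => 1) (fun _ => 0) (smf_cst cM 1) (smf_cst cM 0).
have := v2 0 (fun _ => 0) (fun _ => 0) (smf_cst cM 0) (smf_cst cM 0).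
have -> : (fun _ : M => 0 * 0 + 0) = (fun _ => 0 : R) by apply/funext => y; rewrite mul0r addr0.
have -> : (fun _ : M => c * 1 + 0) = (fun _ => c : R) by apply/funext => y; rewrite mulr1 addr0.
have := v3 (fun _ => 0) (fun _ => 0) (smf_cst cM 0) (smf_cst cM 0).
rewrite (_ : (fun _ : M => 0 * 0) = (fun _ => 0 : R)); last by apply/funext => y; rewrite mul0r.
by rewrite !mul0r addr0 => -> _ ->; rewrite v1 mulr0 addr0.
Qed.

Lemma tangent_sumf (M : smooth_space R) (x : M) v I (r : seq I) (F : I -> M -> R) :
  smclosed M -> tangent x v -> (forall i, smfun M (F i)) ->
  v (fun y => \sum_(i <- r) F i y) = \sum_(i <- r) v (F i).
Proof.
move=> cM tv HF; elim: r => [|i r IH].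
  by rewrite big_nil; under eq_fun do rewrite big_nil; exact: tangent_cst tv.
rewrite big_cons -IH; have [_ v2 _] := tv.
have := v2 1 (F i) (fun y => \sum_(j <- r) F j y) (HF i) (smf_sum cM _ _ HF).
rewrite mul1r => <-; congr (v _).
by apply/funext => y; rewrite big_cons mul1r.
Qed.

(** In the Hadamard expansion of g at a x, the Leibniz rule kills every term except the first-order
    ones, since the factors a_i - a_i x vanish at x. *)
Lemma tangent_chain (M : smooth_space R) (x : M) v n (g : 'rV[R]_n -> R) (a : M -> 'rV[R]_n) :
  smclosed M -> tangent x v -> Cinfty g -> (forall i, smfun M (fun y => a y 0 i)) ->
  v (fun y => g (a y)) = \sum_i v (fun y => a y 0 i) * 'D_(delta_mx 0 i) g (a x).
Proof.
move=> cM tv Hg Ha; have [h [Hh h0 gE]] := hadamard (a x) Hg.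
have [_ v2 v3] := tv.
have sh i : smfun M (fun y => h i (a y)) by exact: smf_comp.
have sa i : smfun M (fun y => a y 0 i - a x 0 i) by apply: smf_sub => //; exact: smf_cst.
have E : (fun y => g (a y)) =
    (fun y => 1 * (\sum_i (a y 0 i - a x 0 i) * h i (a y)) + g (a x)).
  by apply/funext => y; rewrite gE mul1r addrC.
rewrite E v2; last 2 first.
- by apply: smf_sum => // i; exact: smf_mul.
- exact: smf_cst.
rewrite (tangent_cst _ cM tv) addr0 mul1r (tangent_sumf _ cM tv); last by move=> i; exact: smf_mul.
apply: eq_bigr => i _; rewrite v3 // subrr mul0r add0r h0 mulrC; congr (_ * _).
have := v2 1 (fun y => a y 0 i) (fun _ => - a x 0 i) (Ha i) (smf_cst cM _).
rewrite (tangent_cst _ cM tv) addr0 mul1r => <-; congr (v _).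
by apply/funext => y; rewrite mul1r.
Qed.

(** A bump b supported where f = g makes b (f - g) vanish identically; the Leibniz rule at x, where
    b = 1 and f = g, leaves v f - v g. *)
Lemma tangent_local n (M : smooth_space R) (x : M) v f g : manifold n M -> tangent x v ->
  smfun M f -> smfun M g -> (\forall y \near x, f y = g y) -> v f = v g.
Proof.
move=> mM tv Hf Hg fg; have cM := manifold_smclosed mM.
have [b [sb b1 bW]] := manifold_bump mM fg.
have [_ v2 v3] := tv.
have sd : smfun M (fun y => -1 * g y + f y) by apply: smf_add => //; exact: smf_scale.
have : v (fun y => b y * (-1 * g y + f y)) = 0.
  rewrite -(tangent_cst 0 cM tv); congr (v _); apply/funext => y.
  have [E|b0] := bW y; first by rewrite (nbhs_singleton E) mulN1r addrC subrr mulr0.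
  by rewrite (nbhs_singleton b0) mul0r.
rewrite v3 // v2 // (nbhs_singleton fg) (nbhs_singleton b1) mul1r mulN1r.
rewrite mulN1r addrC [- g x + _]addrC subrr mul0r add0r addrC => /eqP.
by rewrite subr_eq0 => /eqP.
Qed.

Lemma tmapE (M N : smooth_space R) (f : M -> N) (v : tvec M) g : smfun N g ->
  tmap f v g = v (g \o f).
Proof. by move=> Hg; rewrite /tmap asboolT. Qed.

Lemma tmapE0 (M N : smooth_space R) (f : M -> N) (v : tvec M) g : ~ smfun N g ->
  tmap f v g = 0.
Proof. by move=> Hg; rewrite /tmap asboolF. Qed.

Lemma tangent_tmap (M N : smooth_space R) (f : M -> N) (x : M) v : smclosed N ->
  smooth_map f -> tangent x v -> tangent (f x) (tmap f v).
Proof.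
move=> cN sf [v1 v2 v3]; split=> [g|c g h Hg Hh|g h Hg Hh]; first exact: tmapE0.
- rewrite !tmapE //; last by apply: smf_add => //; exact: smf_scale.
  exact: (v2 c (g \o f) (h \o f) (sf _ Hg) (sf _ Hh)).
- rewrite !tmapE //; last exact: smf_mul.
  exact: (v3 (g \o f) (h \o f) (sf _ Hg) (sf _ Hh)).
Qed.

Lemma tmap_lin (M N : smooth_space R) (f : M -> N) (c : R) u v :
  tmap f (c *: u + v) = c *: tmap f u + tmap f v.
Proof.
apply/funext => g; rewrite tvecE; have [Hg|Hg] := pselect (smfun N g).
  by rewrite !tmapE.
by rewrite !tmapE0 // mulr0 addr0.
Qed.

Lemma tmap0 (M N : smooth_space R) (f : M -> N) : tmap f 0 = 0.
Proof.
apply/funext => g; have [Hg|Hg] := pselect (smfun N g); first by rewrite tmapE.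
by rewrite tmapE0.
Qed.

Lemma tmapZ (M N : smooth_space R) (f : M -> N) (c : R) u : tmap f (c *: u) = c *: tmap f u.
Proof. by rewrite -[c *: u]addr0 tmap_lin tmap0 addr0. Qed.

Lemma tmapD (M N : smooth_space R) (f : M -> N) u v : tmap f (u + v) = tmap f u + tmap f v.
Proof. by rewrite -{1}[u]scale1r tmap_lin scale1r. Qed.

Lemma tmapB (M N : smooth_space R) (f : M -> N) u v : tmap f (u - v) = tmap f u - tmap f v.
Proof. by rewrite addrC -scaleN1r tmap_lin scaleN1r addrC. Qed.

Lemma tmap_sum (M N : smooth_space R) (f : M -> N) I (r : seq I) (v : I -> tvec M) :
  tmap f (\sum_(i <- r) v i) = \sum_(i <- r) tmap f (v i).
Proof.
by elim: r => [|i r IH]; rewrite ?big_nil ?tmap0 // !big_cons tmapD IH.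
Qed.

Lemma tmap_comp (M N P : smooth_space R) (g : N -> P) (f : M -> N) v : smooth_map g ->
  tmap (g \o f) v = tmap g (tmap f v).
Proof.
move=> sg; apply/funext => h; have [Hh|Hh] := pselect (smfun P h).
  by rewrite !tmapE //; exact: sg.
by rewrite !tmapE0.
Qed.

Lemma tmap_tmap (M N P : smooth_space R) (g : N -> P) (f : M -> N) v : smooth_map g ->
  tmap g (tmap f v) = tmap (fun x => g (f x)) v.
Proof. by move=> sg; rewrite -tmap_comp. Qed.

Lemma tmap_id (M : smooth_space R) (x : M) v : tangent x v -> tmap (@id M) v = v.
Proof.
move=> [v1 _ _]; apply/funext => f; have [Hf|Hf] := pselect (smfun M f).
  by rewrite tmapE.
by rewrite tmapE0 // v1.
Qed.

Lemma tmap_cst (M N : smooth_space R) (y : N) (x : M) v : smclosed M -> tangent x v ->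
  tmap (fun _ : M => y) v = 0.
Proof.
move=> cM tv; apply/funext => f; have [Hf|Hf] := pselect (smfun N f).
  by rewrite tmapE //; exact: (tangent_cst (f y) cM tv).
by rewrite tmapE0.
Qed.

Definition dvec n (z c : 'rV[R]_n) : tvec (euclid R n) :=
  fun f => if `[< Cinfty f >] then 'D_c f z else 0.

Lemma dvecE n (z c : 'rV[R]_n) f : Cinfty f -> dvec z c f = 'D_c f z.
Proof. by move=> Hf; rewrite /dvec asboolT. Qed.

Lemma tangent_dvec n (z c : 'rV[R]_n) : tangent (z : euclid R n) (dvec z c).
Proof.
split=> [f nf|d f g Hf Hg|f g Hf Hg]; first by rewrite /dvec asboolF.
- have Hdf : Cinfty (fun y => d * f y) by apply: Cinfty_mul => //; exact: Cinfty_cst.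
  rewrite !dvecE //; last exact: Cinfty_add.
  rewrite (deriveD (Cinfty_derivable Hdf) (Cinfty_derivable Hg)); congr (_ + _).
  exact: (deriveZ d (Cinfty_derivable Hf)).
- rewrite !dvecE //; last exact: Cinfty_mul.
  exact: (deriveM (Cinfty_derivable Hf) (Cinfty_derivable Hg)).
Qed.

(* The coordinates of [v] are its values on the components of [chi]. *)
Definition tco (M : smooth_space R) n (chi : M -> 'rV[R]_n) (v : tvec M) : 'rV[R]_n :=
  \row_i v (fun y => chi y 0 i).

Lemma tco_lin (M : smooth_space R) n (chi : M -> 'rV[R]_n) c u v :
  tco chi (c *: u + v) = c *: tco chi u + tco chi v.
Proof. by apply/rowP => i; rewrite !mxE. Qed.

Lemma tcoZ (M : smooth_space R) n (chi : M -> 'rV[R]_n) c u :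
  tco chi (c *: u) = c *: tco chi u.
Proof. by apply/rowP => i; rewrite !mxE. Qed.

Lemma tco_sum (M : smooth_space R) n (chi : M -> 'rV[R]_n) I (r : seq I) (v : I -> tvec M) :
  tco chi (\sum_(i <- r) v i) = \sum_(i <- r) tco chi (v i).
Proof.
elim: r => [|i r IH]; rewrite ?big_nil; first by apply/rowP => i; rewrite !mxE.
rewrite !big_cons -IH; apply/rowP => j; rewrite !mxE.
by [].
Qed.

(** Locality replaces f by f o kap o chi, to which [tangent_chain] applies: in a chart every
    derivation is a directional derivative. *)
Lemma chart_tangent n m (M : smooth_space R) (y : M) (chi : M -> 'rV[R]_n) kap v :
  manifold m M -> (forall i, smfun M (fun y => chi y 0 i)) ->
  smooth_map (kap : euclid R n -> M) -> (\forall y' \near y, kap (chi y') = y') ->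
  tangent y v -> v = tmap (kap : euclid R n -> M) (dvec (chi y) (tco chi v)).
Proof.
move=> mM schi skap kc tv; have cM := manifold_smclosed mM.
apply/funext => f; have [Hf|Hf] := pselect (smfun M f); last first.
  by rewrite tmapE0 //; case: tv => ->.
have Hfk : Cinfty (f \o kap) by exact: skap.
rewrite tmapE // dvecE // (derive_sum_coord _ (Cinfty_differentiable _ Hfk)).
have -> : v f = v (fun y => (f \o kap) (chi y)).
  apply: (tangent_local mM tv) => //; first exact: (smf_comp cM Hfk schi).
  by apply: filterS kc => z /= ->.
rewrite (tangent_chain cM tv Hfk schi); apply: eq_bigr => i _.
by rewrite mxE.
Qed.

Lemma chart_tco n (M : smooth_space R) (z c : 'rV[R]_n) (chi : M -> 'rV[R]_n) kap :
  (forall i, smfun M (fun y => chi y 0 i)) -> smooth_map (kap : euclid R n -> M) ->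
  (\forall z' \near z, chi (kap z') = z') ->
  tco chi (tmap (kap : euclid R n -> M) (dvec z c)) = c.
Proof.
move=> schi skap ck; apply/rowP => i; rewrite mxE tmapE // dvecE; last exact: skap.
have [_ <-] := is_derive_split (is_derive_coord z c i).
by apply: near_eq_derive; apply: filterS ck => w /= ->.
Qed.

(** Coordinate fields of a chart times a bump function. The germ identities of the chart are needed
    at all points near x, not only at x, whence the uses of [nbhs_interior]. *)
Lemma local_frame n (M : smooth_space R) (x : M) : manifold n M ->
  exists (chi : M -> 'rV[R]_n) (U : 'I_n -> vfield M),
  [/\ forall i, smfun M (fun y => chi y 0 i), forall i, is_field (U i) &
    \forall y \near x, (forall i, tco chi (U i y) = delta_mx 0 i) /\
      (forall v, tangent y v -> v = \sum_i tco chi v 0 i *: U i y)].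
Proof.
move=> mM; have cM := manifold_smclosed mM; have scM := diffeo_smcontinuous mM.
have [chi [kap [schi skap ckap chix [kc ck]]]] := manifold_chart x mM.
have cchi : continuous chi by apply: continuous_rV => i; exact: scM.
have kc2 : \forall y \near x, \forall y' \near y, kap (chi y') = y' by exact: nbhs_interior kc.
have [b [sb b1 bW]] := manifold_bump mM kc2.
pose U i (y : M) : tvec M := b y *: tmap (kap : euclid R n -> M) (dvec (chi y) (delta_mx 0 i)).
have Uf i : is_field (U i).
  split=> [y|f Hf].
    have [E|b0] := bW y; last by rewrite /U (nbhs_singleton b0) scale0r; exact: tangent0.
    have := nbhs_singleton E => /nbhs_singleton Ey.
    apply: tangent_scale; rewrite -{1}Ey.
    by apply: tangent_tmap => //; exact: tangent_dvec.
  have Hfk : Cinfty (f \o kap) by exact: skap.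
  have -> : (fun y => U i y f) = (fun y => b y * 'D_(delta_mx 0 i) (f \o kap) (chi y)).
    by apply/funext => y; rewrite /U -[LHS]/(b y * _) tmapE // dvecE.
  have HD : Cinfty ('D_(delta_mx 0 i) (f \o kap)) by exact: Cinfty_derive.
  by apply: smf_mul => //; exact: (smf_comp cM HD schi).
exists chi, U; split => //.
have ck2 : \forall y \near x, \forall z \near chi y, chi (kap z) = z.
  apply: (near_comp (g := chi) (P := fun z => \forall z' \near z, chi (kap z') = z') cchi).
  by rewrite chix; exact: nbhs_interior ck.
have main : \forall y \near x, forall i, tco chi (U i y) = delta_mx 0 i.
  apply: filterS2 b1 ck2 => y by1 Hy i; rewrite /U by1 scale1r.
  exact: (chart_tco _ schi skap).
apply: filterS2 main kc2 => y Hy Ky; split => // v tv.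
have tS : tangent y (\sum_i tco chi v 0 i *: U i y).
  by apply: tangent_sum => i; apply: tangent_scale; case: (Uf i).
rewrite [LHS](chart_tangent mM schi skap Ky tv) [RHS](chart_tangent mM schi skap Ky tS).
congr (tmap _ (dvec _ _)); rewrite tco_sum [LHS]row_sum_delta.
by apply: eq_bigr => i _; rewrite tcoZ Hy.
Qed.

End Tangent.

(** * Forms *)

Section Forms.
Context {R : realType}.

Lemma field_sum (M : smooth_space R) I (r : seq I) (c : I -> M -> R) (U : I -> vfield M) :
  smclosed M -> (forall i, smfun M (c i)) -> (forall i, is_field (U i)) ->
  is_field (fun y => \sum_(i <- r) c i y *: U i y).
Proof.
move=> cM sc fU; split=> [y|f Hf].
  by apply: tangent_sum => i; apply: tangent_scale; case: (fU i).
under eq_fun do rewrite tvec_sumE.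
by apply: smf_sum => // i; apply: smf_mul => //; case: (fU i) => _; exact.
Qed.

Lemma field_extend n (M : smooth_space R) (x : M) v : manifold n M -> tangent x v ->
  exists2 X : vfield M, is_field X & X x = v.
Proof.
move=> mM tv; have cM := manifold_smclosed mM.
have [chi [U [schi fU N]]] := local_frame x mM.
exists (fun y => \sum_i tco chi v 0 i *: U i y).
  by apply: field_sum => // i; exact: smf_cst.
by have [_ /(_ v tv) {2}->] := nbhs_singleton N.
Qed.

Lemma covector0 (M : smooth_space R) (x : M) (a : tcovec M) : covector x a -> a 0 = 0.
Proof.
move=> /(_ 1 0 0 (tangent0 x) (tangent0 x)); rewrite scale1r addr0 mul1r => /eqP.
by rewrite -subr_eq subrr eq_sym => /eqP.
Qed.

Lemma covector_sum (M : smooth_space R) (x : M) (a : tcovec M) I (r : seq I) (c : I -> R) v :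
  covector x a -> (forall i, tangent x (v i)) ->
  a (\sum_(i <- r) c i *: v i) = \sum_(i <- r) c i * a (v i).
Proof.
move=> ca tv; elim: r => [|i r IH]; first by rewrite !big_nil (covector0 ca).
rewrite !big_cons -IH -ca //.
by apply: tangent_sum => j; exact: tangent_scale.
Qed.

Lemma covectorD (M : smooth_space R) (x : M) (a : tcovec M) u v : covector x a ->
  tangent x u -> tangent x v -> a (u + v) = a u + a v.
Proof. by move=> ca tu tv; have := ca 1 u v tu tv; rewrite scale1r mul1r. Qed.

Lemma form2_anti (M : smooth_space R) (w : form2 M) x u v : is_form2 w ->
  tangent x u -> tangent x v -> w x u v = - w x v u.
Proof.
move=> [w1 w2 w3 _] tu tv.
have tuv : tangent x (u + v) by exact: tangent_add.
have := w3 x (u + v) tuv.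
rewrite (covectorD (w1 x _ tuv) tu tv).
rewrite (covectorD (w2 x u tu) tu tv) (covectorD (w2 x v tv) tu tv).
rewrite (w3 x u tu) (w3 x v tv) add0r addr0 => /eqP.
by rewrite addrC addr_eq0 => /eqP.
Qed.

Lemma form1_rep n (M : smooth_space R) (a : form1 M) (x : M) : manifold n M -> is_form1 a ->
  exists (chi : 'I_n -> M -> R) (c : 'I_n -> M -> R),
  [/\ forall i, smfun M (chi i), forall i, smfun M (c i) &
    \forall y \near x, forall u, tangent y u -> a y u = \sum_i c i y * u (chi i)].
Proof.
move=> mM [a1 a2]; have [chi [U [schi fU N]]] := local_frame x mM.
exists (fun i y => chi y 0 i), (fun i y => a y (U i y)); split => //.
- by move=> i; apply: a2; exact: fU.
- apply: filterS N => y [_ Hy] u tu; rewrite {1}(Hy u tu).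
  rewrite (covector_sum _ _ (a1 y)); last by move=> i; case: (fU i).
  by apply: eq_bigr => i _; rewrite mxE mulrC.
Qed.

Lemma form2_rep n (M : smooth_space R) (w : form2 M) (x : M) : manifold n M -> is_form2 w ->
  exists (chi : 'I_n -> M -> R) (c : 'I_n -> 'I_n -> M -> R),
  [/\ forall i, smfun M (chi i), forall i j, smfun M (c i j),
    forall i j y, c i j y = - c j i y &
    \forall y \near x, forall u v, tangent y u -> tangent y v ->
      w y u v = \sum_i \sum_j c i j y * u (chi i) * v (chi j)].
Proof.
move=> mM fw; have [w1 w2 w3 w4] := fw.
have [chi [U [schi fU N]]] := local_frame x mM.
exists (fun i y => chi y 0 i), (fun i j y => w y (U i y) (U j y)); split => //.
- by move=> i j; apply: w4.
- by move=> i j y; apply: form2_anti => //; [case: (fU i)|case: (fU j)].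
- have tU i y : tangent y (U i y) by case: (fU i).
  apply: filterS N => y [_ Hy] u v tu tv; rewrite {1}(Hy u tu) {1}(Hy v tv).
  set V := \sum_i tco chi v 0 i *: _.
  have tV : tangent y V by apply: tangent_sum => i; exact: tangent_scale.
  rewrite (covector_sum (a := fun z => w y z V) _ _ (w2 y V tV)) //.
  apply: eq_bigr => i _; rewrite (covector_sum _ _ (w1 y (U i y) (tU i y))) //.
  by rewrite mulr_sumr; apply: eq_bigr => j _; rewrite !mxE; ring.
Qed.

(** The definition of a form controls global fields on M only, while U is a field along f and need
    not come from one. The local coordinate expression removes the difference; [form2_along] is the
    same for 2-forms. *)
Lemma form1_along n (M N : smooth_space R) (f : N -> M) (a : form1 M) (U : N -> tvec M) :
  manifold n M -> is_form1 a -> smclosed N -> continuous f -> smooth_map f ->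
  (forall y, tangent (f y) (U y)) -> (forall g, smfun M g -> smfun N (fun y => U y g)) ->
  smfun N (fun y => a (f y) (U y)).
Proof.
move=> mM fa cN cf sf tU sU; apply: smf_local => // y.
have [chi [c [schi sc E]]] := form1_rep (f y) mM fa.
exists (fun z => \sum_i c i (f z) * U z (chi i)).
  by apply: smf_sum => // i; apply: smf_mul => //; [exact: sf (sc i)|exact: sU].
have := near_comp cf E; apply: filterS => z Hz; exact: Hz.
Qed.

Lemma form2_along n (M N : smooth_space R) (f : N -> M) (w : form2 M) (U V : N -> tvec M) :
  manifold n M -> is_form2 w -> smclosed N -> continuous f -> smooth_map f ->
  (forall y, tangent (f y) (U y)) -> (forall g, smfun M g -> smfun N (fun y => U y g)) ->
  (forall y, tangent (f y) (V y)) -> (forall g, smfun M g -> smfun N (fun y => V y g)) ->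
  smfun N (fun y => w (f y) (U y) (V y)).
Proof.
move=> mM fw cN cf sf tU sU tV sV; apply: smf_local => // y.
have [chi [c [schi sc _ E]]] := form2_rep (f y) mM fw.
exists (fun z => \sum_i \sum_j c i j (f z) * U z (chi i) * V z (chi j)).
  apply: smf_sum => // i; apply: smf_sum => // j.
  by apply: smf_mul => //; [apply: smf_mul => //; [exact: sf (sc i j)|exact: sU]|exact: sV].
have := near_comp cf E; apply: filterS => z Hz; exact: Hz.
Qed.

Lemma field_bracket (M : smooth_space R) (X Y : vfield M) : smclosed M ->
  is_field X -> is_field Y -> is_field (fbracket X Y).
Proof.
move=> cM [tX sX] [tY sY]; split=> [x|f Hf]; last first.
  by apply: smf_sub => //; [apply: sX; exact: sY|apply: sY; exact: sX].
have [X1 X2 X3] := tX x; have [Y1 Y2 Y3] := tY x.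
split=> [f nf|c f g Hf Hg|f g Hf Hg]; rewrite /fbracket.
- have -> : (fun y => Y y f) = (fun _ => 0).
    by apply/funext => y; case: (tY y) => ->.
  have -> : (fun y => X y f) = (fun _ => 0).
    by apply/funext => y; case: (tX y) => ->.
  by rewrite (tangent_cst _ cM (tX x)) (tangent_cst _ cM (tY x)) subrr.
- have -> : (fun y => Y y (fun z => c * f z + g z)) = (fun y => c * Y y f + Y y g).
    by apply/funext => y; case: (tY y) => _ ->.
  have -> : (fun y => X y (fun z => c * f z + g z)) = (fun y => c * X y f + X y g).
    by apply/funext => y; case: (tX y) => _ ->.
  rewrite X2 ?Y2; [ring|exact: sX|exact: sX|exact: sY|exact: sY].
- have -> : (fun y => Y y (fun z => f z * g z)) = (fun y => 1 * (f y * Y y g) + g y * Y y f).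
    by apply/funext => y; case: (tY y) => _ _ ->; rewrite ?mul1r.
  have -> : (fun y => X y (fun z => f z * g z)) = (fun y => 1 * (f y * X y g) + g y * X y f).
    by apply/funext => y; case: (tX y) => _ _ ->; rewrite ?mul1r.
  have sYg := sY g Hg; have sYf := sY f Hf; have sXg := sX g Hg; have sXf := sX f Hf.
  rewrite X2 ?Y2; try exact: smf_mul.
  by rewrite !X3 // !Y3 //; ring.
Qed.

Definition d2form n (c : 'I_n -> 'I_n -> R) (p q : 'I_n -> R) : R :=
  \sum_i \sum_j c i j * p i * q j.

Lemma d2form_anti n (c : 'I_n -> 'I_n -> R) p q : (forall i j, c i j = - c j i) ->
  d2form c p q = - d2form c q p.
Proof.
move=> ac; rewrite /d2form exchange_big /= -sumrN; apply: eq_bigr => i _.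
by rewrite -sumrN; apply: eq_bigr => j _; rewrite ac; ring.
Qed.

Lemma d2form_sub n (c : 'I_n -> 'I_n -> R) p p' q :
  d2form c (fun i => p i - p' i) q = d2form c p q - d2form c p' q.
Proof.
rewrite /d2form -sumrB; apply: eq_bigr => i _; rewrite -sumrB.
by apply: eq_bigr => j _; ring.
Qed.

Lemma d2form_deriv n (M : smooth_space R) (x : M) v (c : 'I_n -> 'I_n -> M -> R)
    (p q : 'I_n -> M -> R) : smclosed M -> tangent x v ->
  (forall i j, smfun M (c i j)) -> (forall i, smfun M (p i)) -> (forall i, smfun M (q i)) ->
  v (fun y => d2form (fun i j => c i j y) (p ^~ y) (q ^~ y)) =
  d2form (fun i j => v (c i j)) (p ^~ x) (q ^~ x) +
  d2form (fun i j => c i j x) (fun i => v (p i)) (q ^~ x) +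
  d2form (fun i j => c i j x) (p ^~ x) (fun i => v (q i)).
Proof.
move=> cM tv sc sp sq; rewrite /d2form (tangent_sumf _ cM tv); last first.
  by move=> i; apply: smf_sum => // j; apply: smf_mul => //; exact: smf_mul.
rewrite -!big_split /=; apply: eq_bigr => i _; rewrite (tangent_sumf _ cM tv); last first.
  by move=> j; apply: smf_mul => //; exact: smf_mul.
rewrite -!big_split /=; apply: eq_bigr => j _; have [_ _ v3] := tv.
rewrite (v3 _ _ (smf_mul cM (sc i j) (sp i)) (sq j)) (v3 _ _ (sc i j) (sp i)); ring.
Qed.

(* In a local expression [w = sum c_ij da_i da_j] the second derivatives of the
   [a_i] cancel against the bracket terms, so that [d2 w] is a pointwise
   expression in the three fields. *)
Lemma d2_rep m n (M : smooth_space R) (w : form2 M) (x : M) X Y Z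
    (a : 'I_n -> M -> R) (c : 'I_n -> 'I_n -> M -> R) : manifold m M -> is_form2 w ->
  is_field X -> is_field Y -> is_field Z ->
  (forall i, smfun M (a i)) -> (forall i j, smfun M (c i j)) ->
  (forall i j y, c i j y = - c j i y) ->
  (\forall y \near x, forall u v, tangent y u -> tangent y v ->
      w y u v = \sum_i \sum_j c i j y * u (a i) * v (a j)) ->
  d2 w X Y Z x =
  d2form (fun i j => X x (c i j)) (fun i => Y x (a i)) (fun i => Z x (a i))
  - d2form (fun i j => Y x (c i j)) (fun i => X x (a i)) (fun i => Z x (a i))
  + d2form (fun i j => Z x (c i j)) (fun i => X x (a i)) (fun i => Y x (a i)).
Proof.
move=> mM fw fX fY fZ sa sc ac E; have cM := manifold_smclosed mM.
have [w1 w2 w3 w4] := fw.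
have key (V1 V2 : vfield M) (v : tvec M) : tangent x v -> is_field V1 -> is_field V2 ->
    v (fun y => w y (V1 y) (V2 y)) =
    d2form (fun i j => v (c i j)) (fun i => V1 x (a i)) (fun i => V2 x (a i)) +
    d2form (fun i j => c i j x) (fun i => v (fun y => V1 y (a i))) (fun i => V2 x (a i)) +
    d2form (fun i j => c i j x) (fun i => V1 x (a i)) (fun i => v (fun y => V2 y (a i))).
  move=> tv f1 f2; rewrite -(d2form_deriv cM tv sc) //; last 2 first.
  - by move=> i; case: f1 => _; exact.
  - by move=> i; case: f2 => _; exact.
  apply: (tangent_local mM tv); first exact: w4.
    apply: smf_sum => // i; apply: smf_sum => // j.
    by apply: smf_mul => //; [apply: smf_mul => //; case: f1 => _; exact|case: f2 => _; exact].
  by apply: filterS E => y; apply; [case: f1|case: f2].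
have Ex := nbhs_singleton E.
have tX : tangent x (X x) by case: fX.
have tY : tangent x (Y x) by case: fY.
have tZ : tangent x (Z x) by case: fZ.
have tXY : tangent x (fbracket X Y x) by case: (field_bracket cM fX fY).
have tXZ : tangent x (fbracket X Z x) by case: (field_bracket cM fX fZ).
have tYZ : tangent x (fbracket Y Z x) by case: (field_bracket cM fY fZ).
rewrite /d2 !key // !Ex // -!/(d2form _ _ _).
rewrite -!/(d2form (fun i j => c i j x) (fun i => fbracket _ _ x (a i)) (fun i => _ x (a i))).
rewrite /fbracket !d2form_sub.
have ac' i j : c i j x = - c j i x by exact: ac.
rewrite (d2form_anti (fun i => Y x (a i)) (fun i => X x (fun y => Z y (a i))) ac').
rewrite (d2form_anti (fun i => X x (a i)) (fun i => Y x (fun y => Z y (a i))) ac').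
rewrite (d2form_anti (fun i => X x (a i)) (fun i => Z x (fun y => Y y (a i))) ac').
ring.
Qed.

Lemma pull2_form m n (N M : smooth_space R) (f : N -> M) (w : form2 M) :
  manifold m N -> manifold n M -> smooth_map f -> is_form2 w -> is_form2 (pull2 f w).
Proof.
move=> mN mM sf fw; have cM := manifold_smclosed mM; have cN := manifold_smclosed mN.
have [w1 w2 w3 w4] := fw.
have tf x u : tangent x u -> tangent (f x) (tmap f u) by exact: tangent_tmap.
split=> [x u tu|x v tv|x u tu|X Y [tX sX] [tY sY]].
- move=> c v v' tv tv'; rewrite /pull2 tmap_lin.
  by apply: w1; exact: tf.
- move=> c u u' tu tu'; rewrite /pull2 tmap_lin.
  by apply: (w2 (f x) _ (tf _ _ tv)); exact: tf.
- by apply: w3; exact: tf.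
- apply: (form2_along mM fw cN _ sf).
  + exact: smooth_continuous (diffeo_smcontinuous mN) mM sf.
  + by move=> y; exact: tf.
  + move=> g Hg; under eq_fun do rewrite (tmapE _ _ Hg); apply: sX; exact: sf.
  + by move=> y; exact: tf.
  + move=> g Hg; under eq_fun do rewrite (tmapE _ _ Hg); apply: sY; exact: sf.
Qed.

(** The primed fields agree with the pushed-forward ones at the single point f x; no relatedness is
    assumed. This is possible because [d2_rep] expresses [d2] through the values of the fields at
    the point. *)
Lemma d2_pull2 m n (N M : smooth_space R) (f : N -> M) (w : form2 M) x X Y Z X' Y' Z' :
  manifold m N -> manifold n M -> smooth_map f -> is_form2 w ->
  is_field X -> is_field Y -> is_field Z -> is_field X' -> is_field Y' -> is_field Z' ->
  X' (f x) = tmap f (X x) -> Y' (f x) = tmap f (Y x) -> Z' (f x) = tmap f (Z x) ->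
  d2 (pull2 f w) X Y Z x = d2 w X' Y' Z' (f x).
Proof.
move=> mN mM sf fw fX fY fZ fX' fY' fZ' EX EY EZ.
have cN := manifold_smclosed mN.
have [a [c [sa sc ac E]]] := form2_rep (f x) mM fw.
rewrite (d2_rep mM fw fX' fY' fZ' sa sc ac E).
have cf := smooth_continuous (diffeo_smcontinuous mN) mM sf.
have E' : \forall y \near x, forall u v, tangent y u -> tangent y v ->
      pull2 f w y u v = \sum_i \sum_j (c i j \o f) y * u (a i \o f) * v (a j \o f).
  have := near_comp cf E; apply: filterS => y Hy u v tu tv; rewrite /pull2 Hy.
  - by apply: eq_bigr => i _; apply: eq_bigr => j _; rewrite !tmapE.
  - by apply: tangent_tmap => //; exact: manifold_smclosed mM.
  - by apply: tangent_tmap => //; exact: manifold_smclosed mM.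
rewrite (d2_rep mN (pull2_form mN mM sf fw) fX fY fZ _ _ _ E').
- rewrite EX EY EZ.
  by congr (_ - _ + _); apply: eq_bigr => i _; apply: eq_bigr => j _; rewrite !tmapE.
- by move=> i; exact: sf (sa i).
- by move=> i j; exact: sf (sc i j).
- by move=> i j y /=; exact: ac.
Qed.

End Forms.

(** * Transverse fiber products *)

Section FiberProducts.
Context {R : realType}.

Lemma cluster_map (T U : topologicalType) (f : T -> U) p q : continuous f ->
  cluster (nbhs p) q -> cluster (nbhs (f p)) (f q).
Proof.
move=> cf H A B nA nB; have [z [Az Bz]] := H _ _ (cf p A nA) (cf q B nB).
by exists (f z).
Qed.

Lemma dvec0 n (z : 'rV[R]_n) : dvec z 0 = 0.
Proof.
apply/funext => f; rewrite /dvec; case: ifP => // _.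
by rewrite derive0.
Qed.

Lemma Cinfty_smooth (M : smooth_space R) n (kap : 'rV[R]_n -> M) h :
  smooth_map (kap : euclid R n -> M) -> smfun M h -> Cinfty (fun z => h (kap z)).
Proof. by move=> sk Hh; exact: (sk h Hh). Qed.

Section FiberProduct.
Variables (X Y Z : smooth_space R) (f : X -> Z) (g : Y -> Z).
Local Notation F := (fiber_product f g).

Lemma continuous_fpr1 : continuous (fun p : F => fpr1 p).
Proof. exact: (continuous_comp_fun (@continuous_fst X Y) (@continuous_val _ _)). Qed.

Lemma continuous_fpr2 : continuous (fun p : F => fpr2 p).
Proof. exact: (continuous_comp_fun (@continuous_snd X Y) (@continuous_val _ _)). Qed.

Lemma smooth_fpr1 : smooth_map (@fpr1 R X Y Z f g).
Proof. by move=> h Hh; exact: (smooth_val (smooth_fst Hh)). Qed.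

Lemma smooth_fpr2 : smooth_map (@fpr2 R X Y Z f g).
Proof. by move=> h Hh; exact: (smooth_val (smooth_snd Hh)). Qed.

Lemma continuous_to_fiber (T : topologicalType) (h : T -> F) :
  continuous (fun t => fpr1 (h t)) -> continuous (fun t => fpr2 (h t)) -> continuous h.
Proof. by move=> c1 c2; apply: continuous_to_sub; exact: continuous_to_prod. Qed.

Lemma smooth_to_fiber (M : smooth_space R) (h : M -> F) : smclosed M ->
  continuous (fun t => fpr1 (h t)) -> continuous (fun t => fpr2 (h t)) ->
  smooth_map (fun t => fpr1 (h t)) -> smooth_map (fun t => fpr2 (h t)) -> smooth_map h.
Proof.
move=> cM c1 c2 s1 s2; apply: smooth_to_ssub => //; first exact: continuous_to_fiber.
by apply: smooth_to_sprod => //; exact: continuous_to_prod.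
Qed.

Lemma fiber_hausdorff : hausdorff_space X -> hausdorff_space Y -> hausdorff_space F.
Proof.
move=> hX hY p q H; apply: fiber_product_eq.
  by apply: hX; exact: (cluster_map continuous_fpr1 H).
by apply: hY; exact: (cluster_map continuous_fpr2 H).
Qed.

Lemma fiber_second_countable : @second_countable X -> @second_countable Y ->
  @second_countable F.
Proof.
move=> [BX cX [oX nX]] [BY cY [oY nY]].
pose S (UV : set X * set Y) : set F := [set p | UV.1 (fpr1 p) /\ UV.2 (fpr2 p)].
exists (S @` (BX `*` BY)); first exact: card_le_trans (card_image_le _ _) (countableX cX cY).
split=> [_ [[U V] [/= BU BV] <-]|p W].
  apply: openI; first by apply: open_comp; [move=> q _; exact: continuous_fpr1|exact: oX].
  by apply: open_comp; [move=> q _; exact: continuous_fpr2|exact: oY].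
rewrite nbhsE => -[_ [[Q oQ <-] Qp] QW].
have : nbhs (set_val p : X * Y) Q by exact: open_nbhs_nbhs.
move=> [[U V] [/= nU nV] UVQ].
have [U' [BU' U'p] U'U] := nX _ _ nU; have [V' [BV' V'p] V'V] := nY _ _ nV.
exists (S (U', V')); first by split => //; exists (U', V').
by move=> q [/= q1 q2]; apply: QW; apply: UVQ; split => /=; [exact: U'U|exact: V'V].
Qed.

Lemma fiber_smclosed : smclosed F. Proof. exact: ssub_smclosed. Qed.

Lemma fiber_smcontinuous : smcontinuous X -> smcontinuous Y -> smcontinuous F.
Proof. by move=> cX cY; apply: ssub_smcontinuous; exact: sprod_smcontinuous. Qed.

Variables (nX nY nZ m : nat).
Hypotheses (mX : manifold nX X) (mY : manifold nY Y) (mZ : manifold nZ Z).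
Hypotheses (sf : smooth_map f) (sg : smooth_map g) (tr : transverse f g).
Hypothesis (dim : (nX + nY = nZ + m)%N).

Let tco_chart (M : smooth_space R) n x (chi : M -> 'rV[R]_n) kap h v : manifold n M ->
  chart_at x chi kap -> smooth_map (h : M -> Z) -> tangent x v -> forall zeta : Z -> 'rV[R]_nZ,
  (forall i, smfun Z (fun y => zeta y 0 i)) ->
  dmap (zeta \o h \o kap) 0 (tco chi v) = tco zeta (tmap h v).
Proof.
move=> mM [schi skap ckap chix [kc ck]] sh tv zeta szeta.
have -> : tmap h v = tmap h (tmap (kap : euclid R n -> M) (dvec 0 (tco chi v))).
  by rewrite -chix -(chart_tangent mM schi skap kc tv).
apply/rowP => i; rewrite !mxE tmapE // tmapE; last exact: sh.
by rewrite dvecE //; exact: (skap _ (sh _ (szeta i))).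
Qed.

(** In charts the fiber product is the zero set of H (a, b) = f a - g b on R^(nX + nY), a submersion
    at 0 by transversality, so [implicit_chart] applies. The tangent statements are proved along
    with the chart because they use its construction. *)
Lemma fiber_chart (p : F) : exists (chi : F -> 'rV[R]_m) (kap : 'rV[R]_m -> F),
  [/\ chart_at p chi kap,
      forall u v, tangent (fpr1 p) u -> tangent (fpr2 p) v -> tmap f u = tmap g v ->
        exists w, [/\ tangent p w, tmap (@fpr1 R X Y Z f g) w = u &
                      tmap (@fpr2 R X Y Z f g) w = v] &
      forall w, tangent p w -> tmap (@fpr1 R X Y Z f g) w = 0 ->
        tmap (@fpr2 R X Y Z f g) w = 0 -> tco chi w = 0].
Proof.
have cX := manifold_smclosed mX; have cY := manifold_smclosed mY.
have cZ := manifold_smclosed mZ.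
have scX := diffeo_smcontinuous mX; have scY := diffeo_smcontinuous mY.
have [chiX [kapX chX]] := manifold_chart (fpr1 p) mX.
have [chiY [kapY chY]] := manifold_chart (fpr2 p) mY.
have [chiZ [kapZ chZ]] := manifold_chart (f (fpr1 p)) mZ.
have [sX skX ckX X0 [kcX ccX]] := chX; have [sY skY ckY Y0 [kcY ccY]] := chY.
have [sZ skZ ckZ Z0 [kcZ ccZ]] := chZ.
have cchX : continuous chiX by apply: continuous_rV => i; exact: scX.
have cchY : continuous chiY by apply: continuous_rV => i; exact: scY.
have kX0 : kapX 0 = fpr1 p by rewrite -X0; exact: nbhs_singleton kcX.
have kY0 : kapY 0 = fpr2 p by rewrite -Y0; exact: nbhs_singleton kcY.
have cf : continuous f by exact: smooth_continuous scX mZ sf.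
have cg : continuous g by exact: smooth_continuous scY mZ sg.
pose fh := chiZ \o f \o kapX; pose gh := chiZ \o g \o kapY.
have sfh : smap fh by move=> i; exact: (Cinfty_smooth skX (sf (sZ i))).
have sgh : smap gh by move=> i; exact: (Cinfty_smooth skY (sg (sZ i))).
have fh0 : fh 0 = 0 by rewrite /fh /= kX0.
have gh0 : gh 0 = 0 by rewrite /gh /= kY0 -fiber_productE.
pose lp (w : 'rV[R]_(nX + nY)) : 'rV[R]_nX := lsubmx w.
pose rp (w : 'rV[R]_(nX + nY)) : 'rV[R]_nY := rsubmx w.
have slp : smap lp by exact: smap_lsubmx.
have srp : smap rp by exact: smap_rsubmx.
have dlp x v : dmap lp x v = lp v.
  apply/rowP => i; rewrite !mxE; under eq_fun do rewrite mxE.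
  by have [_ ->] := is_derive_split (is_derive_coord x v (lshift nY i)).
have drp x v : dmap rp x v = rp v.
  apply/rowP => i; rewrite !mxE; under eq_fun do rewrite mxE.
  by have [_ ->] := is_derive_split (is_derive_coord x v (rshift nX i)).
have lp0 : lp 0 = 0 by apply/rowP => i; rewrite !mxE.
have rp0 : rp 0 = 0 by apply/rowP => i; rewrite !mxE.
pose H w := (fh \o lp) w - (gh \o rp) w.
have sH : smap H by apply: smap_sub; exact: smap_comp.
have H0 : H 0 = 0 by rewrite /H /= lp0 rp0 fh0 gh0 subrr.
have dH v : dmap H 0 v = dmap fh 0 (lp v) - dmap gh 0 (rp v).
  rewrite dmap_sub; [|exact: smap_comp|exact: smap_comp].
  by rewrite (dmap_comp _ _ sfh slp) (dmap_comp _ _ sgh srp) lp0 rp0 dlp drp.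
have dfh u : tangent (fpr1 p) u -> dmap fh 0 (tco chiX u) = tco chiZ (tmap f u).
  by move=> tu; exact: (tco_chart mX chX).
have dgh u : tangent (fpr2 p) u -> dmap gh 0 (tco chiY u) = tco chiZ (tmap g u).
  by move=> tu; exact: (tco_chart mY chY).
have surj w : exists v, dmap H 0 v = w.
  have kZ0 : kapZ 0 = f (fpr1 p) by rewrite -Z0; exact: nbhs_singleton kcZ.
  have tw : tangent (f (fpr1 p)) (tmap (kapZ : euclid R nZ -> Z) (dvec 0 w)).
    by rewrite -kZ0; apply: tangent_tmap => //; exact: tangent_dvec.
  have [u [v [tu tv E]]] := tr (fiber_productE p) tw.
  (* The sign is there because transversality provides a sum, whereas H is a difference. *)
  exists (row_mx (tco chiX u) (- tco chiY v)).
  rewrite dH /lp /rp row_mxKl row_mxKr dfh //.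
  have -> : dmap gh 0 (- tco chiY v) = - tco chiZ (tmap g v).
    by rewrite -dgh // !dmapE // mulNmx.
  rewrite opprK -[tco chiZ (tmap f u)]scale1r -tco_lin scale1r -E.
  by exact: (chart_tco _ sZ skZ ccZ).
have [P [k [sk k0 kH Hk dk]]] := implicit_chart dim sH H0 surj.
have ck : continuous k by exact: smap_continuous.
have clp : continuous lp by exact: smap_continuous.
have crp : continuous rp by exact: smap_continuous.
(* Vanishing of H only says that the two images agree after chiZ; near p both lie where kapZ inverts
   chiZ, so they agree in Z. *)
have good : \forall c \near (0 : 'rV[R]_m), f (kapX (lp (k c))) = g (kapY (rp (k c))).
  have N1 : \forall c \near (0 : 'rV[R]_m), kapZ (chiZ (f (kapX (lp (k c))))) = f (kapX (lp (k c))).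
    apply: (near_comp (g := fun c => f (kapX (lp (k c)))) (P := fun z => kapZ (chiZ z) = z)).
      exact: (continuous_comp_fun cf (continuous_comp_fun ckX (continuous_comp_fun clp ck))).
    by rewrite k0 lp0 kX0.
  have N2 : \forall c \near (0 : 'rV[R]_m), kapZ (chiZ (g (kapY (rp (k c))))) = g (kapY (rp (k c))).
    apply: (near_comp (g := fun c => g (kapY (rp (k c)))) (P := fun z => kapZ (chiZ z) = z)).
      exact: (continuous_comp_fun cg (continuous_comp_fun ckY (continuous_comp_fun crp ck))).
    by rewrite k0 rp0 kY0 -fiber_productE.
  apply: filterS3 N1 N2 Hk => c <- <- [/eqP]; rewrite /H subr_eq0 => /eqP E _.
  by congr kapZ.
have /nbhs_normP [r /= r0 Hr] := good.
have r2 : 0 < r / 2 by rewrite divr_gt0.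
have [C C0 cut] := @cutoff R m.
have [rho [srho brho idrho _]] := cut _ r2.
have crho : continuous rho by exact: smap_continuous.
have small : \forall c \near (0 : 'rV[R]_m), rho c = c.
  have : \forall z \near (0 : 'rV[R]_m), `|z| < r / 2 / 2 by apply: nbhs0_lt; rewrite !divr_gt0.
  by apply: filterS => z /ltW; exact: idrho.
have rho0 : rho 0 = 0 by exact: nbhs_singleton small.
(* With the cutoff rho the equation holds for every c, so kap is defined on all of R^m with values
   in the fiber product. *)
have Fc c : f (kapX (lp (k (rho c)))) = g (kapY (rp (k (rho c)))).
  apply: Hr; rewrite /= sub0r normrN (le_lt_trans (brho c)) //.
  by rewrite ltr_pdivrMr // ltr_pMr // ltr1n.
pose kap c : F := fmk (Fc c).
pose row (q : F) : 'rV[R]_(nX + nY) := row_mx (chiX (fpr1 q)) (chiY (fpr2 q)).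
pose chi (q : F) : 'rV[R]_m := row q *m P.
have srow i : smfun F (fun q => row q 0 i).
  under eq_fun do rewrite mxE; case: (fintype.split i) => j.
    exact: (smooth_fpr1 (sX j)).
  exact: (smooth_fpr2 (sY j)).
have crow : continuous row.
  by apply: continuous_rV => i; exact: (fiber_smcontinuous scX scY).
have row0 : row p = 0 by rewrite /row X0 Y0 row_mx0.
have schi i : smfun F (fun q => chi q 0 i).
  under eq_fun do rewrite mxE.
  apply: (smf_sum fiber_smclosed) => j.
  exact: (smf_mul fiber_smclosed (srow j) (smf_cst fiber_smclosed _)).
have chi0 : chi p = 0 by rewrite /chi row0 mul0mx.
have cchi : continuous chi.
  by apply: continuous_rV => i; exact: (fiber_smcontinuous scX scY).
have skr : smap (k \o rho) by exact: smap_comp.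
have slkr : smap (lp \o (k \o rho)) by exact: smap_comp.
have srkr : smap (rp \o (k \o rho)) by exact: smap_comp.
have ckap : continuous kap.
  apply: continuous_to_fiber.
    exact: (continuous_comp_fun ckX (smap_continuous slkr)).
  exact: (continuous_comp_fun ckY (smap_continuous srkr)).
have skap : smooth_map (kap : euclid R m -> F).
  apply: smooth_to_fiber.
  - exact: euclid_smclosed.
  - exact: (continuous_comp_fun ckX (smap_continuous slkr)).
  - exact: (continuous_comp_fun ckY (smap_continuous srkr)).
  - by move=> h Hh; exact: (Cinfty_comp (skX _ Hh) slkr).
  - by move=> h Hh; exact: (Cinfty_comp (skY _ Hh) srkr).
have kap1 c : fpr1 (kap c) = kapX (lp (k (rho c))) by [].
have kap2 c : fpr2 (kap c) = kapY (rp (k (rho c))) by [].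
have kap0 : kap 0 = p.
  by apply: fiber_product_eq; rewrite ?kap1 ?kap2 rho0 k0 ?lp0 ?rp0.
have chart : chart_at p chi kap.
  split => //; split.
  - have N1 : \forall q \near p, kapX (chiX (fpr1 q)) = fpr1 q.
      exact: (near_comp (g := fun q : F => fpr1 q) (P := fun x => kapX (chiX x) = x) continuous_fpr1).
    have N2 : \forall q \near p, kapY (chiY (fpr2 q)) = fpr2 q.
      exact: (near_comp (g := fun q : F => fpr2 q) (P := fun x => kapY (chiY x) = x) continuous_fpr2).
    have N3 : \forall q \near p, H (row q) = 0 -> k (row q *m P) = row q.
      by apply: (near_comp (g := row) (P := fun w => H w = 0 -> k (w *m P) = w) crow); rewrite row0.
    have N4 : \forall q \near p, rho (chi q) = chi q.
      by apply: (near_comp (g := chi) (P := fun c => rho c = c) cchi); rewrite chi0.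
    near=> q.
    have E1 : kapX (chiX (fpr1 q)) = fpr1 q by near: q.
    have E2 : kapY (chiY (fpr2 q)) = fpr2 q by near: q.
    have E4 : rho (chi q) = chi q by near: q.
    have Hq : H (row q) = 0.
      rewrite /H /= /lp /rp row_mxKl row_mxKr /fh /gh /= E1 E2.
      by rewrite fiber_productE subrr.
    have E3 : k (row q *m P) = row q by move: Hq; near: q.
    apply: fiber_product_eq; rewrite ?kap1 ?kap2 E4 {1}/chi E3.
      by rewrite /lp row_mxKl.
    by rewrite /rp row_mxKr.
  - have N1 : \forall c \near (0 : 'rV[R]_m), chiX (kapX (lp (k c))) = lp (k c).
      apply: (near_comp (g := fun c => lp (k c)) (P := fun a => chiX (kapX a) = a)).
        exact: continuous_comp_fun clp ck.
      by rewrite k0 lp0.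
    have N2 : \forall c \near (0 : 'rV[R]_m), chiY (kapY (rp (k c))) = rp (k c).
      apply: (near_comp (g := fun c => rp (k c)) (P := fun a => chiY (kapY a) = a)).
        exact: continuous_comp_fun crp ck.
      by rewrite k0 rp0.
    near=> c.
    have E1 : chiX (kapX (lp (k c))) = lp (k c) by near: c.
    have E2 : chiY (kapY (rp (k c))) = rp (k c) by near: c.
    have E3 : rho c = c by near: c.
    have [_ E4] : H (k c) = 0 /\ k c *m P = c by near: c.
    rewrite /chi /row kap1 kap2 E3 E1 E2.
    by rewrite /lp /rp hsubmxK.
exists chi, kap; split => //.
- move=> u v tu tv E.
  pose w := row_mx (tco chiX u) (tco chiY v).
  have dHw : dmap H 0 w = 0.
    by rewrite dH /w /lp /rp row_mxKl row_mxKr dfh // dgh // E subrr.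
  have dkw := dk w dHw.
  have drk : dmap (k \o rho) 0 (w *m P) = w.
    rewrite (@dmap_near _ _ _ _ k) ?dkw //.
    by apply: filterS small => c /= ->.
  exists (tmap (kap : euclid R m -> F) (dvec 0 (w *m P))); split.
  + rewrite -kap0; apply: tangent_tmap => //; first exact: fiber_smclosed.
    exact: tangent_dvec.
  + rewrite -tmap_comp; last exact: smooth_fpr1.
    rewrite (chart_tangent mX sX skX kcX tu) X0.
    apply/funext => h; have [Hh|Hh] := pselect (smfun X h); last by rewrite !tmapE0.
    have Hhk : Cinfty (h \o kapX) by exact: skX.
    rewrite !tmapE // !dvecE //; last exact: (Cinfty_comp Hhk slkr).
    rewrite (derive_comp (f := h \o kapX) (g := lp \o (k \o rho)) _ _ Hhk slkr).
    rewrite dmap_comp // drk dlp /= rho0 k0 lp0.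
    by rewrite /lp row_mxKl.
  + rewrite -tmap_comp; last exact: smooth_fpr2.
    rewrite (chart_tangent mY sY skY kcY tv) Y0.
    apply/funext => h; have [Hh|Hh] := pselect (smfun Y h); last by rewrite !tmapE0.
    have Hhk : Cinfty (h \o kapY) by exact: skY.
    rewrite !tmapE // !dvecE //; last exact: (Cinfty_comp Hhk srkr).
    rewrite (derive_comp (f := h \o kapY) (g := rp \o (k \o rho)) _ _ Hhk srkr).
    rewrite dmap_comp // drk drp /= rho0 k0 rp0.
    by rewrite /rp row_mxKr.
(* The chart is linear in the coordinates of the two factors, so w annihilates its components once
   both projections of w vanish. *)
- move=> w tw w1 w2; apply/rowP => i; rewrite !mxE; under eq_fun do rewrite mxE.
  rewrite (tangent_sumf _ fiber_smclosed tw); last first.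
    by move=> j; exact: (smf_mul fiber_smclosed (srow j) (smf_cst fiber_smclosed _)).
  apply: big1 => j _; have [_ _ v3] := tw.
  rewrite (v3 _ _ (srow j) (smf_cst fiber_smclosed _)).
  rewrite (tangent_cst _ fiber_smclosed tw) mulr0 add0r.
  suff -> : w (fun q => row q 0 j) = 0 by rewrite mulr0.
  under eq_fun do rewrite mxE; case: (fintype.split j) => a.
    by have := congr1 (fun t => t (fun y => chiX y 0 a)) w1; rewrite tmapE.
  by have := congr1 (fun t => t (fun y => chiY y 0 a)) w2; rewrite tmapE.
Unshelve. all: end_near. Qed.

Lemma fiber_manifold : manifold m F.
Proof.
have [hX sX _ _] := mX; have [hY sY _ _] := mY.
apply: chart_manifold.
- exact: fiber_hausdorff.
- exact: fiber_second_countable.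
- exact: fiber_smclosed.
- by apply: fiber_smcontinuous; [exact: diffeo_smcontinuous mX|exact: diffeo_smcontinuous mY].
- by move=> p; have [chi [kap [ch _ _]]] := fiber_chart p; exists chi, kap.
Qed.

Lemma fiber_tangent (p : F) u v : tangent (fpr1 p) u -> tangent (fpr2 p) v ->
  tmap f u = tmap g v ->
  exists w, [/\ tangent p w, tmap (@fpr1 R X Y Z f g) w = u & tmap (@fpr2 R X Y Z f g) w = v].
Proof. by move=> tu tv E; have [chi [kap [_ H _]]] := fiber_chart p; exact: H. Qed.

Lemma fiber_tangent_inj (p : F) w w' : tangent p w -> tangent p w' ->
  tmap (@fpr1 R X Y Z f g) w = tmap (@fpr1 R X Y Z f g) w' ->
  tmap (@fpr2 R X Y Z f g) w = tmap (@fpr2 R X Y Z f g) w' -> w = w'.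
Proof.
move=> tw tw' E1 E2; have [chi [kap [[schi skap ckap chi0 [kc ck]] _ H]]] := fiber_chart p.
apply/eqP; rewrite -subr_eq0; apply/eqP.
have td : tangent p (w - w') by exact: tangent_sub.
rewrite (chart_tangent fiber_manifold schi skap kc td) H //; last 2 first.
- by rewrite tmapB E1 subrr.
- by rewrite tmapB E2 subrr.
by rewrite dvec0 tmap0.
Qed.

End FiberProduct.
End FiberProducts.

(** * Linear algebra of tangent spaces *)

Section TangentAlgebra.
Context {R : realType}.

Definition independent (V : lmodType R) k (u : 'I_k -> V) : Prop :=
  forall c : 'I_k -> R, \sum_i c i *: u i = 0 -> forall i, c i = 0.

Lemma tangent_basis n (M : smooth_space R) (x : M) : manifold n M ->
  exists (chi : M -> 'rV[R]_n) (B : 'I_n -> tvec M),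
  [/\ forall i, smfun M (fun y => chi y 0 i), forall i, tangent x (B i),
      forall c : 'I_n -> R, tco chi (\sum_i c i *: B i) = \row_i c i &
      forall v, tangent x v -> v = \sum_i tco chi v 0 i *: B i].
Proof.
move=> mM; have [chi [U [schi fU N]]] := local_frame x mM.
have [N1 N2] := nbhs_singleton N.
exists chi, (fun i => U i x); split => //.
- by move=> i; case: (fU i).
- move=> c; rewrite tco_sum [RHS]row_sum_delta; apply: eq_bigr => i _.
  by rewrite tcoZ N1 mxE.
Qed.

Lemma tco_rows n k (M : smooth_space R) (chi : M -> 'rV[R]_n) (c : 'rV[R]_k) (u : 'I_k -> tvec M) :
  tco chi (\sum_i c 0 i *: u i) = c *m \matrix_(i, j) tco chi (u i) 0 j.
Proof.
rewrite tco_sum; apply/rowP => j; rewrite summxE mxE; apply: eq_bigr => i _.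
by rewrite tcoZ !mxE.
Qed.

Lemma tco_inj n (M : smooth_space R) (x : M) chi (B : 'I_n -> tvec M) u v :
  (forall v, tangent x v -> v = \sum_i tco chi v 0 i *: B i) ->
  tangent x u -> tangent x v -> tco chi u = tco chi v -> u = v.
Proof. by move=> H tu tv E; rewrite (H u tu) (H v tv) E. Qed.

Lemma independent_row_free n k (M : smooth_space R) (x : M) (chi : M -> 'rV[R]_n)
    (B : 'I_n -> tvec M) (u : 'I_k -> tvec M) :
  (forall v, tangent x v -> v = \sum_i tco chi v 0 i *: B i) ->
  (forall i, tangent x (u i)) -> independent u ->
  row_free (\matrix_(i, j) tco chi (u i) 0 j).
Proof.
move=> H tu iu; apply: inj_row_free => c; rewrite -tco_rows => E.
apply/rowP => i; rewrite mxE; apply: (iu (fun i => c 0 i)).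
apply: (tco_inj H _ (tangent0 x)).
  by apply: tangent_sum => j; exact: tangent_scale.
by rewrite E; apply/rowP => j; rewrite !mxE.
Qed.

Section Kernel.
Variables (nM nN k : nat) (M N : smooth_space R) (f : M -> N) (x : M).
Hypotheses (mM : manifold nM M) (mN : manifold nN N) (sf : submersion f).
Hypothesis dim : nM = (nN + k)%N.

Let kernel_matrix : exists (chi : M -> 'rV[R]_nM) (B : 'I_nM -> tvec M) (S : 'M[R]_(nM, nN)),
  [/\ [/\ forall i, tangent x (B i),
      forall c : 'I_nM -> R, tco chi (\sum_i c i *: B i) = \row_i c i &
      forall v, tangent x v -> v = \sum_i tco chi v 0 i *: B i],
      \rank (kermx S) = k &
      forall v, tangent x v -> (tmap f v = 0 <-> tco chi v *m S = 0)].
Proof.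
have cN := manifold_smclosed mN; have [sf1 sf2] := sf.
have [chi [B [schi tB cB spB]]] := tangent_basis x mM.
have [chiN [BN [schiN tBN cBN spBN]]] := tangent_basis (f x) mN.
pose S := \matrix_(i, j) tco chiN (tmap f (B i)) 0 j.
have SE v : tangent x v -> tco chiN (tmap f v) = tco chi v *m S.
  move=> tv; rewrite -tco_rows {1}(spB v tv) tmap_sum.
  by congr tco; apply: eq_bigr => i _; rewrite tmapZ.
exists chi, B, S; split => //.
- have fS : row_full S.
    rewrite -sub1mx; apply/row_subP => i.
    pose w := \sum_j (row i 1%:M : 'rV[R]_nN) 0 j *: BN j.
    have tw : tangent (f x) w by apply: tangent_sum => j; exact: tangent_scale.
    have [v tv E] := sf2 x w tw.
    have -> : row i 1%:M = tco chiN w by rewrite cBN; apply/rowP => j; rewrite !mxE.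
    by rewrite -E SE //; exact: submxMl.
  by rewrite mxrank_ker (eqP fS) dim addKn.
- move=> v tv; split=> [E|E].
    by rewrite -SE // E; apply/rowP => i; rewrite !mxE.
  apply: (tco_inj spBN _ (tangent0 (f x))); first exact: tangent_tmap.
  by rewrite SE // E; apply/rowP => i; rewrite !mxE.
Qed.

Lemma kernel_basis : exists u : 'I_k -> tvec M,
  [/\ forall i, tangent x (u i), forall i, tmap f (u i) = 0 & independent u].
Proof.
have [chi [B [S [[tB cB spB] rS kS]]]] := kernel_matrix.
have [K Kf KS] := row_base_rank rS.
pose u i := \sum_j K i j *: B j.
have tu i : tangent x (u i) by apply: tangent_sum => j; exact: tangent_scale.
have cu i : tco chi (u i) = row i K by rewrite cB; apply/rowP => j; rewrite !mxE.
exists u; split => //.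
- move=> i; apply/kS => //; rewrite cu -row_mul.
  have -> : K *m S = 0 by apply/sub_kermxP; rewrite KS.
  by rewrite row0.
- move=> c E i.
  have : tco chi (\sum_i c i *: u i) = 0.
    by rewrite E; apply/rowP => j; rewrite !mxE.
  have -> : tco chi (\sum_i c i *: u i) = (\row_i c i) *m K.
    have := tco_rows chi (\row_i c i) u.
    under eq_bigr do rewrite mxE.
    move=> ->; congr (_ *m _); apply/matrixP => a b.
    by rewrite mxE cu mxE.
  rewrite -(mul0mx _ K) => /(row_free_inj Kf)/rowP/(_ i).
  by rewrite !mxE.
Qed.

Lemma kernel_span (u : 'I_k -> tvec M) a : (forall i, tangent x (u i)) ->
  (forall i, tmap f (u i) = 0) -> independent u -> tangent x a -> tmap f a = 0 ->
  exists c : 'I_k -> R, a = \sum_i c i *: u i.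
Proof.
move=> tu ku iu ta ka.
have [chi [B [S [[tB cB spB] rS kS]]]] := kernel_matrix.
pose K := \matrix_(i, j) tco chi (u i) 0 j.
have Kf : row_free K by exact: (independent_row_free spB tu iu).
have KS : (K <= kermx S)%MS.
  apply/sub_kermxP/row_matrixP => i; rewrite row0 row_mul.
  have -> : row i K = tco chi (u i) by apply/rowP => j; rewrite !mxE.
  by apply/kS.
have SK : (kermx S <= K)%MS.
  by have := mxrank_leqif_sup KS => -[_ <-]; rewrite rS (eqP Kf).
have /submxP [c Ec] : (tco chi a <= K)%MS.
  by apply: submx_trans SK; apply/sub_kermxP; apply/kS.
exists (fun i => c 0 i); apply: (tco_inj spB ta).
  by apply: tangent_sum => j; exact: tangent_scale.
by rewrite tco_rows Ec.
Qed.

End Kernel.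

(* Lagrangian means maximal isotropic, by counting dimensions in T + T^*. *)
Lemma lagrangian_span n (N : smooth_space R) (x : N) (E : 'I_n -> gvec N) (e : gvec N) :
  manifold n N -> (forall i, gfiber x (E i)) ->
  (forall c : 'I_n -> R, Defs.geq x (\sum_i c i *: (E i).1, \sum_i c i *: (E i).2) (0, 0) ->
     forall i, c i = 0) ->
  (forall i j, gpairing (E i) (E j) = 0) -> gfiber x e ->
  (forall i, gpairing e (E i) = 0) ->
  exists c : 'I_n -> R, Defs.geq x e (\sum_i c i *: (E i).1, \sum_i c i *: (E i).2).
Proof.
move=> mN fE iE EE fe eE; have [chi [B [schi tB cB spB]]] := tangent_basis x mN.
pose r (d : gvec N) : 'rV[R]_(n + n) := row_mx (tco chi d.1) (\row_j d.2 (B j)).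
(* Exchanging the two halves turns the pairing into a plain product of rows. *)
pose r' (d : gvec N) : 'rV[R]_(n + n) := row_mx (\row_j d.2 (B j)) (tco chi d.1).
have pE d d' : gfiber x d -> gfiber x d' -> gpairing d d' = (r d *m (r' d')^T) 0 0.
  move=> [t1 c1] [t1' c1']; rewrite /gpairing.
  have -> : d.2 d'.1 = \sum_i tco chi d'.1 0 i * d.2 (B i).
    by rewrite {1}(spB _ t1') (covector_sum _ _ c1).
  have -> : d'.2 d.1 = \sum_i tco chi d.1 0 i * d'.2 (B i).
    by rewrite {1}(spB _ t1) (covector_sum _ _ c1').
  rewrite /r /r' tr_row_mx mul_row_col !mxE addrC; congr (_ + _); apply: eq_bigr => i _.
    by rewrite !mxE mulrC.
  by rewrite !mxE.
have sumE (c : 'I_n -> R) (a : 'I_n -> tcovec N) v :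
    (\sum_i c i *: a i) v = \sum_i c i * a i v.
  by elim/big_rec2: _ => // i b d _ <-.
have geqr d d' : gfiber x d -> gfiber x d' -> r d = r d' -> Defs.geq x d d'.
  move=> [t1 c1] [t1' c1'] /eq_row_mx [E1 E2]; split; first exact: (tco_inj spB).
  move=> v tv; rewrite (spB v tv) (covector_sum _ _ c1) // (covector_sum _ _ c1') //.
  apply: eq_bigr => j _; congr (_ * _).
  by have := congr1 (fun m : 'rV[R]_n => m 0 j) E2; rewrite !mxE.
pose M := \matrix_(i, j) r (E i) 0 j; pose M' := \matrix_(i, j) r' (E i) 0 j.
pose comb (c : 'I_n -> R) : gvec N := (\sum_i c i *: (E i).1, \sum_i c i *: (E i).2).
have fcomb c : gfiber x (comb c).
  split=> /=; first by apply: tangent_sum => i; apply: tangent_scale; case: (fE i).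
  move=> d u v tu tv; rewrite !sumE mulr_sumr -big_split /=; apply: eq_bigr => i _.
  by have [_ ci] := fE i; rewrite ci //; ring.
have Mrl : M = row_mx (\matrix_(i, j) tco chi (E i).1 0 j) (\matrix_(i, j) (E i).2 (B j)).
  by apply/matrixP => i j; rewrite !mxE; case: (fintype.split j) => k; rewrite !mxE.
have rcomb (c : 'rV[R]_n) : r (comb (fun i => c 0 i)) = c *m M.
  rewrite Mrl mul_mx_row /r; congr row_mx; first exact: tco_rows.
  apply/rowP => k; rewrite /comb /= !mxE (sumE (fun i => c 0 i) (fun i => (E i).2)).
  by apply: eq_bigr => i _; rewrite mxE.
have M'rl : M' = row_mx (\matrix_(i, j) (E i).2 (B j)) (\matrix_(i, j) tco chi (E i).1 0 j).
  by apply/matrixP => i j; rewrite !mxE; case: (fintype.split j) => k; rewrite !mxE.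
have Mf : row_free M.
  apply: inj_row_free => c cM; apply/rowP => i; rewrite mxE.
  apply: (iE (fun i => c 0 i)); apply: geqr => //; first exact: fcomb.
    by split; [exact: tangent0|move=> d u v _ _ /=; rewrite -[RHS]/(d * 0 + 0) mulr0 addr0].
  rewrite rcomb cM; apply/rowP => j; rewrite !mxE.
  by case: (fintype.split j) => k; rewrite mxE.
have M'f : row_free M'.
  apply: inj_row_free => c; rewrite M'rl mul_mx_row => E0.
  have [E1 E2] : c *m (\matrix_(i, j) (E i).2 (B j)) = 0 /\ c *m (\matrix_(i, j) tco chi (E i).1 0 j) = 0.
    by apply: eq_row_mx; rewrite E0 row_mx0.
  by apply: (row_free_inj Mf); rewrite mul0mx Mrl mul_mx_row E1 E2 row_mx0.
have rowM i : row i M = r (E i) by apply/rowP => j; rewrite !mxE.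
have rowM' i : row i M' = r' (E i) by apply/rowP => j; rewrite !mxE.
(* Isotropy puts the rows of M into the kernel of the transpose of M'. Both spaces have dimension n,
   the kernel because M' has rank n in R^(n + n), so they coincide. *)
have MM' : (M <= kermx M'^T)%MS.
  apply/sub_kermxP/matrixP => i j; rewrite [RHS]mxE -(EE i j) pE // -rowM -rowM'.
  by rewrite !mxE; apply: eq_bigr => k _; rewrite !mxE.
have kM : (kermx M'^T <= M)%MS.
  have := mxrank_leqif_sup MM' => -[_ <-].
  by rewrite mxrank_ker mxrank_tr (eqP M'f) (eqP Mf) addnK.
have /submxP [c Ec] : (r e <= M)%MS.
  apply: submx_trans kM; apply/sub_kermxP/rowP => j; rewrite [RHS]mxE -(eE j) pE //.
  by rewrite -rowM' !mxE; apply: eq_bigr => k _; rewrite !mxE.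
exists (fun i => c 0 i); apply: geqr => //; first exact: fcomb.
by rewrite [RHS]rcomb Ec.
Qed.

End TangentAlgebra.

(** * Linear systems with smooth coefficients *)

Section SmoothSolve.
Context {R : realType} (M : smooth_space R).
Hypotheses (cM : smclosed M) (scM : smcontinuous M).

(* The denominator is modified by a cutoff so that it vanishes nowhere. *)
Lemma smf_inverse_germ (f : M -> R) (x : M) : smfun M f -> f x = 1 ->
  exists2 h, smfun M h & \forall y \near x, h y * f y = 1.
Proof.
(* As [cut1] is bounded by 2, d is at least 1/2 everywhere; it is the identity where |t - 1| <=
   1/4. *)
move=> sf fx; pose d (t : R) := 1 + 4^-1 * cut1 (4 * (t - 1)).
have d0 t : d t != 0.
  have := cut1_le2 (4 * (t - 1)); rewrite ler_norml => /andP[c1 c2].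
  rewrite gt_eqF // /d; lra.
have Cd : Cinfty (fun z : 'rV[R]_1 => (d (z 0 0))^-1).
  move=> k; apply: Cr_inv => //; apply: Cr_add; first exact: Cr_cst.
  apply: Cr_mul; first exact: Cr_cst.
  apply: (@smooth1_cut1 R 1 k (fun z => 4 * (z 0 0 - 1))).
  by apply: Cr_mul; [exact: Cr_cst|apply: Cr_add; [exact: Cr_coord|exact: Cr_cst]].
exists (fun y => (d (f y))^-1).
  have -> : (fun y => (d (f y))^-1) = (fun y => (d (((f y)%:M : 'rV[R]_1) 0 0))^-1).
    by apply/funext => y; rewrite mxE.
  apply: (smf_comp cM (a := fun y => ((f y)%:M : 'rV[R]_1)) Cd) => i.
  by under eq_fun do rewrite mxE (ord1 i) eqxx mulr1n.
have cf : continuous (fun y => `|4 * (f y - 1)|).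
  apply: continuous_norm; apply: continuous_mul; first exact: cst_continuous.
  by apply: continuous_sub; [exact: scM|exact: cst_continuous].
have := near_lt (x := x) (c := 1) cf; rewrite fx subrr mulr0 normr0 => /(_ ltr01).
apply: filterS => y /ltW fy.
have -> : d (f y) = f y by rewrite /d cut1_id // mulKf ?pnatr_eq0 // addrC subrK.
apply: mulVf; apply/eqP => fy0; move: fy; rewrite fy0 sub0r mulrN1 normrN normr_nat.
by rewrite leNgt ltr1n.
Qed.

Lemma smf_det m (A : M -> 'M[R]_m) :
  (forall i j, smfun M (fun y => A y i j)) -> smfun M (fun y => \det (A y)).
Proof.
move=> HA; apply: smf_sum => // s; apply: smf_mul => //; first exact: smf_cst.
by apply: smf_prod => // i; exact: HA.
Qed.

Lemma smf_mulmx m p q (A : M -> 'M[R]_(m, p)) (B : M -> 'M[R]_(p, q)) :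
  (forall i j, smfun M (fun y => A y i j)) -> (forall i j, smfun M (fun y => B y i j)) ->
  forall i j, smfun M (fun y => (A y *m B y) i j).
Proof.
move=> HA HB i j; under eq_fun do rewrite mxE.
by apply: smf_sum => // k; exact: smf_mul.
Qed.

Lemma smf_invmx_germ m (A : M -> 'M[R]_m) (x : M) :
  (forall i j, smfun M (fun y => A y i j)) -> A x = 1%:M ->
  exists B : M -> 'M[R]_m, (forall i j, smfun M (fun y => B y i j)) /\
    \forall y \near x, A y *m B y = 1%:M.
Proof.
move=> HA Ax; have sd := smf_det HA.
have [h sh Hh] : exists2 h, smfun M h & \forall y \near x, h y * \det (A y) = 1.
  by apply: smf_inverse_germ => //; rewrite Ax det1.
exists (fun y => h y *: \adj (A y)); split.
  move=> i j; under eq_fun do rewrite !mxE.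
  apply: smf_mul => //; apply: smf_mul => //; first exact: smf_cst.
  by apply: smf_det => a b; under eq_fun do rewrite !mxE; exact: HA.
by apply: filterS Hh => y E; rewrite -scalemxAr mul_mx_adj scale_scalar_mx E.
Qed.

(** With Q a right inverse of A at x, kept constant, A Q is square and equal to 1 at x, hence
    invertible nearby. Only uniqueness with a smooth candidate is concluded: the system may be
    overdetermined, and solvability must come from elsewhere. *)
Lemma smooth_solve_inj m q (A : M -> 'M[R]_(m, q)) (b : M -> 'rV[R]_q) (x : M) :
  (forall i j, smfun M (fun y => A y i j)) -> (forall j, smfun M (fun y => b y 0 j)) ->
  row_free (A x) ->
  exists w : M -> 'rV[R]_m, (forall j, smfun M (fun y => w y 0 j)) /\
    \forall y \near x, forall w', w' *m A y = b y -> w' = w y.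
Proof.
move=> HA Hb Af; pose Q := pinvmx (A x).
have sQ i j : smfun M (fun=> Q i j) by exact: smf_cst.
have sb i j : smfun M (fun y => b y i j) by rewrite (ord1 i).
have sD := smf_mulmx HA sQ.
have D1 : A x *m Q = 1%:M by exact: mulmxVp.
have [B [sB N]] := smf_invmx_germ sD D1.
exists (fun y => b y *m Q *m B y); split.
  by move=> j; exact: (smf_mulmx (smf_mulmx sb sQ) sB).
by apply: filterS N => y AB w' <-; rewrite -2!mulmxA [_ *m (Q *m _)]mulmxA AB mulmx1.
Qed.

Lemma smooth_solve_surj m q (A : M -> 'M[R]_(m, q)) (b : M -> 'rV[R]_q) (x : M) :
  (forall i j, smfun M (fun y => A y i j)) -> (forall j, smfun M (fun y => b y 0 j)) ->
  row_full (A x) ->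
  exists w : M -> 'rV[R]_m, (forall j, smfun M (fun y => w y 0 j)) /\
    \forall y \near x, w y *m A y = b y.
Proof.
move=> HA Hb Af; pose Q := pinvmx (A x).
have sQ i j : smfun M (fun=> Q i j) by exact: smf_cst.
have sb i j : smfun M (fun y => b y i j) by rewrite (ord1 i).
have sD := smf_mulmx sQ HA.
have D1 : Q *m A x = 1%:M by exact: mulVpmx.
have [B [sB N]] := smf_invmx_germ sD D1.
exists (fun y => b y *m B y *m Q); split.
  by move=> j; exact: (smf_mulmx (smf_mulmx sb sB) sQ).
by apply: filterS N => y /mulmx1C BA; rewrite -2!mulmxA BA mulmx1.
Qed.

End SmoothSolve.

(** Relatedness is required near x only, because the lifts of fields used later are correct only as
    germs at a unit. *)
Lemma related_bracket {R : realType} n (M N : smooth_space R) (f : M -> N) (x : M)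
    (U1 U2 : vfield M) (X1 X2 : vfield N) :
  manifold n M -> smclosed N -> smooth_map f ->
  is_field U1 -> is_field U2 -> is_field X1 -> is_field X2 ->
  (\forall y \near x, tmap f (U1 y) = X1 (f y)) ->
  (\forall y \near x, tmap f (U2 y) = X2 (f y)) ->
  tmap f (fbracket U1 U2 x) = fbracket X1 X2 (f x).
Proof.
move=> mM cN sf fU1 fU2 fX1 fX2 N1 N2; have cM := manifold_smclosed mM.
have K (U U' : vfield M) (X X' : vfield N) h : is_field U -> is_field U' -> is_field X' ->
    smfun N h -> tmap f (U x) = X (f x) -> (\forall y \near x, tmap f (U' y) = X' (f y)) ->
    U x (fun y => U' y (h \o f)) = X (f x) (fun y => X' y h).
  move=> [tU _] [_ sU'] [_ sX'] sh EU N'.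
  rewrite -EU tmapE; last exact: sX'.
  apply: (tangent_local mM (tU x)); [exact: sU' (sf _ sh)|exact: sf (sX' _ sh)|].
  by apply: filterS N' => y E; rewrite /= -E tmapE.
apply: (@tangent_ext _ _ (f x)).
- by apply: tangent_tmap => //; apply: (proj1 (field_bracket cM fU1 fU2)).
- exact: (proj1 (field_bracket cN fX1 fX2)).
move=> h sh; rewrite tmapE // /fbracket.
rewrite (K U1 U2 X1 X2) // ?(nbhs_singleton N1) //.
by rewrite (K U2 U1 X2 X1) // (nbhs_singleton N2).
Qed.

(** * Lie groupoids *)

Section LieGroupoid.
Context {R : realType} (nH nN k : nat) (H N : smooth_space R) (G : groupoid H N).
Hypotheses (lG : lie_groupoid nH nN G) (dim : nH = (nN + k)%N).

Let mH : manifold nH H. Proof. by case: lG. Qed.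
Let mN : manifold nN N. Proof. by case: lG. Qed.
Let cH : smclosed H. Proof. exact: manifold_smclosed mH. Qed.
Let cN : smclosed N. Proof. exact: manifold_smclosed mN. Qed.
Let scH : smcontinuous H. Proof. exact: diffeo_smcontinuous mH. Qed.
Let scN : smcontinuous N. Proof. exact: diffeo_smcontinuous mN. Qed.
Let bS : submersion (gs G). Proof. by case: lG. Qed.
Let bT : submersion (gt G). Proof. by case: lG. Qed.
Let sS : smooth_map (gs G). Proof. by case: bS. Qed.
Let sT : smooth_map (gt G). Proof. by case: bT. Qed.
Let sM : smooth_map (@cmul R H N G). Proof. by case: lG => _ _ _ _ []. Qed.
Let sE : smooth_map (ge G). Proof. by case: lG => _ _ _ _ []. Qed.
Let s1 : smooth_map (@cpr1 R H N G). Proof. exact: (@smooth_fpr1 R H H N (gs G) (gt G)). Qed.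
Let s2 : smooth_map (@cpr2 R H N G). Proof. exact: (@smooth_fpr2 R H H N (gs G) (gt G)). Qed.
Let ctT : continuous (gt G). Proof. exact: (smooth_continuous scH mN sT). Qed.
Lemma cprE (p : composable G) : gs G (cpr1 p) = gt G (cpr2 p).
Proof. exact: (@fiber_productE R H H N (gs G) (gt G) p). Qed.

Definition cmk (g h : H) (e : gs G g = gt G h) : composable G :=
  @fmk R H H N (gs G) (gt G) g h e.

Lemma composable_transverse : transverse (gs G) (gt G).
Proof.
move=> g h e w tw; have [_ /(_ g w tw) [u tu E]] := bS.
by exists u, 0; split=> //; [exact: tangent0|rewrite E tmap0 addr0].
Qed.

Let cdim : (nH + nH = nN + (k + nH))%N.
Proof. by rewrite {1}dim addnA. Qed.

Lemma composable_manifold : manifold (k + nH) (composable G).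
Proof. exact: (fiber_manifold mH mH mN sS sT composable_transverse cdim). Qed.

Lemma composable_tangent (p : composable G) u v :
  tangent (cpr1 p) u -> tangent (cpr2 p) v -> tmap (gs G) u = tmap (gt G) v ->
  exists w, [/\ tangent p w, tmap (@cpr1 R H N G) w = u & tmap (@cpr2 R H N G) w = v].
Proof. exact: (fiber_tangent mH mH mN sS sT composable_transverse cdim). Qed.

Lemma composable_tangent_inj (p : composable G) w w' : tangent p w -> tangent p w' ->
  tmap (@cpr1 R H N G) w = tmap (@cpr1 R H N G) w' ->
  tmap (@cpr2 R H N G) w = tmap (@cpr2 R H N G) w' -> w = w'.
Proof. exact: (fiber_tangent_inj mH mH mN sS sT composable_transverse cdim). Qed.

Lemma smooth_to_composable (M : smooth_space R) (h : M -> composable G) : smclosed M ->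
  smcontinuous M -> smooth_map (fun t => cpr1 (h t)) -> smooth_map (fun t => cpr2 (h t)) ->
  smooth_map h.
Proof.
move=> cM scM h1 h2.
apply: (@smooth_to_fiber R H H N (gs G) (gt G) M h cM) => //.
  exact: (smooth_continuous scM mH h1).
exact: (smooth_continuous scM mH h2).
Qed.

Definition right_unit (g : H) : composable G := cmk (esym (gt_e G (gs G g))).
Definition left_unit (g : H) : composable G := cmk (gs_e G (gt G g)).

Lemma smooth_right_unit : smooth_map right_unit.
Proof.
exact: (smooth_to_composable (h := right_unit) cH scH (@smooth_id _ H) (smooth_comp sE sS)).
Qed.

Lemma smooth_left_unit : smooth_map left_unit.
Proof.
exact: (smooth_to_composable (h := left_unit) cH scH (smooth_comp sE sT) (@smooth_id _ H)).
Qed.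

Lemma tmap_right_unit g u : tangent g u ->
  [/\ tangent (right_unit g) (tmap right_unit u),
    tmap (@cpr1 R H N G) (tmap right_unit u) = u,
    tmap (@cpr2 R H N G) (tmap right_unit u) = tmap (ge G) (tmap (gs G) u) &
    tmap (@cmul R H N G) (tmap right_unit u) = u].
Proof.
move=> tu; have cC := @fiber_smclosed R H H N (gs G) (gt G).
split; first exact: (tangent_tmap cC smooth_right_unit tu).
- by rewrite tmap_tmap //; exact: (tmap_id tu).
- by rewrite !tmap_tmap.
- rewrite tmap_tmap // -{2}(tmap_id tu); congr (tmap _ u).
  by apply/funext => h; exact: gm_er.
Qed.

Lemma tmap_left_unit g u : tangent g u ->
  [/\ tangent (left_unit g) (tmap left_unit u),
    tmap (@cpr1 R H N G) (tmap left_unit u) = tmap (ge G) (tmap (gt G) u),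
    tmap (@cpr2 R H N G) (tmap left_unit u) = u &
    tmap (@cmul R H N G) (tmap left_unit u) = u].
Proof.
move=> tu; have cC := @fiber_smclosed R H H N (gs G) (gt G).
split; first exact: (tangent_tmap cC smooth_left_unit tu).
- by rewrite !tmap_tmap.
- by rewrite tmap_tmap //; exact: (tmap_id tu).
- rewrite tmap_tmap // -{2}(tmap_id tu); congr (tmap _ u).
  by apply/funext => h; exact: gm_el.
Qed.

Lemma left_unit_e x : left_unit (ge G x) = right_unit (ge G x).
Proof.
apply: (@fiber_product_eq R H H N (gs G) (gt G)).
  by rewrite -[LHS]/(ge G (gt G (ge G x))) gt_e.
by rewrite -[RHS]/(ge G (gs G (ge G x))) gs_e.
Qed.

Lemma tmap_gs_ge x v : tangent x v -> tmap (gs G) (tmap (ge G) v) = v.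
Proof.
move=> tv; rewrite tmap_tmap // -{2}(tmap_id tv); congr (tmap _ v).
by apply/funext => y; exact: gs_e.
Qed.

Lemma tmap_gs_cmul (p : composable G) w : tangent p w ->
  tmap (gs G) (tmap (@cmul R H N G) w) = tmap (gs G) (tmap (@cpr2 R H N G) w).
Proof.
move=> tw; rewrite !tmap_tmap //; congr (tmap _ w).
by apply/funext => q; rewrite /cmul gs_m // cprE.
Qed.

Lemma tmap_gt_cmul (p : composable G) w : tangent p w ->
  tmap (gt G) (tmap (@cmul R H N G) w) = tmap (gt G) (tmap (@cpr1 R H N G) w).
Proof.
move=> tw; rewrite !tmap_tmap //; congr (tmap _ w).
by apply/funext => q; rewrite /cmul gt_m // cprE.
Qed.

(** The pair (a, 0) is tangent to the composable pairs because T s a = 0. The vector w is exposed,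
    and not only its image under the multiplication, since multiplicativity of a form is evaluated
    on w. *)
Lemma right_translate g a : algebroid G (gt G g) a ->
  exists w, [/\ tangent (left_unit g) w, tmap (@cpr1 R H N G) w = a,
    tmap (@cpr2 R H N G) w = 0 & tangent g (tmap (@cmul R H N G) w)].
Proof.
move=> [ta sa]; have [|w [tw w1 w2]] := @composable_tangent (left_unit g) a 0 ta (tangent0 g).
  by rewrite sa tmap0.
exists w; split=> //; have := tangent_tmap cH sM tw.
by rewrite -[cmul _]/(gm G (ge G (gt G g)) g) gm_el.
Qed.

Lemma algebroid_lin x (c : R) u v : algebroid G x u -> algebroid G x v ->
  algebroid G x (c *: u + v).
Proof.
move=> [tu su] [tv sv]; split; first exact: tangent_lin.
by rewrite tmap_lin su sv scaler0 addr0.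
Qed.

Lemma algebroid_sum x I (r : seq I) (c : I -> R) (u : I -> tvec H) :
  (forall i, algebroid G x (u i)) -> algebroid G x (\sum_(i <- r) c i *: u i).
Proof.
move=> au; elim/big_rec: _ => [|i v _ av]; first by split; [exact: tangent0|exact: tmap0].
exact: algebroid_lin.
Qed.

Lemma covector_lambda (w : form2 H) x a : is_form2 w -> algebroid G x a ->
  covector x (lambda G w x a).
Proof.
move=> [w1 _ _ _] [ta _] c u v tu tv.
rewrite /lambda tmap_lin; apply: w1 => //; exact: tangent_tmap.
Qed.

(* Evaluates the defect of multiplicativity [C] of [w] on the vectors (a, 0) and
   (1 (T t v), v) at a pair of units, whose products are [a] and [v]. *)
Lemma unit_form (w : form2 H) (C : form2 (composable G)) x a v : is_form2 w ->
  (forall (p : composable G) u v, tangent p u -> tangent p v ->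
     pull2 (@cpr1 R H N G) w p u v + pull2 (@cpr2 R H N G) w p u v
     - pull2 (@cmul R H N G) w p u v = C p u v) ->
  algebroid G x a -> tangent (ge G x) v ->
  w (ge G x) a v = lambda G w x a (tmap (gt G) v)
    - C (right_unit (ge G x)) (tmap right_unit a) (tmap left_unit v).
Proof.
move=> fw Cw [ta sa] tv; have [tr r1 r2 r3] := tmap_right_unit ta.
have [tl l1 l2 l3] := tmap_left_unit tv.
rewrite left_unit_e in tl.
have := Cw _ _ _ tr tl; rewrite /pull2 r1 r2 r3 l1 l2 l3 sa tmap0.
rewrite -[cpr1 _]/(ge G x) -[cpr2 _]/(ge G (gs G (ge G x))) -[cmul _]/(gm G (ge G x) (ge G (gs G (ge G x)))).
rewrite gm_er gs_e.
have [_ w2 _ _] := fw; rewrite (covector0 (w2 _ _ tv)) addr0 /lambda => <-; ring.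
Qed.

(** Along the units, [pr] = id - T(e s) projects onto ker T s. Applied to constant combinations of a
    local frame of H it yields smooth sections that restrict at x to a given basis of the kernel. *)
Lemma algebroid_frame (x : N) : exists u : 'I_k -> N -> tvec H,
  [/\ forall i y, algebroid G y (u i y),
      forall i g, smfun H g -> smfun N (fun y => u i y g) &
      \forall y \near x, independent (u^~ y)].
Proof.
have [chi [U [schi fU NU]]] := local_frame (ge G x) mH.
have [u0 [tu0 su0 iu0]] := kernel_basis (ge G x) mH mN bS dim.
have spU := proj2 (nbhs_singleton NU).
pose K i b := tco chi (u0 i) 0 b.
pose pr v : tvec H := v - tmap (ge G) (tmap (gs G) v).
have prA y v : tangent (ge G y) v -> algebroid G y (pr v).
  move=> tv; have tsv := tangent_tmap cN sS tv.
  split; last by rewrite tmapB (tmap_gs_ge tsv) subrr.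
  apply: tangent_sub => //.
  by have := tangent_tmap cH sE tsv; rewrite gs_e.
pose u i y := \sum_b K i b *: pr (U b (ge G y)).
have Ag i y : algebroid G y (u i y).
  by apply: algebroid_sum => b; apply: prA; case: (fU b).
have su i g : smfun H g -> smfun N (fun y => u i y g).
  move=> sg; rewrite /u; under eq_fun do rewrite tvec_sumE.
  apply: (smf_sum cN) => b; apply: (smf_scale cN).
  have sUg h : smfun H h -> smfun N (fun y => U b (ge G y) h).
    by move=> sh; have [_ /(_ h sh)] := fU b; exact: sE.
  have -> : (fun y => pr (U b (ge G y)) g) =
     (fun y => U b (ge G y) g - U b (ge G y) (g \o ge G \o gs G)).
    apply/funext => y; rewrite /pr -[LHS]/(_ - _); congr (_ - _).
    by rewrite !tmapE //; exact: sE.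
  by apply: (smf_sub cN); apply: sUg => //; exact: sS (sE sg).
exists u; split=> //.
pose A y := \matrix_(i, j) tco chi (u i y) 0 j.
have ux i : u i x = u0 i.
  rewrite [RHS](spU _ (tu0 i)) /u /pr.
  under eq_bigr do rewrite scalerBr.
  rewrite sumrB -[RHS]subr0; congr (_ - _).
  transitivity (tmap (ge G) (tmap (gs G) (\sum_b K i b *: U b (ge G x)))).
    by rewrite !tmap_sum; apply: eq_bigr => b _; rewrite !tmapZ.
  by rewrite -(spU _ (tu0 i)) su0 tmap0.
have Af : row_free (A x).
  apply: (independent_row_free spU) => [i|]; first by rewrite ux.
  by move=> c E; apply: iu0; rewrite -[RHS]E; apply: eq_bigr => i _; rewrite ux.
have sA i j : smfun N (fun y => A y i j).
  by under eq_fun do rewrite !mxE; exact: su.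
(* Uniqueness of solutions for the right-hand side 0 is linear independence of the rows near x. *)
have [w [_ Nw]] := smooth_solve_inj cN scN (b := fun=> 0) sA
  (fun j => smf_cst cN ((0 : 'rV[R]_nH) 0 j)) Af.
apply: filterS Nw => y W c E i.
have W0 : 0 = w y by apply: W; rewrite mul0mx.
have : \row_i c i = w y.
  apply: W; rewrite -tco_rows; under eq_bigr do rewrite mxE.
  by rewrite E; apply/rowP => j; rewrite !mxE.
by rewrite -W0 => /rowP /(_ i); rewrite !mxE.
Qed.

(** Supplies the third argument in d w = 0: a covector identity on N is tested on Z, and upstairs on
    V. Since T t is surjective, its matrix in local frames is [row_full] at the unit, and the
    equation is solved smoothly nearby. *)
Lemma lift_field (x : N) (Z : vfield N) : is_field Z ->
  exists2 V : vfield H, is_field V &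
    \forall g \near ge G x, tmap (gt G) (V g) = Z (gt G g).
Proof.
move=> [tZ sZ]; have [chi [U [schi fU NU]]] := local_frame (ge G x) mH.
have [zeta [UN [szeta fUN NN]]] := local_frame x mN.
have tT g u : tangent g u -> tangent (gt G g) (tmap (gt G) u) by exact: tangent_tmap.
pose A g := \matrix_(b, j) tco zeta (tmap (gt G) (U b g)) 0 j.
have sA i j : smfun H (fun g => A g i j).
  under eq_fun do rewrite !mxE tmapE //.
  by have [_ s] := fU i; apply: s; exact: sT.
have Af : row_full (A (ge G x)).
  rewrite -sub1mx; apply/row_subP => i.
  have [_ /(_ (ge G x) (UN i (gt G (ge G x)))) surj] := bT.
  have [|v tv Ev] := surj; first by case: (fUN i).
  have [NN1 _] := nbhs_singleton NN.
  have -> : row i 1%:M = tco zeta (tmap (gt G) v).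
    by rewrite Ev gt_e NN1 row1.
  have [_ spU] := nbhs_singleton NU.
  rewrite (spU v tv) tmap_sum.
  have -> : \sum_j tmap (gt G) (tco chi v 0 j *: U j (ge G x)) =
    \sum_j tco chi v 0 j *: tmap (gt G) (U j (ge G x)).
    by apply: eq_bigr => j _; rewrite tmapZ.
  by rewrite tco_rows; exact: submxMl.
have sb j : smfun H (fun g => tco zeta (Z (gt G g)) 0 j).
  by under eq_fun do rewrite !mxE; exact: sT (sZ _ (szeta j)).
have [w [sw Nw]] := smooth_solve_surj cH scH (b := fun g => tco zeta (Z (gt G g))) sA sb Af.
exists (fun g => \sum_b w g 0 b *: U b g); first exact: (field_sum _ cH sw fU).
have NN' : \forall g \near ge G x, forall v, tangent (gt G g) v ->
    v = \sum_i tco zeta v 0 i *: UN i (gt G g).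
  apply: (near_comp (g := gt G) (P := fun y => forall v, tangent y v ->
    v = \sum_i tco zeta v 0 i *: UN i y)); first exact: ctT.
  by rewrite gt_e; apply: filterS NN => y [].
near=> g; have W : w g *m A g = tco zeta (Z (gt G g)) by near: g.
have sp : forall v, tangent (gt G g) v -> v = \sum_i tco zeta v 0 i *: UN i (gt G g) by near: g.
apply: (tco_inj sp) => //.
  by apply: tT; apply: tangent_sum => b; apply: tangent_scale; case: (fU b).
rewrite -W /A -tco_rows tmap_sum; congr tco.
by apply: eq_bigr => b _; rewrite tmapZ.
Unshelve. all: by end_near. Qed.

End LieGroupoid.

(** * The Dirac structure of a quasi-symplectic groupoid *)

Section QuasiSymplectic.
Context {R : realType} (n : nat) (H N : smooth_space R) (G : groupoid H N) (w : form2 H).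
Hypothesis qs : quasi_symplectic_groupoid n G w.

Let lG : lie_groupoid (2 * n)%N n G. Proof. by case: qs. Qed.
Let dim : (2 * n = n + n)%N. Proof. by rewrite mul2n addnn. Qed.
Let fw : is_form2 w. Proof. by case: qs. Qed.
Let mH : manifold (2 * n) H. Proof. by case: lG. Qed.
Let mN : manifold n N. Proof. by case: lG. Qed.
Let cH : smclosed H. Proof. exact: manifold_smclosed mH. Qed.
Let cN : smclosed N. Proof. exact: manifold_smclosed mN. Qed.
Let scH : smcontinuous H. Proof. exact: diffeo_smcontinuous mH. Qed.
Let scN : smcontinuous N. Proof. exact: diffeo_smcontinuous mN. Qed.
Let sS : smooth_map (gs G). Proof. by case: lG => _ _ []. Qed.
Let bT : submersion (gt G). Proof. by case: lG. Qed.
Let sT : smooth_map (gt G). Proof. by case: bT. Qed.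
Let sE : smooth_map (ge G). Proof. by case: lG => _ _ _ _ []. Qed.
Let ctT : continuous (gt G). Proof. exact: (smooth_continuous scH mN sT). Qed.
Let ctE : continuous (ge G). Proof. exact: (smooth_continuous scN mH sE). Qed.
Local Notation lam := (lambda G w).

Let mult (p : composable G) u v : tangent p u -> tangent p v ->
  pull2 (@cpr1 R H N G) w p u v + pull2 (@cpr2 R H N G) w p u v
  - pull2 (@cmul R H N G) w p u v = @zero_form2 R (composable G) p u v.
Proof.
by move=> tu tv; case: qs => _ _ _ M _; rewrite (M p u v tu tv) subrr.
Qed.

Let unit_formE x a v : algebroid G x a -> tangent (ge G x) v ->
  w (ge G x) a v = lam x a (tmap (gt G) v).
Proof. by move=> aa tv; rewrite (unit_form lG fw mult aa tv) subr0. Qed.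

Let nondeg x a : algebroid G x a -> tmap (gt G) a = 0 ->
  (forall v, tangent (ge G x) v -> w (ge G x) a v = 0) -> a = 0.
Proof. by move=> [ta sa] Ta wa; case: qs => _ _ _ _; apply; eauto. Qed.

Let isotropic x a b : algebroid G x a -> algebroid G x b ->
  lam x a (tmap (gt G) b) + lam x b (tmap (gt G) a) = 0.
Proof.
move=> aa ab; have [ta _] := aa; have [tb _] := ab.
rewrite -(unit_formE aa tb) -(unit_formE ab ta).
by rewrite (form2_anti fw ta tb) addNr.
Qed.

Let tTe x a : algebroid G x a -> tangent x (tmap (gt G) a).
Proof. by move=> [ta _]; have := tangent_tmap cN sT ta; rewrite gt_e. Qed.

(* [u] is the right translate of [a] to [g]. *)
Let translate_form g a : algebroid G (gt G g) a -> exists2 u, tangent g u &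
  [/\ tmap (gs G) u = 0, tmap (gt G) u = tmap (gt G) a &
    forall v, tangent g v -> w g u v = lam (gt G g) a (tmap (gt G) v)].
Proof.
move=> aa; have [z [tz z1 z2 tm]] := right_translate lG dim aa.
exists (tmap (@cmul R H N G) z) => //; split.
- by rewrite (tmap_gs_cmul lG tz) z2 tmap0.
- by rewrite (tmap_gt_cmul lG tz) z1.
move=> v tv; have [tl l1 l2 l3] := tmap_left_unit lG tv.
have := mult tz tl; rewrite /pull2 z1 z2 l1 l2 l3.
rewrite -[cpr1 _]/(ge G (gt G g)) -[cpr2 _]/g -[cmul _]/(gm G (ge G (gt G g)) g) gm_el.
have [_ w2 _ _] := fw; rewrite (covector0 (w2 _ _ tv)) addr0 /lambda => /eqP.
by rewrite subr_eq0 => /eqP ->.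
Qed.

Let lam_sum x I (r : seq I) (c : I -> R) (u : I -> tvec H) v :
  (forall i, algebroid G x (u i)) -> tangent x v ->
  lam x (\sum_(i <- r) c i *: u i) v = \sum_(i <- r) c i * lam x (u i) v.
Proof.
move=> au tv; have [_ w2 _ _] := fw.
have tev := tangent_tmap cH sE tv.
exact: (@covector_sum _ _ _ (fun z => w (ge G x) z _) _ r c u (w2 _ _ tev) (fun i => proj1 (au i))).
Qed.

Let tcovec_sumE I (r : seq I) (c : I -> R) (a : I -> tcovec N) v :
  (\sum_(i <- r) c i *: a i) v = \sum_(i <- r) c i * a i v.
Proof.
elim: r => [|i r IH]; first by rewrite !big_nil.
by rewrite !big_cons -IH.
Qed.

Let elt (u : N -> tvec H) y : gvec N := (tmap (gt G) (u y), lam y (u y)).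

Let elt_section (u : N -> tvec H) : (forall y, algebroid G y (u y)) ->
  (forall g, smfun H g -> smfun N (fun y => u y g)) -> gsection (elt u).
Proof.
move=> au su; split.
  split=> [x|f sf] /=; first exact: tTe.
  by under eq_fun do rewrite tmapE //; apply: su; exact: sT.
split=> [x|X [tX sX]] /=; first exact: (covector_lambda lG fw (au x)).
apply: (form2_along (f := ge G) mH fw cN ctE sE (U := u) (V := fun y => tmap (ge G) (X y))) => //.
- by move=> y; case: (au y).
- by move=> y; exact: tangent_tmap.
- by move=> g sg; under eq_fun do rewrite tmapE //; apply: sX; exact: sE.
Qed.

Let elt_sum x (c : 'I_n -> R) (u : 'I_n -> N -> tvec H) :
  (forall i y, algebroid G y (u i y)) ->
  let a := \sum_i c i *: u i x in
  tmap (gt G) a = \sum_i c i *: (elt (u i) x).1 /\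
  forall v, tangent x v -> lam x a v = (\sum_i c i *: (elt (u i) x).2) v.
Proof.
move=> au a; split; first by rewrite tmap_sum; apply: eq_bigr => i _; rewrite tmapZ.
by move=> v tv; rewrite lam_sum // tcovec_sumE.
Qed.

(** Nondegeneracy at the units makes a |-> (T t a, lambda a) injective on the algebroid, so a local
    frame of the algebroid, which has rank n, is carried to a local frame of the Dirac structure. *)
Let dirac_fiber_frame (x : N) : exists u : 'I_n -> N -> tvec H,
  [/\ forall i y, algebroid G y (u i y), forall i, gsection (elt (u i)) &
    \forall y \near x,
      (forall c : 'I_n -> R,
         Defs.geq y (\sum_i c i *: (elt (u i) y).1, \sum_i c i *: (elt (u i) y).2) (0, 0) ->
         forall i, c i = 0) /\
      (forall e, groupoid_dirac G w y e <-> gfiber y e /\ exists c : 'I_n -> R,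
         Defs.geq y e (\sum_i c i *: (elt (u i) y).1, \sum_i c i *: (elt (u i) y).2))].
Proof.
have [u [au su iu]] := algebroid_frame lG dim x.
exists u; split=> [//|i|]; first exact: (elt_section (au i) (su i)).
have bS : submersion (gs G) by case: lG.
apply: filterS iu => y iu; split=> [c [/= E1 E2]|e].
  have [S1 S2] := elt_sum y c au; apply: iu.
  have aa : algebroid G y (\sum_i c i *: u i y) by exact: algebroid_sum.
  apply: (nondeg aa); first by rewrite S1.
  move=> v tv; rewrite unit_formE // S2 ?E2 //;
    by have := tangent_tmap cN sT tv; rewrite gt_e.
split=> [[fe [a aa [e1 e2]]]|[fe [c [e1 e2]]]]; split=> //.
  have [ta sa] := aa.
  have [c Ec] := kernel_span mH mN bS dim (fun i => proj1 (au i y)) (fun i => proj2 (au i y)) iu ta sa.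
  have [S1 S2] := elt_sum y c au.
  exists c; split=> /=; first by rewrite e1 -S1 -Ec.
  by move=> v tv; rewrite e2 // -S2 // -Ec.
have [S1 S2] := elt_sum y c au.
exists (\sum_i c i *: u i y); first exact: algebroid_sum.
by split=> /=; [rewrite e1 -S1|move=> v tv; rewrite (e2 v tv) (S2 v tv)].
Qed.

Let dirac_lagrangian x e : gfiber x e ->
  (groupoid_dirac G w x e <-> forall e', groupoid_dirac G w x e' -> gpairing e e' = 0).
Proof.
move=> fe; split=> [[_ [a aa [e1 e2]]] e' [fe' [b ab [e1' e2']]]|He].
  rewrite /gpairing e2; last by case: fe'.
  by rewrite e2' ?e1 ?e1'; [exact: isotropic|exact: tTe].
have [u [au su /nbhs_singleton [iE LE]]] := dirac_fiber_frame x.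
have Lu i : groupoid_dirac G w x (elt (u i) x).
  split; first by split=> /=; [exact: tTe|exact: (covector_lambda lG fw)].
  by exists (u i x).
apply/LE; split=> //; apply: (lagrangian_span (E := fun i => elt (u i) x) mN) => //.
- by move=> i; case: (Lu i).
- by move=> i j; rewrite /gpairing /elt /=; exact: isotropic.
- by move=> i; exact: He.
Qed.

(* At [ge G x] the equations for [U] determine it by nondegeneracy; right
   translation shows that they remain solvable nearby, so the solution is smooth. *)
Let lift_section (x : N) (E : N -> gvec N) : gsection E ->
  (forall y, groupoid_dirac G w y (E y)) ->
  exists2 U : vfield H, is_field U & \forall g \near ge G x,
    [/\ tmap (gs G) (U g) = 0, tmap (gt G) (U g) = (E (gt G g)).1 &
      forall v, tangent g v -> w g (U g) v = (E (gt G g)).2 (tmap (gt G) v)].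
Proof.
move=> [[tX sX] fa] LE; have [chi [U [schi fU NU]]] := local_frame (ge G x) mH.
have [zeta [B [szeta tB cB spB]]] := tangent_basis x mN.
have [w1 w2 w3 w4] := fw.
have tU b g : tangent g (U b g) by case: (fU b).
have tTU b g : tangent (gt G g) (tmap (gt G) (U b g)) by exact: tangent_tmap.
have srow m p q (C : H -> 'M[R]_(m, p)) (C' : H -> 'M[R]_(m, q)) :
    (forall i j, smfun H (fun g => C g i j)) -> (forall i j, smfun H (fun g => C' g i j)) ->
    forall i j, smfun H (fun g => row_mx (C g) (C' g) i j).
  by move=> HC HC' i j; under eq_fun do rewrite mxE; case: (fintype.split j).
(* The matrix of u |-> (T s u, T t u, w (u, .)): 4 n equations for 2 n unknowns, injective at the
   unit by the nondegeneracy condition. *)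
pose A g := row_mx (row_mx (\matrix_(b, j) tco zeta (tmap (gs G) (U b g)) 0 j)
  (\matrix_(b, j) tco zeta (tmap (gt G) (U b g)) 0 j)) (\matrix_(b, c) w g (U b g) (U c g)).
pose bb g : 'rV[R]_(n + n + 2 * n) := row_mx (row_mx 0 (tco zeta (E (gt G g)).1))
  (\row_c (E (gt G g)).2 (tmap (gt G) (U c g))).
have sA i j : smfun H (fun g => A g i j).
  apply: (srow) => [i' j'|i' j']; last by under eq_fun do rewrite mxE; exact: w4.
  by apply: (srow) => b c; under eq_fun do rewrite !mxE tmapE //;
    have [_ s] := fU b; apply: s; [exact: sS|exact: sT].
have sb j : smfun H (fun g => bb g 0 j).
  apply: (srow) => [i' j'|i' c].
    apply: (srow) => i c; first by under eq_fun do rewrite mxE; exact: smf_cst.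
    by under eq_fun do rewrite mxE; exact: sT (sX _ (szeta c)).
  under eq_fun do rewrite mxE.
  apply: (form1_along (f := gt G) mN fa cH ctT sT (U := fun g => tmap (gt G) (U c g))) => //.
  by move=> g sg; under eq_fun do rewrite tmapE //; have [_ s] := fU c; apply: s; exact: sT.
have tzero (M : smooth_space R) m (z : M -> 'rV[R]_m) : tco z (0 : tvec M) = 0 by apply/rowP => j; rewrite !mxE.
have rowE' (f : H -> N) (c : 'rV[R]_(2 * n)) g :
    c *m (\matrix_(b, j) tco zeta (tmap f (U b g)) 0 j) = tco zeta (tmap f (\sum_b c 0 b *: U b g)).
  by rewrite -tco_rows tmap_sum; congr tco; apply: eq_bigr => b _; rewrite tmapZ.
have rowW (c : 'rV[R]_(2 * n)) g :
    c *m (\matrix_(b, c) w g (U b g) (U c g)) = \row_j w g (\sum_b c 0 b *: U b g) (U j g).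
  apply/rowP => j; rewrite !mxE.
  rewrite (@covector_sum _ _ _ (fun z => w g z _) _ _ (fun b => c 0 b) _ (w2 _ _ (tU j g))) //.
  by apply: eq_bigr => b _; rewrite mxE.
have tsum (c : 'rV[R]_(2 * n)) g : tangent g (\sum_b c 0 b *: U b g).
  by apply: tangent_sum => b; exact: tangent_scale.
have Af : row_free (A (ge G x)).
  apply: inj_row_free => c; rewrite !mul_mx_row !rowE' rowW => E0.
  set u := \sum_b c 0 b *: U b (ge G x) in E0.
  have tu : tangent (ge G x) u by exact: tsum.
  have [/eq_row_mx E01 E2] : row_mx (tco zeta (tmap (gs G) u)) (tco zeta (tmap (gt G) u)) = row_mx 0 0 /\
     \row_j w (ge G x) u (U j (ge G x)) = 0.
    by apply: eq_row_mx; rewrite E0 !row_mx0.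
  have [NU1 spU] := nbhs_singleton NU.
  have su0 : tmap (gs G) u = 0.
    apply: (tco_inj spB _ (tangent0 x)); last by rewrite E01.1 tzero.
    by have := tangent_tmap cN sS tu; rewrite gs_e.
  have tu0 : tmap (gt G) u = 0.
    apply: (tco_inj spB _ (tangent0 x)); last by rewrite E01.2 tzero.
    by have := tangent_tmap cN sT tu; rewrite gt_e.
  have u0 : u = 0.
    apply: (@nondeg x) => // v tv; rewrite (spU v tv) (covector_sum _ _ (w1 _ _ tu)) //.
    rewrite big1 // => b _.
    by move/rowP: E2 => /(_ b); rewrite !mxE => ->; rewrite mulr0.
  have : tco chi u = c.
    rewrite tco_sum [RHS]row_sum_delta; apply: eq_bigr => b _.
    by rewrite tcoZ NU1.
  by rewrite u0 tzero.
have [c [sc Nc]] := smooth_solve_inj cH scH sA sb Af.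
exists (fun g => \sum_b c g 0 b *: U b g); first exact: (field_sum _ cH sc fU).
near=> g; have C : forall w', w' *m A g = bb g -> w' = c g by near: g.
have [NU1 spU] : (forall i, tco chi (U i g) = delta_mx 0 i) /\
  (forall v, tangent g v -> v = \sum_i tco chi v 0 i *: U i g) by near: g.
have [fE [a aa [e1 e2]]] := LE (gt G g).
have [u tu [su Tu wu]] := translate_form aa.
have Cg : tco chi u = c g.
  apply: C; rewrite /bb !mul_mx_row !rowE' rowW -(spU u tu) su tzero Tu e1; congr row_mx.
  by apply/rowP => j; rewrite !mxE wu // e2.
rewrite -Cg -(spU u tu); split; [exact: su|by rewrite Tu e1|].
by move=> v tv; rewrite wu // e2 //; exact: tangent_tmap.
Unshelve. all: by end_near. Qed.

Let bracket_element (x : N) (E1 E2 : N -> gvec N) : gsection E1 -> gsection E2 ->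
  (forall y, groupoid_dirac G w y (E1 y)) -> (forall y, groupoid_dirac G w y (E2 y)) ->
  let X := fun y => (E1 y).1 in let a := fun y => (E1 y).2 in
  let Y := fun y => (E2 y).1 in let b := fun y => (E2 y).2 in
  exists W, [/\ algebroid G x W, tmap (gt G) W = fbracket X Y x &
    forall Z, is_field Z -> lam x W (Z x) = lie1 X b Z x - d1 a Y Z x].
Proof.
move=> s1 s2 L1 L2 X a Y b.
have [fX fa] := s1; have [fY fb] := s2.
have [U1 fU1 N1] := lift_section x s1 L1; have [U2 fU2 N2] := lift_section x s2 L2.
set g := ge G x in N1 N2 *.
have tg : gt G g = x by exact: gt_e.
(* T s U = 0 is read as relatedness of U to the zero field, so that the bracket of two lifts is
   again in ker T s. *)
have f0 : is_field (fun _ : N => 0 : tvec N).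
  by split=> [y|f sf]; [exact: tangent0|exact: smf_cst].
have tW : tangent g (fbracket U1 U2 g) by exact: (proj1 (field_bracket cH fU1 fU2)).
have sW : tmap (gs G) (fbracket U1 U2 g) = 0.
  rewrite (related_bracket mH cN sS fU1 fU2 f0 f0).
  - by apply/funext => f; rewrite /fbracket -[RHS]/(0 : R) subrr.
  - by apply: filterS N1 => h [].
  - by apply: filterS N2 => h [].
have TW : tmap (gt G) (fbracket U1 U2 g) = fbracket X Y x.
  rewrite -tg; apply: (related_bracket mH cN sT fU1 fU2 fX fY).
  - by apply: filterS N1 => h [].
  - by apply: filterS N2 => h [].
have aW : algebroid G x (fbracket U1 U2 g) by [].
exists (fbracket U1 U2 g); split=> // Z fZ.
have [V fV NV] := lift_field lG x fZ.
have [tV _] := fV; have [tU1 _] := fU1; have [tU2 _] := fU2.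
have TV : tmap (gt G) (V g) = Z x by rewrite (nbhs_singleton NV) tg.
rewrite -TV -unit_formE //.
have [w1 w2 w3 w4] := fw.
have TU1 : tmap (gt G) (U1 g) = X x by have [_ -> _] := nbhs_singleton N1; rewrite tg.
have TU2 : tmap (gt G) (U2 g) = Y x by have [_ -> _] := nbhs_singleton N2; rewrite tg.
have loc U (h : N -> R) k : is_field U -> smfun H k -> smfun N h ->
    (\forall y \near g, k y = h (gt G y)) -> U g k = tmap (gt G) (U g) h.
  move=> [tU _] sk sh Nk; rewrite tmapE //.
  by apply: (tangent_local mH (tU g)) => //; exact: sT.
(* Near the unit w (U2, V) is the pullback by t of b (Z), so differentiating it along U1 amounts to
   differentiating b (Z) along X; likewise for the two terms that follow. *)
have E1' : U1 g (fun y => w y (U2 y) (V y)) = X x (fun y => b y (Z y)).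
  rewrite (loc U1 (fun y => b y (Z y))) ?TU1 //; first exact: w4; first by case: fb => _; apply.
  near=> y; have [_ _ ->//] : [/\ tmap (gs G) (U2 y) = 0, tmap (gt G) (U2 y) = (E2 (gt G y)).1 &
      forall v, tangent y v -> w y (U2 y) v = (E2 (gt G y)).2 (tmap (gt G) v)] by near: y.
  by rewrite (near NV y).
have E2' : U2 g (fun y => w y (U1 y) (V y)) = Y x (fun y => a y (Z y)).
  rewrite (loc U2 (fun y => a y (Z y))) ?TU2 //; first exact: w4; first by case: fa => _; apply.
  near=> y; have [_ _ ->//] : [/\ tmap (gs G) (U1 y) = 0, tmap (gt G) (U1 y) = (E1 (gt G y)).1 &
      forall v, tangent y v -> w y (U1 y) v = (E1 (gt G y)).2 (tmap (gt G) v)] by near: y.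
  by rewrite (near NV y).
have E3' : V g (fun y => w y (U1 y) (U2 y)) = Z x (fun y => a y (Y y)).
  rewrite (loc V (fun y => a y (Y y))) ?TV //; first exact: w4; first by case: fa => _; apply.
  near=> y; have [_ _ ->//] : [/\ tmap (gs G) (U1 y) = 0, tmap (gt G) (U1 y) = (E1 (gt G y)).1 &
      forall v, tangent y v -> w y (U1 y) v = (E1 (gt G y)).2 (tmap (gt G) v)] by near: y.
  by have [_ -> _] : [/\ tmap (gs G) (U2 y) = 0, tmap (gt G) (U2 y) = (E2 (gt G y)).1 &
      forall v, tangent y v -> w y (U2 y) v = (E2 (gt G y)).2 (tmap (gt G) v)] by near: y.
have br U P : is_field U -> is_field P -> (\forall y \near g, tmap (gt G) (U y) = P (gt G y)) ->
    tmap (gt G) (fbracket U V g) = fbracket P Z x.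
  move=> fU fP NP; rewrite -tg.
  by apply: (related_bracket mH cN sT fU fV fP fZ) => //; exact: NV.
have tB1 := proj1 (field_bracket cH fU1 fV) g; have tB2 := proj1 (field_bracket cH fU2 fV) g.
have E4 : w g (fbracket U1 V g) (U2 g) = - b x (fbracket X Z x).
  rewrite (form2_anti fw tB1 (tU2 g)); congr (- _).
  have [_ _ ->//] := nbhs_singleton N2; rewrite (br U1 X) ?tg //.
  by apply: filterS N1 => h [].
have E5 : w g (fbracket U2 V g) (U1 g) = - a x (fbracket Y Z x).
  rewrite (form2_anti fw tB2 (tU1 g)); congr (- _).
  have [_ _ ->//] := nbhs_singleton N1; rewrite (br U2 Y) ?tg //.
  by apply: filterS N2 => h [].
(* Of the six terms of [d2], five are now those of L_X b - i_Y (d a) evaluated on Z; the remaining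
   one is - w ([U1, U2], V). *)
have [_ _ cw _ _] := qs; have := cw U1 U2 V fU1 fU2 fV g.
rewrite /d2 E1' E2' E3' E4 E5 /lie1 /d1 => E.
apply/eqP; rewrite -subr_eq0 -oppr_eq0 -E; apply/eqP; ring.
Unshelve. all: by end_near. Qed.

Theorem quasi_symplectic_dirac : dirac_structure (groupoid_dirac G w).
Proof.
split=> [x e []//|x|x e fe|E1 E2 s1 s2 L1 L2].
- by have [u [au su iu]] := dirac_fiber_frame x; exists n, (fun i => elt (u i)).
- exact: dirac_lagrangian.
(* The lifts depend on x, so W is chosen pointwise and nothing is known about its smoothness. That
   of the covector part is read off from the Cartan formula instead. *)
have /choice [W HW] : forall x, exists W, [/\ algebroid G x W,
    tmap (gt G) W = fbracket (fun y => (E1 y).1) (fun y => (E2 y).1) x &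
    forall Z, is_field Z -> lam x W (Z x) =
      lie1 (fun y => (E1 y).1) (fun y => (E2 y).2) Z x
      - d1 (fun y => (E1 y).2) (fun y => (E2 y).1) Z x].
  by move=> x; exact: bracket_element.
have [fX fa] := s1; have [fY fb] := s2; have fXY := field_bracket cN fX fY.
exists (fun x => (fbracket (fun y => (E1 y).1) (fun y => (E2 y).1) x, lam x (W x))).
have cl x : covector x (lam x (W x)) by have [aW _ _] := HW x; exact: (covector_lambda lG fw).
split.
- split=> //; split=> // Z fZ /=.
  have -> : (fun x => lam x (W x) (Z x)) = fun x =>
      lie1 (fun y => (E1 y).1) (fun y => (E2 y).2) Z x
      - d1 (fun y => (E1 y).2) (fun y => (E2 y).1) Z x.
    by apply/funext => x; have [_ _ ->] := HW x.
  have [_ sX] := fX; have [_ sY] := fY; have [_ sZ] := fZ; have [_ sa] := fa; have [_ sb] := fb.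
  rewrite /lie1 /d1; apply: (smf_sub cN); first apply: (smf_sub cN).
  + by apply: sX; exact: sb.
  + by apply: sb; exact: (field_bracket cN fX fZ).
  apply: (smf_sub cN); first apply: (smf_sub cN).
  + by apply: sY; exact: sa.
  + by apply: sZ; exact: sa.
  + by apply: sa; exact: (field_bracket cN fY fZ).
- by split=> // Z fZ x /=; have [_ _ ->] := HW x.
- move=> x; have [aW TW lW] := HW x; split; last by exists (W x).
  by split=> //=; case: fXY.
Qed.

End QuasiSymplectic.

Lemma gi_involutive (H N : Type) (G : groupoid H N) (g : H) : gi G (gi G g) = g.
Proof.
rewrite -[LHS](gm_er G) gs_i gt_i -(gm_il G g) -gmA ?gs_i ?gt_i //.
by rewrite gm_il gs_i gm_el.
Qed.

Section Pull2.
Context {R : realType}.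

Lemma pull2_comp (X Y Z : smooth_space R) (f : Y -> Z) (g : X -> Y) (w : form2 Z) x u v :
  smooth_map f -> pull2 g (pull2 f w) x u v = pull2 (fun x => f (g x)) w x u v.
Proof. by move=> sf; rewrite /pull2 !tmap_tmap. Qed.

Lemma d2_zero (M : smooth_space R) X Y Z (x : M) : smclosed M ->
  is_field X -> is_field Y -> is_field Z -> d2 (@zero_form2 R M) X Y Z x = 0.
Proof.
move=> cM [tX _] [tY _] [tZ _]; rewrite /d2 /zero_form2.
by rewrite (tangent_cst 0 cM (tX x)) (tangent_cst 0 cM (tY x)) (tangent_cst 0 cM (tZ x)) !subr0 !addr0.
Qed.

Lemma tangent_dim0 (M : smooth_space R) (x : M) v : manifold 0 M -> tangent x v -> v = 0.
Proof.
move=> mM tv; have [chi [B [_ _ _ /(_ v tv) ->]]] := tangent_basis x mM.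
by rewrite big_ord0.
Qed.

End Pull2.

(** * Morphisms from a Lie groupoid to a Lie group *)

Section GroupMorphism.
Context {R : realType} (nH nN k nD : nat) (H N D : smooth_space R) (GH : groupoid H N).
Context (GD : groupoid D (spoint R)) (Phi : H -> D).
Hypotheses (lH : lie_groupoid nH nN GH) (dH : nH = (nN + k)%N) (lD : lie_group nD GD).
Hypotheses (sPhi : smooth_map Phi) (mPhi : Defs.multiplicative GH GD Phi).

Let mH : manifold nH H. Proof. by case: lH. Qed.
Let mN : manifold nN N. Proof. by case: lH. Qed.
Let mD : manifold nD D. Proof. by case: lD. Qed.
Let cH : smclosed H. Proof. exact: manifold_smclosed mH. Qed.
Let cN : smclosed N. Proof. exact: manifold_smclosed mN. Qed.
Let cD : smclosed D. Proof. exact: manifold_smclosed mD. Qed.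
Let scH : smcontinuous H. Proof. exact: diffeo_smcontinuous mH. Qed.
Let scD : smcontinuous D. Proof. exact: diffeo_smcontinuous mD. Qed.
Let s1 : smooth_map (@cpr1 R H N GH). Proof. exact: (@smooth_fpr1 R H H N (gs GH) (gt GH)). Qed.
Let s2 : smooth_map (@cpr2 R H N GH). Proof. exact: (@smooth_fpr2 R H H N (gs GH) (gt GH)). Qed.
Let scC : smcontinuous (composable GH).
Proof. exact: (diffeo_smcontinuous (composable_manifold lH dH)). Qed.
Let cC : smclosed (composable GH). Proof. exact: (@fiber_smclosed R H H N (gs GH) (gt GH)). Qed.

Lemma smooth_cmap : smooth_map (@cmap R H N D GH Phi).
Proof.
have p1 := smooth_comp sPhi s1; have p2 := smooth_comp sPhi s2.
apply: (smooth_to_sprod cC (X := D) (Y := D) (f := @cmap R H N D GH Phi) _ p1 p2).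
apply: continuous_to_prod; first exact: (smooth_continuous scC mD p1).
exact: (smooth_continuous scC mD p2).
Qed.

Lemma tmap_unit x v : tangent x v -> tmap Phi (tmap (ge GH) v) = 0.
Proof.
move=> tv; rewrite tmap_tmap //.
have -> : (fun y => Phi (ge GH y)) = fun=> gone GD.
  by apply/funext => y; exact: (multiplicative_unit mPhi).
exact: (tmap_cst _ cN tv).
Qed.

Let cpush (q : composable GH) : composable GD :=
  cmk (spoint_eq (gs GD (Phi (cpr1 q))) (gt GD (Phi (cpr2 q)))).

Let smooth_cpush : smooth_map cpush.
Proof.
exact: (smooth_to_composable lD (h := cpush) cC scC (smooth_comp sPhi s1) (smooth_comp sPhi s2)).
Qed.

(* [W] is (T Phi a, 0) at (1, Phi h). *)
Lemma push_right_translate h a : algebroid GH (gt GH h) a ->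
  exists u W, [/\ tangent h u, tmap (gs GH) u = 0,
    forall p : composable GD, cpr1 p = gone GD -> cpr2 p = Phi h -> tangent p W,
    tmap (@cpr1 R D (spoint R) GD) W = tmap Phi a /\ tmap (@cpr2 R D (spoint R) GD) W = 0 &
    tmap (@cmul R D (spoint R) GD) W = tmap Phi u].
Proof.
move=> aa; have [w [tw w1 w2 tu]] := right_translate lH dH aa.
have sS : smooth_map (gs GH) by case: lH => _ _ [].
have sM : smooth_map (@cmul R H N GH) by case: lH => _ _ _ _ [].
have sMD : smooth_map (@cmul R D (spoint R) GD) by case: lD => _ _ _ _ [].
have sD1 := @smooth_fpr1 R D D (spoint R) (gs GD) (gt GD).
have sD2 := @smooth_fpr2 R D D (spoint R) (gs GD) (gt GD).
exists (tmap (@cmul R H N GH) w), (tmap cpush w); split=> //.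
- by rewrite (tmap_gs_cmul lH tw) w2 tmap0.
- move=> p p1 p2; have -> : p = cpush (left_unit GH h).
    apply: (@fiber_product_eq R D D (spoint R) (gs GD) (gt GD)).
      by rewrite -[LHS]/(cpr1 p) p1 -[RHS]/(Phi (ge GH (gt GH h))) (multiplicative_unit mPhi).
    by rewrite -[LHS]/(cpr2 p) p2.
  exact: (tangent_tmap (@fiber_smclosed R D D (spoint R) (gs GD) (gt GD)) smooth_cpush tw).
- split; rewrite (tmap_tmap _ _ sD1) || rewrite (tmap_tmap _ _ sD2).
    by rewrite -w1 tmap_tmap.
  by rewrite -[RHS](tmap0 Phi) -w2 tmap_tmap.
- rewrite !tmap_tmap //; congr (tmap _ w).
  by apply/funext => q; rewrite /cmul -mPhi ?cprE.
Qed.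

End GroupMorphism.

(** * Reduction *)

Section Reduction.
Context {R : realType} (V : vectType R) (br : V -> V -> V) (pr : V -> V -> R^o).
Hypothesis qV : quadratic_lie_algebra br pr.
Context (nD : nat) (D : smooth_space R) (GD : groupoid D (spoint R))
  (Omega : form2 (sprod D D)) (Theta : form3 D) (j : {linear V -> tvec D}).
Hypotheses (hD : shifted_symplectic_group GD Omega Theta nD)
  (hj : integrates_quadratic GD Omega br pr j).
Context (nH nN : nat) (H N : smooth_space R) (GH : groupoid H N) (Phi : H -> D)
  (sigma : form2 H).
Hypothesis hPhi : lagrangian_morphism GD Omega Theta nH nN nD GH Phi sigma (@zero_form3 R N).
Context (l : {vspace V}).
Hypothesis hl : lagrangian_subalgebra br pr l.
Context (nL : nat) (L : smooth_space R) (GL : groupoid L (spoint R)) (phi : L -> D)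
  (jL : {linear V -> tvec L}).
Hypotheses (hjL : lie_algebra_iso br l GL jL)
  (hphil : forall u, u \in l -> tmap phi (jL u) = j u)
  (hphi : lagrangian_morphism GD Omega Theta nL 0 nD GL phi
              (@zero_form2 R L) (@zero_form3 R (spoint R)))
  (htrans : transverse Phi phi).
Hypotheses (mPhi : Defs.multiplicative GH GD Phi) (mphi : Defs.multiplicative GL GD phi).

Local Notation F := (fiber_product Phi phi).
Local Notation G_L := (fiber_product_groupoid mPhi mphi).
Local Notation f1 := (@fpr1 R H L D Phi phi).
Local Notation f2 := (@fpr2 R H L D Phi phi).
Local Notation sigma_L := (pull2 f1 sigma).

Let lD : lie_group nD GD. Proof. by case: hD. Qed.
Let fO : is_form2 Omega. Proof. by case: hD. Qed.
Let lH : lie_groupoid nH nN GH. Proof. by case: hPhi. Qed.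
Let lL : lie_group nL GL. Proof. by case: hphi. Qed.
(** Over a point the dimension condition on phi reads 2 nL = nD. Hence nH = 2 nN + nL, the algebroid
    of H has rank nN + nL, and the fiber product gets dimension nH + nL - nD = 2 nN. *)
Let dH : nH = (nN + (nN + nL))%N.
Proof. by case: hPhi => _ _ _ _ [d1 _]; case: hphi => _ _ _ _ [d2 _]; lia. Qed.
Let dF : (nH + nL = nD + 2 * nN)%N.
Proof. by case: hPhi => _ _ _ _ [d1 _]; case: hphi => _ _ _ _ [d2 _]; lia. Qed.
Let sPhi : smooth_map Phi. Proof. by case: hPhi => _ []. Qed.
Let sphi : smooth_map phi. Proof. by case: hphi => _ []. Qed.
Let fs : is_form2 sigma. Proof. by case: hPhi => _ _ []. Qed.
Let mH : manifold nH H. Proof. by case: lH. Qed.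
Let mN : manifold nN N. Proof. by case: lH. Qed.
Let mD : manifold nD D. Proof. by case: lD. Qed.
Let mL : manifold nL L. Proof. by case: lL. Qed.
Let cH : smclosed H. Proof. exact: manifold_smclosed mH. Qed.
Let cN : smclosed N. Proof. exact: manifold_smclosed mN. Qed.
Let cD : smclosed D. Proof. exact: manifold_smclosed mD. Qed.
Let cL : smclosed L. Proof. exact: manifold_smclosed mL. Qed.
Let scH : smcontinuous H. Proof. exact: diffeo_smcontinuous mH. Qed.
Let scN : smcontinuous N. Proof. exact: diffeo_smcontinuous mN. Qed.
Let scD : smcontinuous D. Proof. exact: diffeo_smcontinuous mD. Qed.
Let scL : smcontinuous L. Proof. exact: diffeo_smcontinuous mL. Qed.
Let cF : smclosed F. Proof. exact: fiber_smclosed. Qed.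
Let scF : smcontinuous F. Proof. exact: fiber_smcontinuous. Qed.
Let s1 : smooth_map f1. Proof. exact: smooth_fpr1. Qed.
Let s2 : smooth_map f2. Proof. exact: smooth_fpr2. Qed.
Let sS : smooth_map (gs GH). Proof. by case: lH => _ _ []. Qed.
Let sT : smooth_map (gt GH). Proof. by case: lH => _ _ _ []. Qed.
Let sE : smooth_map (ge GH). Proof. by case: lH => _ _ _ _ []. Qed.
Let sI : smooth_map (gi GH). Proof. by case: lH => _ _ _ _ []. Qed.
Let sIL : smooth_map (gi GL). Proof. by case: lL => _ _ _ _ []. Qed.
Let sM : smooth_map (@cmul R H N GH). Proof. by case: lH => _ _ _ _ []. Qed.
Let sML : smooth_map (@cmul R L (spoint R) GL). Proof. by case: lL => _ _ _ _ []. Qed.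
Let sMD : smooth_map (@cmul R D (spoint R) GD). Proof. by case: lD => _ _ _ _ []. Qed.
Let mF : manifold (2 * nN) F.
Proof. exact: (fiber_manifold mH mL mD sPhi sphi htrans dF). Qed.

Let smooth_to_F (M : smooth_space R) (h : M -> F) : smclosed M -> smcontinuous M ->
  smooth_map (fun t => fpr1 (h t)) -> smooth_map (fun t => fpr2 (h t)) -> smooth_map h.
Proof.
move=> cM scM h1 h2; apply: (smooth_to_fiber cM) => //.
  exact: (smooth_continuous scM mH h1).
exact: (smooth_continuous scM mL h2).
Qed.

Let F_tangent (p : F) u v : tangent (fpr1 p) u -> tangent (fpr2 p) v ->
  tmap Phi u = tmap phi v ->
  exists w, [/\ tangent p w, tmap f1 w = u & tmap f2 w = v].
Proof. exact: (fiber_tangent mH mL mD sPhi sphi htrans dF). Qed.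

(* The component in H can be corrected by units, on which T Phi vanishes. *)
Let unit_split x z : tangent (gone GD) z ->
  exists a b, [/\ algebroid GH x a, tangent (gone GL) b & z = tmap Phi a + tmap phi b].
Proof.
move=> tz; have e1 := multiplicative_unit mPhi x.
have e2 : phi (gone GL) = gone GD := multiplicative_unit mphi 0.
have [|a [b [ta tb E]]] := htrans (etrans e1 (esym e2)) (w := z); first by rewrite e1.
have tsa : tangent x (tmap (gs GH) a) by have := tangent_tmap cN sS ta; rewrite gs_e.
exists (a - tmap (ge GH) (tmap (gs GH) a)), b; split=> //.
  split; last by rewrite tmapB (tmap_gs_ge lH tsa) subrr.
  by apply: tangent_sub => //; exact: tangent_tmap.
by rewrite E tmapB (tmap_unit lH sPhi mPhi tsa) subr0.
Qed.

(* [z] is the product of its right translate to 1 with the zero vector at d. *)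
Let translate_split h y z : Phi h = phi y -> tangent (Phi h) z ->
  exists u v, [/\ tangent h u, tangent y v, tmap (gs GH) u = 0 & z = tmap Phi u + tmap phi v].
Proof.
move=> E tz; set d := Phi h in E tz *.
have P := @spoint_eq R.
have sD1 := @smooth_fpr1 R D D (spoint R) (gs GD) (gt GD).
have sD2 := @smooth_fpr2 R D D (spoint R) (gs GD) (gt GD).
pose r k : composable GD := cmk (P (gs GD k) (gt GD (gi GD d))).
have sr : smooth_map r.
  apply: (smooth_to_composable lD (h := r) cD scD); [exact: smooth_id|exact: smooth_cst].
(* q k = (k d^-1, d): the product of its entries is k, the first entry at k = d is the unit, and the
   second is constant. *)
pose q k : composable GD := cmk (P (gs GD (cmul (r k))) (gt GD d)).
have sq : smooth_map q.
  apply: (smooth_to_composable lD (h := q) cD scD); last exact: smooth_cst.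
  exact: smooth_comp sMD sr.
have q1 : cpr1 (q d) = gone GD.
  rewrite -[LHS]/(gm GD d (gi GD d)) gm_ir /gone; congr (ge GD _); exact: P.
have tqz : tangent (q d) (tmap q z).
  exact: (tangent_tmap (@fiber_smclosed R D D (spoint R) (gs GD) (gt GD)) sq tz).
have tz1 : tangent (gone GD) (tmap (@cpr1 R D (spoint R) GD) (tmap q z)).
  by have := tangent_tmap cD sD1 tqz; rewrite -[fpr1 _]/(cpr1 (q d)) q1.
have [a [b [aa tb Eab]]] := unit_split (gt GH h) tz1.
have [u [W [tu su tW [W1 W2] W3]]] := push_right_translate lH dH lD sPhi mPhi aa.
(* Over a point every tangent vector at the unit belongs to the algebroid, as T s takes values in a
   zero-dimensional space. *)
have ab : algebroid GL (gt GL y) b.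
  split; first by rewrite (P (gt GL y) 0).
  have [_ mP [sSL _] _ _] := lL; apply: (tangent_dim0 mP).
  by apply: (tangent_tmap (euclid_smclosed (n := 0)) sSL tb).
have [v [W' [tv sv tW' [W'1 W'2] W'3]]] := push_right_translate lL (k := nL) (erefl _) lD sphi mphi ab.
exists u, v; split=> //.
have twW : tangent (q d) W by apply: tW.
have twW' : tangent (q d) W' by apply: tW'.
have EW : tmap q z = W + W'.
  apply: (composable_tangent_inj lD (k := nD) (erefl _) tqz (tangent_add twW twW')).
    by rewrite tmapD W1 W'1.
  rewrite tmapD W2 W'2 addr0 (tmap_tmap _ _ sD2).
  exact: (tmap_cst d cD tz).
rewrite -W3 -W'3 -tmapD -EW (tmap_tmap _ _ sMD) -{1}(tmap_id tz); congr (tmap _ z).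
apply/funext => k; rewrite /cmul -[cpr1 _]/(gm GD k (gi GD d)) -[cpr2 _]/d.
rewrite gmA ?gm_il; [|exact: P|exact: P].
by rewrite (P (gs GD d) (gs GD k)) gm_er.
Qed.

Let submersion_gs : submersion (gs G_L).
Proof.
split; first exact: smooth_comp sS s1.
move=> p w tw; have [_ _ [_ bS] _ _] := lH.
have [u0 tu0 Eu0] := bS (fpr1 p) w tw.
(* u0 lifts w to H alone. Subtracting u, which lies in ker T s, keeps its image w and leaves T Phi
   (u0 - u) = T phi v, so that (u0 - u, v) is tangent to the fiber product. *)
have [u [v [tu tv su E]]] := translate_split (fiber_productE p) (tangent_tmap cD sPhi tu0).
have [||z [tz z1 z2]] := @F_tangent p (u0 - u) v _ tv; first exact: tangent_sub.
  by rewrite tmapB E addrAC subrr add0r.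
exists z => //; rewrite -[gs G_L]/(fun p => gs GH (f1 p)) -tmap_tmap // z1.
by rewrite tmapB su subr0.
Qed.

Let smooth_gi : smooth_map (gi G_L).
Proof.
apply: smooth_to_F => //; [exact: smooth_comp sI s1|exact: smooth_comp sIL s2].
Qed.

Let submersion_gt : submersion (gt G_L).
Proof.
split; first exact: smooth_comp sT s1.
move=> p w tw; have [sS' bS] := submersion_gs.
have [|u tu Eu] := bS (gi G_L p) w; first by rewrite gs_i.
exists (tmap (gi G_L) u).
  by have := tangent_tmap cF smooth_gi tu; rewrite gi_involutive.
rewrite tmap_tmap; last exact: smooth_comp sT s1.
by rewrite -Eu; congr (tmap _ u); apply/funext => q; exact: gt_i.
Qed.

Let cC : smclosed (composable G_L).
Proof. exact: ssub_smclosed. Qed.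
Let scC : smcontinuous (composable G_L).
Proof. exact: (ssub_smcontinuous (sprod_smcontinuous scF scF)). Qed.
Let p1 : smooth_map (@cpr1 R F N G_L). Proof. exact: (smooth_comp (@smooth_fst R F F) (@smooth_val R (sprod F F) _)). Qed.
Let p2 : smooth_map (@cpr2 R F N G_L). Proof. exact: (smooth_comp (@smooth_snd R F F) (@smooth_val R (sprod F F) _)). Qed.

Let c1 (q : composable G_L) : composable GH :=
  @cmk R H N GH (fpr1 (cpr1 q)) (fpr1 (cpr2 q)) (cprE q).
Let c2 (q : composable G_L) : composable GL :=
  cmk (spoint_eq (gs GL (fpr2 (cpr1 q))) (gt GL (fpr2 (cpr2 q)))).

Let sc1 : smooth_map c1.
Proof.
exact: (smooth_to_composable lH (h := c1) cC scC (smooth_comp s1 p1) (smooth_comp s1 p2)).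
Qed.
Let sc2 : smooth_map c2.
Proof.
exact: (smooth_to_composable lL (h := c2) cC scC (smooth_comp s2 p1) (smooth_comp s2 p2)).
Qed.

Let fpr1_cmul : (fun q : composable G_L => fpr1 (cmul q)) = (fun q => cmul (c1 q)).
Proof. by apply/funext => q; rewrite /cmul [gm _ _ _]/(fp_m _ _ _ _) fp_m1 //; exact: (cprE q). Qed.
Let fpr2_cmul : (fun q : composable G_L => fpr2 (cmul q)) = (fun q => cmul (c2 q)).
Proof. by apply/funext => q; rewrite /cmul [gm _ _ _]/(fp_m _ _ _ _) fp_m2 //; exact: (cprE q). Qed.

Let smooth_cmul : smooth_map (@cmul R F N G_L).
Proof.
apply: smooth_to_F => //.
  by rewrite fpr1_cmul; exact: smooth_comp sM sc1.
by rewrite fpr2_cmul; exact: smooth_comp sML sc2.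
Qed.

Let smooth_ge : smooth_map (ge G_L).
Proof. by apply: smooth_to_F => //; exact: (smooth_cst (gone GL) cN). Qed.

Let lie_G_L : lie_groupoid (2 * nN) nN G_L.
Proof. by split. Qed.

Let PhiE : (fun p : F => Phi (fpr1 p)) = (fun p => phi (fpr2 p)).
Proof. by apply/funext => p; exact: fiber_productE. Qed.

Let fsL : is_form2 sigma_L.
Proof. exact: (pull2_form mF mH s1 fs). Qed.

(** Fields on the fiber product do not descend to H or L. Each is replaced by fields on H and on L
    with the projected values at the one point p, which [d2_pull2] permits. *)
Let closed_sigma_L : closed2 sigma_L.
Proof.
move=> X Y Z fX fY fZ p; have [tX _] := fX; have [tY _] := fY; have [tZ _] := fZ.
have ext1 (U : vfield F) : is_field U -> exists2 U' : vfield H, is_field U' & U' (fpr1 p) = tmap f1 (U p).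
  by move=> [tU _]; apply: (field_extend mH); exact: tangent_tmap.
have ext2 (U : vfield F) : is_field U -> exists2 U' : vfield L, is_field U' & U' (fpr2 p) = tmap f2 (U p).
  by move=> [tU _]; apply: (field_extend mL); exact: tangent_tmap.
have [X1 fX1 EX1] := ext1 X fX; have [Y1 fY1 EY1] := ext1 Y fY; have [Z1 fZ1 EZ1] := ext1 Z fZ.
have [X2 fX2 EX2] := ext2 X fX; have [Y2 fY2 EY2] := ext2 Y fY; have [Z2 fZ2 EZ2] := ext2 Z fZ.
rewrite (d2_pull2 mF mH s1 fs fX fY fZ fX1 fY1 fZ1 EX1 EY1 EZ1).
have [_ _ _ [_ H1] _] := hPhi; have [_ _ _ [_ H2] _] := hphi.
have := H2 X2 Y2 Z2 fX2 fY2 fZ2 (fpr2 p); rewrite d2_zero //.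
have := H1 X1 Y1 Z1 fX1 fY1 fZ1 (fpr1 p).
have Ef U : tmap Phi (tmap f1 U) = tmap phi (tmap f2 U) by rewrite !tmap_tmap // PhiE.
rewrite /pull3 EX1 EY1 EZ1 EX2 EY2 EZ2 !Ef fiber_productE => <-.
rewrite /zero_form3 !subr0 sub0r => /eqP.
by rewrite eq_sym oppr_eq0 => /eqP.
Qed.

Let mult_sigma_L (p : composable G_L) u v : tangent p u -> tangent p v ->
  pull2 (@cmul R F N G_L) sigma_L p u v =
  pull2 (@cpr1 R F N G_L) sigma_L p u v + pull2 (@cpr2 R F N G_L) sigma_L p u v.
Proof.
move=> tu tv.
have t1u : tangent (c1 p) (tmap c1 u) by exact: (tangent_tmap (ssub_smclosed (A := _)) sc1 tu).
have t1v : tangent (c1 p) (tmap c1 v) by exact: (tangent_tmap (ssub_smclosed (A := _)) sc1 tv).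
have t2u : tangent (c2 p) (tmap c2 u) by exact: (tangent_tmap (ssub_smclosed (A := _)) sc2 tu).
have t2v : tangent (c2 p) (tmap c2 v) by exact: (tangent_tmap (ssub_smclosed (A := _)) sc2 tv).
have [_ _ _ [H1 _] _] := hPhi; have [_ _ _ [H2 _] _] := hphi.
have q1 : smooth_map (@cpr1 R H N GH) by exact: (@smooth_fpr1 R H H N (gs GH) (gt GH)).
have q2 : smooth_map (@cpr2 R H N GH) by exact: (@smooth_fpr2 R H H N (gs GH) (gt GH)).
have E1 := H1 _ _ _ t1u t1v; have E2 := H2 _ _ _ t2u t2v.
have zero (f : composable GL -> L) x u' v' : pull2 f (@zero_form2 R L) x u' v' = 0 by [].
rewrite !zero subr0 addr0 in E2.
have scm1 := smooth_cmap lH dH lD sPhi; have scm2 := smooth_cmap lL (k := nL) (erefl _) lD sphi.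
have C12 : (fun q => cmap Phi (c1 q)) = (fun q => cmap phi (c2 q)).
  by apply/funext => q; rewrite /cmap -[cpr1 (c1 q)]/(fpr1 (cpr1 q)) -[cpr2 (c1 q)]/(fpr1 (cpr2 q)) !fiber_productE.
have E : pull2 (cmap Phi (G := GH)) Omega (c1 p) (tmap c1 u) (tmap c1 v) = 0.
  transitivity (pull2 c1 (pull2 (cmap Phi (G := GH)) Omega) p u v) => //.
  rewrite (pull2_comp _ _ _ _ _ scm1) C12.
  by rewrite -[LHS](pull2_comp c2 Omega p u v scm2) [RHS]E2.
rewrite E in E1; move/eqP: E1; rewrite subr_eq0 => /eqP E1.
rewrite !(pull2_comp _ _ _ _ _ s1) fpr1_cmul.
have PC (f : composable GH -> H) (sf : smooth_map f) : pull2 (fun q => f (c1 q)) sigma p u v =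
    pull2 f sigma (c1 p) (tmap c1 u) (tmap c1 v) by exact: esym (pull2_comp c1 sigma p u v sf).
by rewrite (PC _ sM) -E1 -(PC _ q1) -(PC _ q2).
Qed.

Let smooth_inl : smooth_map (fun k : D => spair k (gone GD)).
Proof.
apply: (smooth_to_sprod cD (X := D) (Y := D)); first by apply: continuous_to_prod;
  [exact: (smooth_continuous scD mD (@smooth_id _ D))|exact: cst_continuous].
  exact: smooth_id.
exact: smooth_cst.
Qed.

Let smooth_inr : smooth_map (fun k : D => spair (gone GD) k).
Proof.
apply: (smooth_to_sprod cD (X := D) (Y := D)); first by apply: continuous_to_prod;
  [exact: cst_continuous|exact: (smooth_continuous scD mD (@smooth_id _ D))].
  exact: smooth_cst.
exact: smooth_id.
Qed.

(** Phi sends units to 1, so the defect in [unit_form] becomes Omega at (1, 1) on (T Phi a, 0) and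
    (0, T Phi v), a summand of [pairing_of] up to sign. *)
Let units_pair x a v : algebroid GH x a -> tangent (ge GH x) v ->
  sigma (ge GH x) a v = lambda GH sigma x a (tmap (gt GH) v) -
    Omega (spair (gone GD) (gone GD)) (tmap (fun k : D => spair k (gone GD)) (tmap Phi a))
      (tmap (fun k : D => spair (gone GD) k) (tmap Phi v)).
Proof.
move=> aa tv; have [_ _ _ [H1 _] _] := hPhi.
rewrite (unit_form lH (C := pull2 (cmap Phi (G := GH)) Omega) fs H1 aa tv); congr (_ - _).
have scm := smooth_cmap lH dH lD sPhi.
have sl := smooth_inl; have sr := smooth_inr.
rewrite /pull2 !tmap_tmap //.
have -> : cmap Phi (right_unit GH (ge GH x)) = spair (gone GD) (gone GD).
  rewrite /cmap -[cpr1 _]/(ge GH x) -[cpr2 _]/(ge GH (gs GH (ge GH x))).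
  by rewrite !(multiplicative_unit mPhi).
congr (Omega _ (tmap _ a) (tmap _ v)); apply/funext => g.
  by rewrite /cmap -[cpr1 _]/g -[cpr2 _]/(ge GH (gs GH g)) (multiplicative_unit mPhi).
by rewrite /cmap -[cpr1 _]/(ge GH (gt GH g)) -[cpr2 _]/g (multiplicative_unit mPhi).
Qed.

Let tunit (s : D -> sprod D D) (z : tvec D) : smooth_map s -> tangent (gone GD) z ->
  tangent (s (gone GD)) (tmap s z).
Proof. by move=> ss tz; exact: (tangent_tmap (@sprod_smclosed R D D) ss tz). Qed.

Let tPhi x a : algebroid GH x a -> tangent (gone GD) (tmap Phi a).
Proof.
by move=> [ta _]; have := tangent_tmap cD sPhi ta; rewrite (multiplicative_unit mPhi).
Qed.

Let isotropy x a b : algebroid GH x a -> algebroid GH x b ->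
  lambda GH sigma x a (tmap (gt GH) b) + lambda GH sigma x b (tmap (gt GH) a) =
  - pairing_of GD Omega (tmap Phi a) (tmap Phi b).
Proof.
move=> aa ab; have [ta _] := aa; have [tb _] := ab.
have E1 := units_pair aa tb; have E2 := units_pair ab ta.
rewrite /pairing_of.
rewrite (form2_anti fO (tunit smooth_inr (tPhi aa)) (tunit smooth_inl (tPhi ab))).
have := form2_anti fs ta tb; rewrite E1 E2 => /eqP; rewrite -subr_eq0 => /eqP E.
apply/eqP; rewrite -subr_eq0 -E; apply/eqP; ring.
Qed.

Let jinj v : j v = 0 -> v = 0.
Proof. by case: hj => -[_ J _ _] _; apply: J; rewrite memvf. Qed.

Let jsurj z : tangent (gone GD) z -> exists v, j v = z.
Proof. by case: hj => -[_ _ J _] _ /J [v _ E]; exists v. Qed.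

Let tmap_gsL u : tmap (gs G_L) u = tmap (gs GH) (tmap f1 u).
Proof. by rewrite tmap_tmap. Qed.

Let tmap_gtL u : tmap (gt G_L) u = tmap (gt GH) (tmap f1 u).
Proof. by rewrite tmap_tmap. Qed.

Let tPhif u : tmap Phi (tmap f1 u) = tmap phi (tmap f2 u).
Proof. by rewrite !tmap_tmap // PhiE. Qed.

(** Let a and [jL v] be the components of u. Isotropy together with [lam0] makes v orthogonal to the
    image of the algebroid of H; lying in l, it is orthogonal to l as well. By transversality at 1
    these two span, so v = 0. Then a is in the kernels of T Phi, T s, T t and, by [units_pair], of
    sigma, where the lagrangian condition gives a = 0. *)
Let nondeg_sigma_L x u : tangent (ge G_L x) u -> tmap (gs G_L) u = 0 ->
  (forall v, tangent (ge G_L x) v -> sigma_L (ge G_L x) u v = 0) ->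
  tmap (gt G_L) u = 0 -> u = 0.
Proof.
move=> tu su0 wu0 tu0; have [j1 j2 j3 _] := hjL; have [_ pE] := hj; have [_ lE] := hl.
have [_ [pl psym _ pnd]] := qV.
pose a := tmap f1 u; pose k := tmap f2 u.
have ta : tangent (ge GH x) a by exact: (tangent_tmap cH s1 tu).
have tk : tangent (gone GL) k by exact: (tangent_tmap cL s2 tu).
have sa : tmap (gs GH) a = 0 by rewrite -tmap_gsL.
have Ta : tmap (gt GH) a = 0 by rewrite -tmap_gtL.
have aa : algebroid GH x a by [].
have [v vl Ev] := j3 _ tk.
have Ea : tmap Phi a = j v by rewrite tPhif -/k -Ev hphil.
have W b m : tangent (ge GH x) b -> tangent (gone GL) m -> tmap Phi b = tmap phi m ->
    sigma (ge GH x) a b = 0.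
  move=> tb tm E; have [z [tz <- _]] := @F_tangent (ge G_L x) b m tb tm E.
  exact: wu0.
(* For y tangent to N, the pair (T e y, 0) is tangent to the fiber product because Phi is constant
   on units. *)
have lam0 y : tangent x y -> lambda GH sigma x a y = 0.
  move=> ty; apply: (W _ 0); [exact: tangent_tmap|exact: tangent0|].
  by rewrite (tmap_unit lH sPhi mPhi ty) tmap0.
have v0 : v = 0.
  apply: pnd => z; have tjz : tangent (gone GD) (j z).
    by case: hj => -[J _ _ _] _; apply: J; rewrite memvf.
  have [b [m [ab tm Ez]]] := unit_split x tjz.
  have [b' Eb] := jsurj (tPhi ab); have [m' m'l Em] := j3 _ tm.
  have -> : z = b' + m'.
    by apply/eqP; rewrite -subr_eq0; apply/eqP/jinj; rewrite linearB linearD /= Ez -Em hphil // Eb subrr.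
  have := pl v 1 b' m'; rewrite scale1r => ->.
  have -> : pr v m' = 0 by exact: (proj1 (lE v) vl).
  rewrite mul1r addr0 -pE -Ea Eb.
  have := isotropy aa ab; rewrite Ta lam0; last first.
    by have [tb _] := ab; have := tangent_tmap cN sT tb; rewrite gt_e.
  have -> : lambda GH sigma x b 0 = 0.
    by apply: (covector0 (x := x)); exact: (covector_lambda lH fs ab).
  by rewrite addr0 => /eqP; rewrite eq_sym oppr_eq0 => /eqP.
have Phia : tmap Phi a = 0 by rewrite Ea v0 linear0.
have a0 : a = 0.
  have [_ _ _ _ [_ nd]] := hPhi; apply: (nd (ge GH x)) => // b tb.
  rewrite (units_pair aa tb) lam0; last by have := tangent_tmap cN sT tb; rewrite gt_e.
  rewrite Phia tmap0 sub0r; apply/eqP; rewrite oppr_eq0; apply/eqP.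
  have [_ w2 _ _] := fO; apply: (covector0 (w2 _ _ _)); apply: tunit => //.
  by have := tangent_tmap cD sPhi tb; rewrite (multiplicative_unit mPhi).
apply: (fiber_tangent_inj mH mL mD sPhi sphi htrans dF tu (tangent0 _)).
  by rewrite -/a a0 tmap0.
by rewrite -/k -Ev v0 linear0 tmap0.
Qed.

Lemma reduced_quasi_symplectic : quasi_symplectic_groupoid nN G_L sigma_L.
Proof. by split=> //; exact: nondeg_sigma_L. Qed.

(** The component in L of an algebroid vector of the reduced groupoid is the required element of l.
    Conversely, an element of l and a vector of the algebroid of H with the same image in T_1 D lift
    together to the fiber product. *)
Lemma reduced_groupoid_dirac :
  groupoid_dirac G_L sigma_L = reduced_dirac j l GH Phi sigma.
Proof.
have [j1 j2 j3 _] := hjL.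
have lamE x u y : lambda G_L sigma_L x u y = lambda GH sigma x (tmap f1 u) y.
  by rewrite /lambda /pull2 (tmap_tmap _ _ s1).
apply/funext => x; apply/seteqP; split=> [e [fe [u [tu su] [e1 e2]]]|e [v vl [fe [a aa [[e1 e2] Ev]]]]].
  have tk : tangent (gone GL) (tmap f2 u) by exact: (tangent_tmap cL s2 tu).
  have [v vl Ev] := j3 _ tk; exists v => //; split=> //.
  exists (tmap f1 u); first by split; [exact: (tangent_tmap cH s1 tu)|rewrite -tmap_gsL].
  split; last by rewrite tPhif -Ev hphil.
  split=> [|y ty] /=; first by rewrite e1 /anchor /= tmap_gtL.
  by rewrite e2 //= lamE.
have [ta sa] := aa; rewrite /= in Ev.
have [||z [tz z1 z2]] := @F_tangent (ge G_L x) a (jL v) ta; first exact: j1.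
  by rewrite hphil.
split=> //; exists z; first by split=> //; rewrite tmap_gsL z1.
split=> [|y ty] /=; first by rewrite /anchor tmap_gtL z1.
by rewrite lamE z1; exact: e2.
Qed.

Lemma reduced_dirac_structure : dirac_structure (reduced_dirac j l GH Phi sigma).
Proof.
by rewrite -reduced_groupoid_dirac; exact: quasi_symplectic_dirac reduced_quasi_symplectic.
Qed.

End Reduction.

Theorem proposition5p10 (R : realType)
    (* the Manin pair (V, g) *)
    (V : vectType R) (br : V -> V -> V) (pr : V -> V -> R^o) (g : {vspace V})
    (hVg : manin_pair br pr g)
    (* the 2-shifted symplectic Lie group, with j : V -> Lie(D) *)
    (nD : nat) (D : smooth_space R) (GD : groupoid D (spoint R))
    (Omega : form2 (sprod D D)) (Theta : form3 D)
    (hD : shifted_symplectic_group GD Omega Theta nD)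
    (j : {linear V -> tvec D})
    (hj : integrates_quadratic GD Omega br pr j)
    (* the multiplicative moment map *)
    (nH nN : nat) (H N : smooth_space R) (GH : groupoid H N)
    (Phi : H -> D) (sigma : form2 H)
    (hPhi : multiplicative_moment_map GD Omega Theta nH nN nD j g GH Phi sigma)
    (* the lagrangian subalgebra and phi : L -> D *)
    (l : {vspace V}) (hl : lagrangian_subalgebra br pr l)
    (nL : nat) (L : smooth_space R) (GL : groupoid L (spoint R)) (phi : L -> D)
    (jL : {linear V -> tvec L}) (hjL : lie_algebra_iso br l GL jL)
    (hphil : forall u, u \in l -> tmap phi (jL u) = j u)
    (hphi : lagrangian_morphism GD Omega Theta nL 0 nD GL phi
              (@zero_form2 R L) (@zero_form3 R (spoint R)))
    (htrans : transverse Phi phi) :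
  let L_l := reduced_dirac j l GH Phi sigma in
  let G_L := fiber_product_groupoid (lagrangian_multiplicative (proj1 hPhi))
               (lagrangian_multiplicative hphi) in
  let sigma_L := pull2 (@fpr1 R H L D Phi phi) sigma in
  dirac_structure L_l /\
  quasi_symplectic_groupoid nN G_L sigma_L /\
  groupoid_dirac G_L sigma_L = L_l.
Proof.
have [qV _] := hVg; have lPhi := proj1 hPhi.
move=> L_l G_L sigma_L.
have mPhi := lagrangian_multiplicative lPhi; have mphi := lagrangian_multiplicative hphi.
split; last split.
- exact: (reduced_dirac_structure qV hD hj lPhi hl hjL hphil hphi htrans mPhi mphi).
- exact: (reduced_quasi_symplectic qV hD hj lPhi hl hjL hphil hphi htrans).
- exact: (reduced_groupoid_dirac hD lPhi hjL hphil hphi htrans).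
Qed.
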